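(* Let $S$ be a regular local ring of dimension $d+1$, $f\in S$ a non-zero non-unit, $n\ge 2$ an integer, and $R^\#=S[y]/(f+y^n)$. Then the subcategories $\Sigma_1,\dots,\Sigma_n$ are functorially finite in $\operatorname{MCM}(R^\#)$, that is, every MCM $R^\#$-module $N$ admits both left and right approximations by modules in $\Sigma_k$ for each $k$. Namely, there are short exact sequences $$0 \to \Omega_{R^\#}(N) \to \Omega_{R^\#}(N/y^kN) \to N \to 0$$ and $$0 \to N \to \Omega_{R^\#}\bigl(\Omega_{R^\#}(N)/y^k\Omega_{R^\#}(N)\bigr) \to \Omega_{R^\#}(N) \to 0$$ which are right and left $\Sigma_k$-approximations of $N$, respectively.
   Context: MCM means maximal Cohen-Macaulay, and $\operatorname{MCM}(A)$ is the category of MCM $A$-modules. For a ring $\Gamma$ and a $\Gamma$-module $X$, $\Omega_\Gamma(X)$ denotes an arbitrary first syzygy of $X$, uniquely defined up to projective summands; if $\Gamma$ is commutative local, $\Omega_\Gamma(X)$ is unique up to isomorphism. For $1\le k\le n$ put $A_k=S[y]/(f,y^k)$ and $$\Sigma_k=\operatorname{add}\{\Omega_{R^\#}(M) \mid M \text{ is a MCM } A_k\text{-module}\},$$ where $\operatorname{add}$ denotes closure under isomorphisms, finite direct sums and direct summands. For a full subcategory $\mathcal X$, a right $\mathcal X$-approximation of $N$ is a morphism $q\colon X\to N$ with $X\in\mathcal X$ such that every morphism $X'\to N$ with $X'\in\mathcal X$ factors through $q$; a left $\mathcal X$-approximation of $N$ is a morphism $j\colon N\to X$ with $X\in\mathcal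 X$ such that every morphism $N\to X'$ with $X'\in\mathcal X$ factors through $j$. When a right approximation $q\colon X\to N$ is surjective (resp. a left approximation $j\colon N\to X$ is injective), the whole short exact sequence $0\to\ker q\to X\to N\to 0$ (resp. $0\to N\to X\to\operatorname{cok} j\to 0$) is also called the approximation.
   Formalization: With minimal syzygies the second sequence fails when N has a free summand (N=R^#: Ω(N)=0). So there the outer Ω is a suitable first syzygy, determined up to projective summands; it is the minimal one when N has no free summand. The first sequence holds with minimal syzygies for all N. *)

(* Defs.v *)
From HB Require Import structures.
From mathcomp Require Import all_boot all_algebra.
From mathcomp Require Import generic_quotient ring_quotient boolp.
Set Implicit Arguments.
Unset Strict Implicit.
Unset Printing Implicit Defensive.
Import GRing.Theory.
Local Open Scope ring_scope.
Local Open Scope quotient_scope.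

(* The submodule (s_1, ..., s_r) M of M. For M = A^o it is the ideal of A
   generated by s. *)
Definition seq_mul (A : comPzRingType) (M : lmodType A) (s : seq A) :
    {pred M} :=
  fun x => `[< exists v : 'I_(size s) -> M,
                 x = \sum_(i < size s) s`_i *: v i >].
Arguments seq_mul {A} M s.

Lemma seq_mulP (A : comPzRingType) (M : lmodType A) (s : seq A) (x : M) :
  reflect (exists v : 'I_(size s) -> M, x = \sum_(i < size s) s`_i *: v i)
    (x \in seq_mul M s).
Proof. exact: asboolP. Qed.

Lemma seq_mul_submod (A : comPzRingType) (M : lmodType A) (s : seq A) :
  submod_closed (seq_mul M s).
Proof.
split=> [|a _ _ /seq_mulP[u ->] /seq_mulP[v ->]]; apply/seq_mulP.
  by exists (fun=> 0); rewrite big1 // => i _; rewrite scaler0.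
exists (fun i => a *: u i + v i); rewrite scaler_sumr -big_split /=.
by apply: eq_bigr => i _; rewrite scalerDr !scalerA mulrC.
Qed.

HB.instance Definition _ (A : comPzRingType) (M : lmodType A) (s : seq A) :=
  GRing.isZmodClosed.Build M (seq_mul M s)
    (GRing.submod_closedB (seq_mul_submod M s)).

Section QuotientModule.
Variables (A : comPzRingType) (M : lmodType A) (s : seq A).

(* M / (s_1, ..., s_r) M *)
Definition quot_mod := Quotient.quot (seq_mul M s).
HB.instance Definition _ := GRing.Zmodule.on quot_mod.

Definition quot_mod_proj (x : M) : quot_mod :=
  \pi_(Quotient.quot (seq_mul M s)) x.

Let scale (a : A) (x : quot_mod) : quot_mod :=
  quot_mod_proj (a *: repr (x : Quotient.quot (seq_mul M s))).

Lemma quot_mod_projP (x y : M) :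
  quot_mod_proj x = quot_mod_proj y <-> x - y \in seq_mul M s.
Proof.
split=> [e|]; first by rewrite Quotient.idealrBE; apply/eqP.
by rewrite Quotient.idealrBE => /eqP.
Qed.

Lemma quot_mod_proj_surj (x : quot_mod) : exists u, quot_mod_proj u = x.
Proof. by exists (repr (x : Quotient.quot (seq_mul M s))); exact: reprK. Qed.

Lemma quot_mod_projD : {morph quot_mod_proj : x y / x + y}.
Proof. by move=> x y; rewrite /quot_mod_proj !piE. Qed.

Let scaleE a (x : M) : scale a (quot_mod_proj x) = quot_mod_proj (a *: x).
Proof.
apply/quot_mod_projP; rewrite -scalerBr -[_ *: _]addr0.
apply: (seq_mul_submod M s).2; last exact: (seq_mul_submod M s).1.
by apply/quot_mod_projP; exact: reprK.
Qed.

Let scaleA a b x : scale a (scale b x) = scale (a * b) x.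
Proof. by have [u <-] := quot_mod_proj_surj x; rewrite !scaleE scalerA. Qed.
Let scale1 : left_id 1 scale.
Proof. by move=> x; have [u <-] := quot_mod_proj_surj x; rewrite scaleE scale1r. Qed.
Let scaleDr : right_distributive scale +%R.
Proof.
move=> a x y; have [u <-] := quot_mod_proj_surj x.
have [v <-] := quot_mod_proj_surj y.
by rewrite -quot_mod_projD !scaleE scalerDr quot_mod_projD.
Qed.
Let scaleDl x : {morph scale^~ x : a b / a + b}.
Proof.
move=> a b; have [u <-] := quot_mod_proj_surj x.
by rewrite !scaleE scalerDl quot_mod_projD.
Qed.

HB.instance Definition _ := GRing.Zmodule_isLmodule.Build A quot_mod
  scaleA scale1 scaleDr scaleDl.

Lemma quot_mod_projZ a (x : M) :
  quot_mod_proj (a *: x) = a *: quot_mod_proj x.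
Proof. by rewrite -scaleE. Qed.

Lemma quot_mod_proj_linear : linear quot_mod_proj.
Proof. by move=> a x y; rewrite quot_mod_projD quot_mod_projZ. Qed.
HB.instance Definition _ :=
  GRing.isLinear.Build A M quot_mod _ quot_mod_proj quot_mod_proj_linear.

End QuotientModule.

Section QuotientRing.
Variables (A : comPzRingType) (s : seq A).

(* A / (s_1, ..., s_r). The ideal may be improper: the zero ring is allowed. *)
Definition quot_ring := quot_mod A^o s.
HB.instance Definition _ := GRing.Lmodule.on quot_ring.

Definition quot_ring_proj (x : A) : quot_ring := quot_mod_proj s (x : A^o).

Let mul (x y : quot_ring) : quot_ring :=
  (repr (x : Quotient.quot (seq_mul A^o s)) : A) *: y.

Lemma quot_ring_projP (x y : A) :
  quot_ring_proj x = quot_ring_proj y <-> x - y \in seq_mul A^o s.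
Proof. exact: quot_mod_projP. Qed.

Lemma quot_ring_proj_surj (x : quot_ring) : exists u, quot_ring_proj u = x.
Proof. exact: (@quot_mod_proj_surj A A^o s x). Qed.

Let projD : {morph quot_ring_proj : x y / x + y}.
Proof. exact: (@quot_mod_projD A A^o s). Qed.

Let mulE (x y : A) :
  mul (quot_ring_proj x) (quot_ring_proj y) = quot_ring_proj (x * y).
Proof.
rewrite /mul -[LHS]quot_mod_projZ; apply/quot_ring_projP.
rewrite /GRing.scale /= -mulrBl mulrC -[_ * _]addr0.
apply: (seq_mul_submod A^o s).2; last exact: (seq_mul_submod A^o s).1.
by apply/quot_ring_projP; exact: reprK.
Qed.

Let mulA : associative mul.
Proof.
move=> x y z; have [a <-] := quot_ring_proj_surj x.
have [b <-] := quot_ring_proj_surj y; have [c <-] := quot_ring_proj_surj z.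
by rewrite !mulE mulrA.
Qed.
Let mulC : commutative mul.
Proof.
move=> x y; have [a <-] := quot_ring_proj_surj x.
by have [b <-] := quot_ring_proj_surj y; rewrite !mulE mulrC.
Qed.
Let mul1 : left_id (quot_ring_proj 1) mul.
Proof. by move=> x; have [a <-] := quot_ring_proj_surj x; rewrite mulE mul1r. Qed.
Let mulDl : left_distributive mul +%R.
Proof.
move=> x y z; have [a <-] := quot_ring_proj_surj x.
have [b <-] := quot_ring_proj_surj y; have [c <-] := quot_ring_proj_surj z.
by rewrite -projD !mulE mulrDl projD.
Qed.

HB.instance Definition _ := GRing.Zmodule_isComPzRing.Build quot_ring
  mulA mulC mul1 mulDl.

Lemma quot_ring_proj_zmod_morphism : zmod_morphism quot_ring_proj.
Proof. by move=> x y; exact: (raddfB (quot_mod_proj (M := A^o) s)). Qed.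
HB.instance Definition _ := GRing.isZmodMorphism.Build A quot_ring
  quot_ring_proj quot_ring_proj_zmod_morphism.

Lemma quot_ring_proj_monoid_morphism : monoid_morphism quot_ring_proj.
Proof. by split=> // x y; rewrite -[RHS]mulE. Qed.
HB.instance Definition _ := GRing.isMonoidMorphism.Build A quot_ring
  quot_ring_proj quot_ring_proj_monoid_morphism.

End QuotientRing.

Section Rings.
Variable A : comPzRingType.

Definition nonunit : {pred A} := fun a => `[< ~ exists b, a * b = 1 >].

Definition ideal (I : {pred A}) := submod_closed (I : {pred A^o}).

Definition prime_ideal (p : {pred A}) :=
  [/\ ideal p, 1 \notin p & forall a b, a * b \in p -> a \in p \/ b \in p].

Definition prime_chain (e : nat) (p : 'I_e.+1 -> {pred A}) :=
  (forall i, prime_ideal (p i)) /\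
  (forall i j : 'I_e.+1, (i < j)%N ->
     {subset p i <= p j} /\ exists2 a, a \in p j & a \notin p i).

Definition krull_dim (e : nat) :=
  (exists p : 'I_e.+1 -> {pred A}, prime_chain p) /\
  (forall e' (p : 'I_e'.+1 -> {pred A}), prime_chain p -> (e' <= e)%N).

Definition noetherian :=
  forall I : {pred A}, ideal I -> exists s : seq A, I =i seq_mul A^o s.

(* The maximal ideal is then [nonunit]. *)
Definition local_ring := ideal nonunit.

Definition regular_local_ring (e : nat) :=
  [/\ noetherian, local_ring, krull_dim e &
      exists2 s : seq A, size s = e & nonunit =i seq_mul A^o s].

End Rings.
Arguments nonunit {A}.

Section Modules.
Variable A : comPzRingType.

Definition fin_gen (M : lmodType A) := exists s : seq M, forall x : M,
  exists c : 'I_(size s) -> A, x = \sum_(i < size s) c i *: s`_i.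

Definition regular_sequence (M : lmodType A) (s : seq A) :=
  [/\ {subset s <= nonunit},
      forall i, (i < size s)%N -> forall x : M,
        s`_i *: x \in seq_mul M (take i s) -> x \in seq_mul M (take i s) &
      exists x : M, x \notin seq_mul M s].

Definition depth (M : lmodType A) (e : nat) :=
  (exists2 s, size s = e & regular_sequence M s) /\
  (forall s, regular_sequence M s -> (size s <= e)%N).

(* Over a Noetherian local ring. The zero module is included, as usual when
   MCM modules are to form an additive category. *)
Definition MCM (M : lmodType A) :=
  fin_gen M /\
  ((forall x : M, x = 0) \/ exists2 e, krull_dim A e & depth M e).

Definition surjective (X Y : lmodType A) (g : {linear X -> Y}) :=
  forall y, exists x, g x = y.

Definition short_exact (X Y Z : lmodType A)
    (i : {linear X -> Y}) (q : {linear Y -> Z}) :=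
  [/\ injective i, forall y, q y = 0 <-> exists x, i x = y & surjective q].

Definition projective (P : lmodType A) :=
  forall (X Y : lmodType A) (g : {linear X -> Y}) (h : {linear P -> Y}),
    surjective g -> exists l : {linear P -> X}, forall p, g (l p) = h p.

(* Z is a first syzygy of X. *)
Definition syzygy (X Z : lmodType A) :=
  exists (P : lmodType A) (i : {linear Z -> P}) (q : {linear P -> X}),
    [/\ fin_gen P, projective P & short_exact i q].

(* Over a local ring with maximal ideal m: Z is the kernel of a projective
   cover P -> X, i.e. Z is contained in m P. *)
Definition minimal_syzygy (X Z : lmodType A) :=
  exists (P : lmodType A) (i : {linear Z -> P}) (q : {linear P -> X}),
    [/\ fin_gen P, projective P, short_exact i q &
        forall z, exists2 s : seq A, {subset s <= nonunit} &
          i z \in seq_mul P s].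

Definition isomorphic (X Y : lmodType A) :=
  exists g : {linear X -> Y}, bijective g.

Definition has_free_summand (N : lmodType A) :=
  exists X : lmodType A, isomorphic N (A^o * X)%type.

(* A full subcategory is given by the predicate of its objects. *)
Inductive add_closure (C : lmodType A -> Prop) : lmodType A -> Prop :=
| add_base (X : lmodType A) : C X -> add_closure C X
| add_iso (X Y : lmodType A) :
    isomorphic X Y -> add_closure C X -> add_closure C Y
| add_zero (X : lmodType A) : (forall x : X, x = 0) -> add_closure C X
| add_sum (X Y : lmodType A) :
    add_closure C X -> add_closure C Y -> add_closure C (X * Y)%type
| add_summand (X Y : lmodType A) :
    add_closure C (X * Y)%type -> add_closure C X.

Definition right_approximation (C : lmodType A -> Prop) (X N : lmodType A)
    (q : {linear X -> N}) :=
  C X /\ forall X' : lmodType A, C X' -> forall h : {linear X' -> N},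
    exists g : {linear X' -> X}, forall x, h x = q (g x).

Definition left_approximation (C : lmodType A -> Prop) (N X : lmodType A)
    (j : {linear N -> X}) :=
  C X /\ forall X' : lmodType A, C X' -> forall h : {linear N -> X'},
    exists g : {linear X -> X'}, forall x, h x = g (j x).

Definition functorially_finite_in (D C : lmodType A -> Prop) :=
  (forall X, C X -> D X) /\
  forall N, D N ->
    (exists (X : lmodType A) (q : {linear X -> N}),
       right_approximation C q) /\
    (exists (X : lmodType A) (j : {linear N -> X}),
       left_approximation C j).

End Modules.

Section BranchedCover.
Variables (S : comNzRingType) (f : S) (n : nat).

(* R^# = S[y] / (f + y^n) *)
Definition Rsharp : comPzRingType := quot_ring [:: f%:P + 'X^n].

Definition ysharp : Rsharp := quot_ring_proj [:: f%:P + 'X^n] 'X.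

(* A_k = S[y] / (f, y^k) *)
Definition A_ (k : nat) : comPzRingType := quot_ring [:: f%:P; 'X^k].

(* M' is the A_k-module M viewed as an R^#-module: they are isomorphic as
   S[y]-modules. For k <= n this is restriction of scalars along the surjection
   R^# -> A_k. *)
Definition restriction (k : nat) (M : lmodType (A_ k))
    (M' : lmodType Rsharp) :=
  exists phi : {additive M' -> M}, bijective phi /\
    forall (p : {poly S}) (x : M'),
      phi (quot_ring_proj [:: f%:P + 'X^n] p *: x) =
      quot_ring_proj [:: f%:P; 'X^k] p *: phi x.

Definition Sigma_ (k : nat) : lmodType Rsharp -> Prop :=
  add_closure (fun Z => exists (M : lmodType (A_ k)) (M' : lmodType Rsharp),
    [/\ MCM M, restriction M M' & syzygy M' Z]).

End BranchedCover.

(* Main.v *)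
Require Import Defs.
From Stdlib Require List.
From HB Require Import structures.
From mathcomp Require Import all_boot all_algebra.
From mathcomp Require Import boolp ring zify.
Set Implicit Arguments.
Unset Strict Implicit.
Unset Printing Implicit Defensive.
Import GRing.Theory.
Local Open Scope ring_scope.

(* R^# is free over S with basis 1, y, ..., y^(n-1), and an R^#-module is MCM
   exactly when it is finitely generated and S-projective. This rests on two
   facts: depth does not depend on the choice of regular elements, and an
   associated prime of a module of depth t starts a chain of t+1 primes, whose
   contractions to S form a strict chain. It also shows that N/y^k N is MCM
   over A_k when N is MCM over R^#, and that syzygies over R^# of MCM
   A_k-modules are MCM.

   Given 0 -> Z -> P -> N -> 0 with P projective, let W be the preimage of
   y^k N in P, a syzygy of N/y^k N. As y^k is regular on N, W is the pullback of
   P -> N along y^k : N -> N, whence 0 -> Z -> W -> N -> 0. If X' is the kernel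
   of P' -> M' with P' projective and y^k M' = 0, then y^k P' lies in X'. So for
   h : X' -> N the map v |-> h (y^k v) is defined on P' and lifts to P, which
   factors h through W. Dually, a map Z -> X' extends to P -> P' (P' is
   injective relative to S-split extensions, because Hom_S(R^#, -) is also an
   induction functor) and the extension sends W = Z + y^k P into X'. The left
   approximation of N is this for the sequence 0 -> N -> P -> Z -> 0 in which N
   is a syzygy of its own syzygy Z. *)

(** * Submodules and Noetherian modules *)

(** Multiplication by y^k is injective on an MCM module because y^(n-k) y^k = y^n = -f, and a
    nonzero f is regular on a projective module over the domain S. That S is a domain is itself
    derived: when the maximal ideal has as many generators as the dimension, the height theorem
    forces the ideals they successively generate to be prime. The depth theory forms neither
    localizations nor towers of quotient modules. A quotient V/U is a pair of predicates on one
    module, and localization at a prime is replaced by saturated submodules. The depth of a first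
    syzygy can thus be measured inside the projective module P that contains it. The theorem
    concerns every syzygy Z of N, not only the minimal one. The left approximation therefore needs a
    projective module mapping onto this very Z with kernel exactly N; periodicity up to projective
    summands would not suffice. *)

Local Notation sub U V := (forall x, U x -> V x).

Section Submodules.
Variables (R : comPzRingType) (M : lmodType R).
Implicit Types (U V W : M -> Prop) (l : seq M) (x y v : M) (a b c : R).

Definition submod U := U 0 /\ forall a x y, U x -> U y -> U (a *: x + y).

Section SubmodTheory.
Variables (U : M -> Prop) (hU : submod U).

Lemma submod0 : U 0. Proof. exact: hU.1. Qed.
Lemma submodD x y : U x -> U y -> U (x + y).
Proof. by move=> hx hy; rewrite -[x]scale1r; exact: hU.2. Qed.
Lemma submodZ a x : U x -> U (a *: x).
Proof. by move=> hx; rewrite -[_ *: _]addr0; apply: hU.2; last exact: submod0. Qed.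
Lemma submodN x : U x -> U (- x).
Proof. by rewrite -scaleN1r; exact: submodZ. Qed.
Lemma submodB x y : U x -> U y -> U (x - y).
Proof. by move=> hx hy; apply: submodD => //; exact: submodN. Qed.
Lemma submodK x y : U y -> U (x + y) -> U x.
Proof. by move=> hy hxy; rewrite -[x](addrK y); exact: submodB. Qed.
Lemma submodKB x y : U y -> U (x - y) -> U x.
Proof. by move=> hy; apply: submodK; exact: submodN. Qed.
End SubmodTheory.

(** For an ideal J this is J times the span of [l]. The recursion on [l] allows induction on
    generators; [comb_sum] and [sum_comb] translate to indexed sums. *)
Fixpoint comb (J : R -> Prop) l x : Prop :=
  if l is v :: l' then exists2 c, J c & comb J l' (x - c *: v) else x = 0.

Definition span := comb (fun=> True).

(* [addmul U a V] is U + aV. *)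
Definition addmul U a V x := exists2 v, V v & U (x - a *: v).

Definition ann U v a := U (a *: v).

Lemma submod_addmul U a V : submod U -> submod V -> submod (addmul U a V).
Proof.
move=> hU hV; split; first by exists 0; [exact: submod0|rewrite scaler0 subr0; exact: submod0].
move=> b x y [v hv hx] [w hw hy]; exists (b *: v + w); first exact: hV.2.
rewrite scalerDr scalerA [a * b]mulrC -scalerA opprD addrACA -scalerBr.
exact: hU.2.
Qed.

Lemma addmul_subl U a V : submod V -> sub U (addmul U a V).
Proof. by move=> hV x hx; exists 0; [exact: submod0|rewrite scaler0 subr0]. Qed.

Lemma addmul_mem U a V v : submod U -> V v -> addmul U a V (a *: v).
Proof. by move=> hU hv; exists v; rewrite // subrr; exact: submod0. Qed.

Lemma addmul_min U a V W : submod W -> sub U W -> (forall v, V v -> W (a *: v)) ->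
  sub (addmul U a V) W.
Proof.
by move=> hW UW aV x [v /aV hv /UW]; exact: submodKB.
Qed.

Lemma submod_eq0 : submod (fun x => x = 0).
Proof. by split=> // a x y -> ->; rewrite scaler0 addr0. Qed.

Lemma submodT : submod (fun=> True). Proof. by []. Qed.

Lemma comb_submod (J : R -> Prop) l :
  J 0 -> (forall a b c, J b -> J c -> J (a * b + c)) -> submod (comb J l).
Proof.
move=> J0 JD; elim: l => [|v l [IH0 IH]]; first exact: submod_eq0.
split; first by exists 0; rewrite // scale0r subr0.
move=> a x y [c hc hx] [c' hc' hy]; exists (a * c + c'); first exact: JD.
rewrite scalerDl -scalerA opprD addrACA -scalerBr; exact: IH.
Qed.

Lemma span_submod l : submod (span l).
Proof. exact: comb_submod. Qed.

Lemma span_mem l x : x \in l -> span l x.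
Proof.
elim: l => // v l IH; rewrite inE => /orP[/eqP->|/IH hx].
  by exists 1; rewrite // scale1r subrr; apply: submod0; exact: span_submod.
by exists 0; rewrite // scale0r subr0.
Qed.

Lemma span_min l U : submod U -> (forall x, x \in l -> U x) -> sub (span l) U.
Proof.
move=> hU; elim: l => [|v l IH] hl x; first by move->; exact: submod0.
case=> c _ /IH hx; apply: (@submodKB _ hU x (c *: v)).
  by apply: submodZ => //; apply: hl; rewrite mem_head.
by apply: hx => y hy; apply: hl; rewrite in_cons hy orbT.
Qed.

Lemma span_mono l l' : {subset l <= l'} -> sub (span l) (span l').
Proof.
move=> h; apply: span_min; first exact: span_submod.
by move=> x /h; exact: span_mem.
Qed.

Lemma comb_sum (J : R -> Prop) l x : comb J l x ->
  exists2 c : 'I_(size l) -> R, forall i, J (c i) & x = \sum_i c i *: l`_i.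
Proof.
elim: l x => [|v l IH] x; first by move->; exists (fun=> 0); [case|rewrite big_ord0].
case=> c hc /IH[d hd e].
exists (fun i => oapp d c (unlift ord0 i)) => [i|].
  by case: unliftP => [j _|_] /=.
rewrite big_ord_recl unlift_none /=.
rewrite -[LHS](subrK (c *: v)) addrC e; congr (_ + _).
by apply: eq_bigr => i _; rewrite liftK.
Qed.

Lemma sum_comb (J : R -> Prop) l (c : 'I_(size l) -> R) :
  (forall i, J (c i)) -> comb J l (\sum_i c i *: l`_i).
Proof.
elim: l c => [|v l IH] c hc; first by rewrite big_ord0.
exists (c ord0); first exact: hc.
rewrite big_ord_recl /= addrC addKr.
by apply: (IH (fun i => c (lift ord0 i))).
Qed.

(** [G] is an arbitrary subset and the generators are drawn from [G] itself. This form directly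
    yields finitely many associated primes and integral equations. *)
Definition noeth := forall G : M -> Prop,
  exists l, (forall x, x \in l -> G x) /\ sub G (span l).

(** Without a maximal member, choice gives a strictly increasing sequence; the finitely many
    generators of its union already lie in one term. *)
Lemma noeth_max (F : (M -> Prop) -> Prop) : noeth ->
  (forall U, F U -> submod U) -> (exists U, F U) ->
  exists2 U, F U & forall V, F V -> sub U V -> sub V U.
Proof.
move=> nM Fsub [U0 FU0]; apply: contrapT => nmax.
have step U : exists V, F U -> [/\ F V, sub U V & ~ sub V U].
  have [FU|nFU] := EM (F U); last by exists U.
  apply: contrapT => nV; apply: nmax; exists U => // V FV UV.
  by apply: contrapT => VU; apply: nV; exists V.
have [nxt hnxt] := choice step.
pose g i := iter i nxt U0.
have Fg i : F (g i) by elim: i => // i /hnxt[].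
have gS i : sub (g i) (g i.+1) by have [] := hnxt _ (Fg i).
have gm i j : (i <= j)%N -> sub (g i) (g j).
  by move=> /subnK <-; elim: (j - i)%N => // m IH x /IH; exact: gS.
have [l [lG Gl]] := nM (fun x => exists i, g i x).
have [i hi] : exists i, forall x, x \in l -> g i x.
  elim: l lG {Gl} => [|v l IH] lG; first by exists 0%N.
  have [i hi] := IH (fun x hx => lG x (mem_behead (s := v :: l) hx)).
  have [j hj] := lG v (mem_head _ _).
  exists (maxn i j) => x; rewrite inE => /orP[/eqP->|/hi].
    by apply: gm hj; exact: leq_maxr.
  by apply: gm; exact: leq_maxl.
have [_ _] := hnxt _ (Fg i); apply=> x hx.
apply: (span_min (Fsub _ (Fg i)) hi).
by apply: Gl; exists i.+1.
Qed.

Lemma generated_finite (G : M -> Prop) l :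
  (forall x, x \in l -> exists2 l', (forall y, y \in l' -> G y) & span l' x) ->
  exists2 l', (forall y, y \in l' -> G y) & sub (span l) (span l').
Proof.
elim: l => [|v l IH] h; first by exists [::].
have [l1 h1 s1] := IH (fun x hx => h x (mem_behead (s := v :: l) hx)).
have [l2 h2 s2] := h v (mem_head _ _).
exists (l1 ++ l2) => [y|x]; first by rewrite mem_cat => /orP[/h1|/h2].
apply: span_min => [|y]; first exact: span_submod.
rewrite inE => /orP[/eqP->|/span_mem/s1].
  by apply: span_mono s2 => z hz; rewrite mem_cat hz orbT.
by apply: span_mono => z hz; rewrite mem_cat hz.
Qed.

Lemma generated_submod (G : M -> Prop) :
  submod (fun x => exists2 l, (forall y, y \in l -> G y) & span l x).
Proof.
split; first by exists [::].
move=> a x y [l1 h1 s1] [l2 h2 s2]; exists (l1 ++ l2).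
  by move=> z; rewrite mem_cat => /orP[/h1|/h2].
apply: (span_submod _).2.
  by apply: span_mono s1 => z hz; rewrite mem_cat hz.
by apply: span_mono s2 => z hz; rewrite mem_cat hz orbT.
Qed.

End Submodules.

Arguments span_min {R M l U}.

Definition idl (R : comPzRingType) (I : R -> Prop) := submod (M := R^o) I.

Definition prm (R : comPzRingType) (P : R -> Prop) :=
  [/\ idl P, ~ P 1 & forall a b, P (a * b) -> P a \/ P b].

(** Induction on the generators. The coefficients of the last generator [v] in elements of the span
    of [G] form an ideal; after subtracting lifts of its finitely many generators, what remains lies
    in the span of the other generators of the module. *)
Lemma noeth_fg (R : comPzRingType) (M : lmodType R) (l : seq M) :
  noeth R^o -> (forall x, span l x) -> noeth M.
Proof.
move=> nR hl G.
suff: sub G (span l) -> exists l', (forall x, x \in l' -> G x) /\ sub G (span l').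
  by apply=> x _; exact: hl.
elim: l {hl} G => [|v l IH] G Gl; first by exists [::].
pose H x := exists2 l', (forall y, y \in l' -> G y) & span l' x.
have hH : submod H := generated_submod G.
have [cs [csJ Jcs]] := nR (fun c => exists2 x, H x & span l (x - c *: v)).
have pick c : exists x, c \in cs -> H x /\ span l (x - c *: v).
  have [/csJ[x]|] := boolP (c \in cs); first by exists x.
  by exists 0.
have [f hf] := choice pick.
have [l2 [l2G Gl2]] := IH (fun x => H x /\ span l x) (fun x h => h.2).
have [|l' hl' sl'] := @generated_finite _ _ G (map f cs ++ l2).
  move=> x; rewrite mem_cat => /orP[/mapP[c /hf[hc _] ->] //|/l2G[] //].
exists l'; split=> // x Gx; apply: sl'.
have [c _ hc] := Gl _ Gx.
have Hx : H x by exists [:: x]; [move=> y; rewrite inE => /eqP->|apply: span_mem; rewrite inE].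
have /Jcs : exists2 x, H x & span l (x - c *: v) by exists x.
pose Q c := exists2 z, span (map f cs) z & span l (z - c *: v).
have hQ : idl Q.
  split; first by exists 0; rewrite ?scale0r ?subr0; apply: submod0; exact: span_submod.
  move=> a c1 c2 [z1 hz1 e1] [z2 hz2 e2]; exists (a *: z1 + z2); first exact: (span_submod _).2.
  rewrite /= scalerDl -scalerA opprD addrACA -scalerBr; exact: (span_submod _).2.
have QH : sub (span (map f cs)) H.
  by apply: span_min => // y /mapP[d /hf[hd _] ->].
move=> /(@span_min R R^o _ _ hQ)[].
  by move=> d hd; exists (f d); [apply: span_mem; rewrite map_f|case: (hf d hd)].
move=> z hz ez.
apply: (@submodKB _ _ _ (span_submod _) x z).
  by apply: span_mono hz => y hy; rewrite mem_cat hy.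
have : span l2 (x - z).
  apply: Gl2; split; first by apply: submodB => //; exact: QH.
  have -> : x - z = (x - c *: v) - (z - c *: v) by rewrite opprB addrA subrK.
  by apply: submodB => //; exact: span_submod.
by apply: span_mono => y hy; rewrite mem_cat hy orbT.
Qed.

Lemma seq_mul_span (R : comPzRingType) (s : seq R) (x : R) :
  (x \in seq_mul R^o s) <-> span (M := R^o) s x.
Proof.
split.
  move/seq_mulP => [v ->]; have -> : \sum_(i < size s) s`_i *: v i = \sum_i v i *: (s : seq R^o)`_i.
    by apply: eq_bigr => i _; exact: mulrC.
  exact: sum_comb.
move=> /comb_sum[c _ ->]; apply/seq_mulP; exists c.
by apply: eq_bigr => i _; exact: mulrC.
Qed.

Lemma noeth_noetherian (R : comPzRingType) : noetherian R -> noeth R^o.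
Proof.
move=> nR G.
pose H (x : R^o) := exists2 l', (forall y, y \in l' -> G y) & span l' x.
have hH : submod H := generated_submod G.
have [|s hs] := nR (fun x => `[< H x >]).
  split; first by apply/asboolP; exact: submod0.
  by move=> a x y /asboolP hx /asboolP hy; apply/asboolP; exact: hH.2.
have sH : forall x, x \in s -> H x.
  move=> x hx; suff: x \in (fun x => `[< H x >]) by move/asboolP.
  by rewrite hs; apply/seq_mul_span; exact: span_mem.
have [l hl sl] := @generated_finite R R^o G s sH.
exists l; split=> // x Gx; apply: sl; apply/seq_mul_span; rewrite -hs.
by apply/asboolP; exists [:: x]; [move=> y; rewrite inE => /eqP->|apply: span_mem; rewrite inE].
Qed.

(** * Prime ideals *)

Section Primes.
Variables (R : comPzRingType) (M : lmodType R).
Implicit Types (U V W : M -> Prop) (l : seq M) (x y v : M) (a b c : R).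
Implicit Types (I P q : R -> Prop).

Lemma comb_span (J : R -> Prop) l x : comb J l x -> span l x.
Proof.
by elim: l x => // v l IH x [c _ /IH hx]; exists c.
Qed.

Lemma ann_idl U v : submod U -> idl (ann U v).
Proof.
move=> hU; split; first by rewrite /ann scale0r; exact: submod0.
by move=> a b c hb hc; rewrite /ann scalerDl -scalerA; exact: hU.2.
Qed.

Lemma idlM I a b : idl I -> I b -> I (a * b).
Proof. by move=> hI; exact: (submodZ hI). Qed.

Lemma idlMr I a b : idl I -> I a -> I (a * b).
Proof. by move=> hI ha; rewrite mulrC; exact: idlM. Qed.

Lemma prmM P a b : prm P -> ~ P a -> ~ P b -> ~ P (a * b).
Proof. by case=> _ _ hP ha hb /hP[]. Qed.

Lemma prmX P a n : prm P -> P (a ^+ n) -> P a.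
Proof.
move=> hP; elim: n => [|n IH]; first by case: hP.
by rewrite exprS => /(let: And3 _ _ h := hP in h a _)[].
Qed.

(* [W] is saturated at [q], so this is Nakayama's lemma in the localization. *)
Lemma nakayama q W l : prm q -> submod W ->
  (forall t v, ~ q t -> W (t *: v) -> W v) ->
  (forall x, x \in l -> exists2 s, ~ q s &
     exists2 w, W w & comb q l (s *: x - w)) ->
  sub (span l) W.
Proof.
move=> hq hW satW; have [Iq _ _] := hq => hl.
suff: forall x, x \in l -> W x by exact: span_min.
elim: l hl => // v l IH hl.
have hcl : submod (comb q l) by apply: comb_submod; [exact: Iq.1|exact: Iq.2].
have [s qs [w hw [j qj hz]]] := hl v (mem_head _ _).
set z := _ - _ in hz.
have qt : ~ q (s - j) by move=> /(submodKB Iq qj).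
have tv : (s - j) *: v = w + z by rewrite /z scalerBl addrA [w + _]addrC subrK.
have Wl : forall x, x \in l -> W x.
  apply: IH => x xl.
  have [|s' qs' [w' hw' [j' qj' hz']]] := hl x; first by rewrite inE xl orbT.
  set z' := _ - _ in hz'.
  exists ((s - j) * s'); first exact: prmM.
  exists ((s - j) *: w' + j' *: w); first by apply: hW.2 => //; exact: submodZ.
  suff -> : ((s - j) * s') *: x - ((s - j) *: w' + j' *: w) = (s - j) *: z' + j' *: z.
    by apply: hcl.2 => //; exact: submodZ.
  have e : (s - j) *: (j' *: v) = j' *: w + j' *: z.
    by rewrite -scalerDr -tv !scalerA mulrC.
  have -> : j' *: z = (s - j) *: (j' *: v) - j' *: w by rewrite e addrAC subrr add0r.
  by rewrite /z' !scalerBr opprD !addrA subrK scalerA.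
move=> x; rewrite inE => /orP[/eqP->|]; last exact: Wl.
apply: (satW _ _ qt); rewrite tv; apply: submodD => //.
exact: (span_min hW Wl _ (comb_span hz)).
Qed.

(** Associated primes of the localization of V/U at q, without localizing. Take an annihilator
    maximal among those inside q and ab in ann v. If ann (bv) is inside q, maximality gives a in ann
    v; otherwise some s outside q kills bv, ann (sv) is still inside the prime q, and maximality
    gives b in ann v. *)
Lemma assoc_above q U V v0 : noeth R^o -> prm q -> submod U -> submod V ->
  V v0 -> sub (ann U v0) q ->
  exists v, [/\ V v, prm (ann U v), sub (ann U v0) (ann U v), sub (ann U v) q &
    forall v', V v' -> sub (ann U v') q -> sub (ann U v) (ann U v') ->
      sub (ann U v') (ann U v)].
Proof.
move=> nR hq hU hV Vv0 v0q.
have [||_ [v [Vv vq v0v ->]] vmax] := @noeth_max R R^o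
  (fun I => exists v, [/\ V v, sub (ann U v) q, sub (ann U v0) (ann U v) & I = ann U v]) nR.
- by move=> _ [v [_ _ _ ->]]; exact: ann_idl.
- by exists (ann U v0), v0.
have vmax' v' : V v' -> sub (ann U v') q -> sub (ann U v) (ann U v') ->
      sub (ann U v') (ann U v).
  by move=> Vv' v'q vv'; apply: vmax => //; exists v'; split=> // a /v0v/vv'.
exists v; split=> //; split; first exact: ann_idl.
  by move=> /vq; case: hq.
move=> a b; rewrite /ann => abv.
have [bv|nbv] := EM (U (b *: v)); [by right|left].
have [|/existsNP[s /not_implyP[sbv qs]]] := EM (sub (ann U (b *: v)) q).
  move=> bvq; apply: (vmax' (b *: v)) => //; first exact: submodZ.
    by move=> c cv; rewrite /ann scalerA mulrC -scalerA; exact: submodZ.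
  by rewrite /ann scalerA.
case: nbv; apply: (vmax' (s *: v)); first exact: submodZ.
- move=> t; rewrite /ann scalerA => /vq.
  by case: hq => _ _ hq' /hq'[].
- by move=> c cv; rewrite /ann scalerA mulrC -scalerA; exact: submodZ.
- by rewrite /ann scalerA mulrC -scalerA.
Qed.

End Primes.

Section Avoidance.
Variable (R : comPzRingType).
Implicit Types (I P q : R -> Prop) (ps : seq (R -> Prop)).

(** Once no member of [ps] lies inside p, a product yields b in I and in every member of [ps] but
    not in p. If a avoids [ps], then a or a + b avoids p as well. *)
Lemma prime_avoidance I ps : idl I ->
  (forall P, List.In P ps -> prm P /\ ~ sub I P) ->
  exists2 a, I a & forall P, List.In P ps -> ~ P a.
Proof.
move=> hI; have [n] := ubnP (size ps); elim: n ps => // n IH [|p ps] sps hps.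
  by exists 0 => //; exact: (submod0 hI).
have [pp Ip] := hps p (or_introl erefl).
have [[p' [hin p'p]]|nps] := EM (exists p', List.In p' ps /\ sub p' p).
  have [l1 [l2 e]] := List.in_split _ _ hin.
  have [||a Ia ha] := IH (p :: l1 ++ l2).
  - by move: sps; rewrite e /= !size_cat /= !addnS !ltnS.
  - move=> P hP; apply: hps; case: hP; first by left.
    rewrite e => h; right; apply/List.in_app_iff.
    by move/List.in_app_iff: h => [h|h]; [left|right; right].
  have pa := ha p (or_introl erefl).
  exists a => // P [<- //|]; rewrite e => /List.in_app_iff[h|[<- /p'p //|h]].
    by apply: ha; right; apply/List.in_app_iff; left.
  by apply: ha; right; apply/List.in_app_iff; right.
have [b Ib [pb hb]] : exists2 b, I b & ~ p b /\ forall P, List.In P ps -> P b.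
  elim: ps nps hps {sps} => [|P ps IHps] nps hps.
    by have /existsNP[b /not_implyP[Ib pb]] := Ip; exists b.
  have [||b Ib [pb hb]] := IHps.
  - by move=> [p' [h h']]; apply: nps; exists p'; split=> //; right.
  - by move=> P' [h|h]; apply: hps; [left|right; right].
  have /existsNP[c /not_implyP[Pc pc]] : ~ sub P p.
    by move=> h; apply: nps; exists P; split=> //; left.
  exists (c * b); first exact: idlM.
  split; first exact: prmM.
  have [[hP _ _] _] := hps P (or_intror (or_introl erefl)).
  move=> P' [<-|hP']; first exact: idlMr.
  have [[hP'' _ _] _] := hps P' (or_intror (or_intror hP')).
  by apply: idlM => //; exact: hb.
have [||a Ia ha] := IH ps; first by move: sps; rewrite /= ltnS.
  by move=> P hP; apply: hps; right.
have [pa|npa] := EM (p a); last by exists a => // P [<-|/ha].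
have [Ip' _ _] := pp.
exists (a + b); first exact: (submodD hI).
move=> P [<-|hP] h; first by apply: pb; apply: (submodK Ip' pa); rewrite addrC.
have [[hP' _ _] _] := hps P (or_intror hP).
by apply: (ha P hP); exact: (submodK hP' (hb P hP)).
Qed.

End Avoidance.

(** * Depth *)

Definition ssub (R : Type) (P Q : R -> Prop) := sub P Q /\ ~ sub Q P.

(* [t] counts the inclusions: such a chain has [t.+1] primes. *)
Fixpoint pchain (R : comPzRingType) t (P Q : R -> Prop) : Prop :=
  if t is t'.+1 then exists P', [/\ pchain t' P P', prm Q & ssub P' Q]
  else prm Q /\ P = Q.

Lemma pchain_cons (R : comPzRingType) t (P P1 Q : R -> Prop) :
  prm P -> ssub P P1 -> pchain t P1 Q -> pchain t.+1 P Q.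
Proof.
elim: t Q => [|t IH] Q pP PP1; first by case=> pQ e; subst Q; exists P.
by case=> P' [hP' pQ hQ]; exists P'; split=> //; exact: (IH _ pP PP1 hP').
Qed.

Lemma pchain_prm (R : comPzRingType) t (P Q : R -> Prop) :
  pchain t P Q -> prm P /\ prm Q.
Proof.
elim: t Q => [|t IH] Q; first by case=> pQ ->.
by case=> P' [/IH[pP _] pQ _].
Qed.

Lemma pchain_sub (R : comPzRingType) t (P Q : R -> Prop) : pchain t P Q -> sub P Q.
Proof.
elim: t Q => [|t IH] Q; first by case=> _ ->.
by case=> P' [/IH h1 _ [h2 _]] x /h1/h2.
Qed.

Definition nu (R : comPzRingType) (a : R) := ~ exists b, a * b = 1.

Lemma nuP (R : comPzRingType) (a : R) : reflect (nu a) (a \in nonunit).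
Proof. exact: asboolP. Qed.

Lemma local_idl (R : comPzRingType) : local_ring R -> idl (@nu R).
Proof.
move=> hR; split; first by apply/nuP; exact: hR.1.
by move=> a x y /nuP hx /nuP hy; apply/nuP; exact: hR.2.
Qed.

Lemma nu_prm (R : comPzRingType) : idl (@nu R) -> prm (@nu R).
Proof.
move=> hR; split=> // [|a b]; first by apply; exists 1; rewrite mulr1.
move=> hab; apply: contrapT => /not_orP[/contrapT[a' ha] /contrapT[b' hb]].
by apply: hab; exists (a' * b'); rewrite mulrACA ha hb mulr1.
Qed.

Lemma nu_max (R : comPzRingType) (P : R -> Prop) : idl P -> ~ P 1 -> sub P (@nu R).
Proof. by move=> hP P1 a Pa [b hb]; apply: P1; rewrite -hb; exact: idlMr. Qed.

Section Depth.
Variables (R : comPzRingType) (nR : noeth R^o) (lR : idl (@nu R)).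
Variables (M : lmodType R) (nM : noeth M).
Implicit Types (U V W : M -> Prop) (l : seq M) (x y v : M) (a b c : R).

Let nup : prm (@nu R) := nu_prm lR.

Definition regular_on a U V := forall v, V v -> U (a *: v) -> U v.

(** The socle of V/U is zero, which says that the maximal ideal is not associated to V/U. *)
Definition socle0 U V := forall v, V v -> (forall a, nu a -> U (a *: v)) -> U v.

Lemma regular_socle0 a U V : nu a -> regular_on a U V -> socle0 U V.
Proof. by move=> ha hr v Vv h; apply: hr => //; exact: h. Qed.

Lemma nu_sat U : submod U -> forall t v, ~ nu t -> U (t *: v) -> U v.
Proof.
move=> hU t v /contrapT[b hb] h.
by rewrite -[v]scale1r -hb mulrC -scalerA; exact: submodZ.
Qed.

Lemma ann_nu U v : submod U -> ~ U v -> sub (ann U v) (@nu R).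
Proof.
move=> hU Uv; apply: nu_max; first exact: ann_idl.
by rewrite /ann scale1r.
Qed.

Lemma max_ann U V v0 : submod U -> submod V -> V v0 -> ~ U v0 ->
  exists v, [/\ V v, prm (ann U v), sub (ann U v0) (ann U v), ~ U v &
    forall v', V v' -> ~ U v' -> sub (ann U v) (ann U v') ->
      sub (ann U v') (ann U v)].
Proof.
move=> hU hV Vv0 Uv0.
have [v [Vv pv v0v vnu vmax]] := assoc_above nR nup hU hV Vv0 (ann_nu hU Uv0).
exists v; split=> //.
  by move=> Uv; apply: (let: And3 _ h _ := pv in h); rewrite /ann scale1r.
by move=> v' Vv' Uv'; apply: vmax => //; exact: ann_nu.
Qed.

(** Finitely many elements [l] of maximal annihilator span all others of that kind. If no ann x with
    x in [l] were inside the prime ann w, a product b of elements outside ann w would kill all of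
    [l], hence w. So ann w equals some ann x. *)
Lemma ass_primes U V : submod U -> submod V ->
  exists ps : seq (R -> Prop),
    (forall P, List.In P ps -> prm P /\ exists2 v, V v /\ ~ U v & P = ann U v) /\
    forall a, (forall P, List.In P ps -> ~ P a) -> regular_on a U V.
Proof.
move=> hU hV.
have [l [lG Gl]] := nM (fun v => [/\ V v, ~ U v, prm (ann U v) &
  forall v', V v' -> ~ U v' -> sub (ann U v) (ann U v') -> sub (ann U v') (ann U v)]).
exists (map (ann U) l); split.
  move=> P /List.in_map_iff[v [<- vl]].
  have /lG[Vv Uv pv _] : v \in l.
    by elim: l vl {lG Gl} => //= x l IH [->|/IH]; rewrite inE ?eqxx // => ->; rewrite orbT.
  by split=> //; exists v.
move=> a ha v Vv av; apply: contrapT => Uv.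
have [w [Vw pw vw Uw wmax]] := max_ann hU hV Vv Uv.
have {}ha x : x \in l -> ~ U (a *: x).
  move=> xl; apply: (ha (ann U x)); apply: List.in_map.
  by elim: l xl {lG Gl ha} => //= y l IH; rewrite inE => /orP[/eqP->|/IH]; [left|right].
suff [x xl xw] : exists2 x, x \in l & sub (ann U x) (ann U w).
  have [Vx Ux _ xmax] := lG x xl.
  by apply: (ha x xl); apply: (xmax w) => //; exact: vw.
apply: contrapT => nx.
have [b bw hb] : exists2 b, ~ ann U w b & forall x, x \in l -> ann U x b.
  elim: l nx {lG Gl ha} => [|y l IH] nx.
    by exists 1 => //; case: pw.
  have [|b bw hb] := IH.
    by move=> [x xl xw]; apply: nx; exists x; rewrite ?inE ?xl ?orbT.
  have /existsNP[c /not_implyP[cy cw]] : ~ sub (ann U y) (ann U w).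
    by move=> h; apply: nx; exists y; rewrite ?mem_head.
  exists (c * b); first exact: prmM.
  move=> x; rewrite inE => /orP[/eqP->|/hb h].
    by apply: (idlMr _ _ cy); exact: ann_idl.
  by apply: (idlM _ _ h); exact: ann_idl.
apply: bw; have /Gl hw : [/\ V w, ~ U w, prm (ann U w) &
  forall v', V v' -> ~ U v' -> sub (ann U w) (ann U v') -> sub (ann U v') (ann U w)] by [].
apply: (@span_min _ _ l (fun x => U (b *: x)) _ hb _ hw).
split; first by rewrite scaler0; exact: submod0.
by move=> c x y hx hy; rewrite scalerDr scalerA mulrC -scalerA; exact: hU.2.
Qed.

(** A vanishing socle keeps the maximal ideal out of every associated prime, so prime avoidance
    applies to the associated primes of all the quotients at once. *)
Lemma common_regular (Us : seq ((M -> Prop) * (M -> Prop))) :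
  (forall UV, List.In UV Us -> [/\ submod UV.1, submod UV.2 & socle0 UV.1 UV.2]) ->
  exists2 a, nu a & forall UV, List.In UV Us -> regular_on a UV.1 UV.2.
Proof.
move=> hUs.
have [ps [psP psr]] : exists ps : seq (R -> Prop),
    (forall P, List.In P ps -> prm P /\ ~ sub (@nu R) P) /\
    forall a, (forall P, List.In P ps -> ~ P a) ->
      forall UV, List.In UV Us -> regular_on a UV.1 UV.2.
  elim: Us hUs => [|[U V] Us IH] hUs; first by exists [::].
  have [|ps [hps rps]] := IH; first by move=> UV h; apply: hUs; right.
  have [/= hU hV UV0] := hUs (U, V) (or_introl erefl).
  have [qs [hqs rqs]] := ass_primes hU hV.
  exists (qs ++ ps); split.
    move=> P /List.in_app_iff[/hqs[pP [v [Vv Uv] eP]]|/hps //]; split=> //.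
    by rewrite eP => h; apply/Uv/UV0.
  move=> a ha UV [<-|hUV] /=.
    by apply: rqs => P hP; apply: ha; apply/List.in_app_iff; left.
  by apply: rps => // P hP; apply: ha; apply/List.in_app_iff; right.
have [a anu ha] := prime_avoidance lR psP.
by exists a => //; exact: psr.
Qed.

(* V/U has a weakly regular sequence of length [t] of nonunits. *)
Fixpoint dep t U V : Prop :=
  if t is t'.+1 then
    exists a, [/\ nu a, regular_on a U V & dep t' (addmul U a V) V]
  else True.

Lemma dep_socle0 t U V : dep t.+1 U V -> socle0 U V.
Proof. by case=> a [ha hr _]; exact: regular_socle0 hr. Qed.

Lemma regular_addmul_swap a c U V : submod U -> submod V ->
  regular_on a U V -> regular_on c U V -> regular_on c (addmul U a V) V ->
  regular_on a (addmul U c V) V.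
Proof.
move=> hU hV ra rc rca v Vv [w Vw h].
have [|u Vu hu] := rca w Vw.
  exists v => //; rewrite -opprB; exact: submodN.
exists u => //; apply: ra; first by apply: submodB => //; exact: submodZ.
have -> : a *: (v - c *: u) = (a *: v - c *: w) + c *: (w - a *: u).
  by rewrite !scalerBr addrA subrK !scalerA mulrC.
by apply: submodD => //; exact: submodZ.
Qed.

Lemma addmulAC a c U V : addmul (addmul U a V) c V = addmul (addmul U c V) a V.
Proof.
by apply/funext => x; apply/propext; split=> -[v Vv [w Vw h]];
   exists w => //; exists v => //; rewrite addrAC.
Qed.

(* Depth does not depend on the choice of the first regular element: compare
   a and b through some c regular modulo each of them. *)
Lemma dep_addmul t b U V : submod U -> submod V ->
  dep t.+1 U V -> nu b -> regular_on b U V -> dep t (addmul U b V) V.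
Proof.
elim: t b U => // t IH b U hU hV [a [anu ra da]] bnu rb.
have hUa := submod_addmul a hU hV; have hUb := submod_addmul b hU hV.
have sa : socle0 (addmul U a V) V := dep_socle0 da.
(* For M = V/U with a and b regular on it, the socles of M/aM and M/bM are isomorphic, both being
   Ext^1 of the residue field into M. The correspondence sends v to the w with a v = b w modulo
   U. *)
have sb : socle0 (addmul U b V) V.
  move=> v Vv h; have [w Vw hw] := h a anu.
  have [u Vu hu] : addmul U a V w.
    apply: sa => // c cnu; have [z Vz hz] := h c cnu.
    exists z => //; apply: rb; first by apply: submodB => //; exact: submodZ.
    have -> : b *: (c *: w - a *: z) = a *: (c *: v - b *: z) - c *: (a *: v - b *: w).
      rewrite !scalerBr !scalerA opprB [b * c]mulrC [a * c]mulrC [a * b]mulrC.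
      by rewrite [RHS]addrC addrA subrK.
    by apply: submodB => //; exact: submodZ.
  exists u => //; apply: ra; first by apply: submodB => //; exact: submodZ.
  have -> : a *: (v - b *: u) = (a *: v - b *: w) + b *: (w - a *: u).
    by rewrite !scalerBr addrA subrK !scalerA mulrC.
  by apply: submodD => //; exact: submodZ.
have [|c cnu rc] := @common_regular [:: (U, V); (addmul U a V, V); (addmul U b V, V)].
  move=> UV /= [<-|[<-|[<-|]]] //; split=> //=.
  exact: regular_socle0 ra.
have rcU : regular_on c U V := rc _ (or_introl erefl).
have rca : regular_on c (addmul U a V) V := rc _ (or_intror (or_introl erefl)).
have rcb : regular_on c (addmul U b V) V := rc _ (or_intror (or_intror (or_introl erefl))).
exists c; split=> //; rewrite addmulAC; apply: (IH) => //; first exact: submod_addmul.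
  exists a; split=> //; first exact: regular_addmul_swap.
  by rewrite addmulAC; exact: (IH).
exact: regular_addmul_swap.
Qed.

Lemma span_comb (J : R -> Prop) a l x : idl J -> J a -> span l x -> comb J l (a *: x).
Proof.
move=> hJ Ja; elim: l x => [|v l IH] x; first by move=> ->; rewrite /= scaler0.
by case=> c _ /IH h; exists (a * c); [exact: idlMr|rewrite -scalerA -scalerBr].
Qed.

(** Let p = ann v and let T consist of the elements killed by p modulo U. If T were inside U + aV,
    regularity of a would give T inside U + aT, and Nakayama T inside U, contradicting v. An element
    of T outside U + aV has an annihilator modulo U + aV that contains p and also a, which is not in
    p: the next prime of the chain. *)
Lemma dep_chain t U V v : submod U -> submod V -> V v -> ~ U v ->
  prm (ann U v) -> dep t U V -> exists Q, pchain t (ann U v) Q.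
Proof.
elim: t U v => [|t IH] U v hU hV Vv Uv pv; first by exists (ann U v).
case=> a [anu ra da].
pose T x := V x /\ forall p, ann U v p -> U (p *: x).
have hT : submod T.
  split; first by split=> [|p _]; rewrite ?scaler0; exact: submod0.
  move=> c x y [Vx hx] [Vy hy]; split=> [|p hp]; first exact: hV.2.
  by rewrite scalerDr scalerA mulrC -scalerA; apply: hU.2; [exact: hx|exact: hy].
have hUa := submod_addmul a hU hV.
have [w [Tw Uw]] : exists w, T w /\ ~ addmul U a V w.
  apply: contrapT => nw.
  have Ta x : T x -> addmul U a V x.
    by move=> Tx; apply: contrapT => Ux; apply: nw; exists x.
  have [l [lT Tl]] := nM T.
  apply: Uv; apply: (@nakayama R M (@nu R) U l nup hU (nu_sat hU)); last first.
    by apply: Tl; split.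
  move=> x xl; exists 1; first by apply; exists 1; rewrite mulr1.
  have [v' Vv' hv'] := Ta x (lT x xl).
  exists (x - a *: v') => //; rewrite scale1r opprB addrC subrK.
  apply: span_comb => //; apply: Tl; split=> // p hp.
  apply: ra; first exact: submodZ.
  have -> : a *: (p *: v') = p *: x - p *: (x - a *: v').
    by rewrite scalerBr opprB addrC subrK !scalerA mulrC.
  by apply: submodB => //; [exact: (lT x xl).2|exact: submodZ].
have [v1 [Vv1 pv1 wv1 Uv1 _]] := max_ann hUa hV Tw.1 Uw.
have [Q hQ] := IH _ _ hUa hV Vv1 Uv1 pv1 da.
exists Q; apply: pchain_cons hQ => //; split.
  move=> p hp; apply: wv1; apply: addmul_subl => //; exact: Tw.2.
move=> h; apply: Uv; apply: ra => //; apply: h; apply: wv1.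
by apply: addmul_mem => //; exact: Tw.1.
Qed.

End Depth.

(** [phi] induces a bijection from V/U to V'/U' under which non-unit scalars correspond. It is only
    additive, so that the lemma also covers a change of rings. *)
Lemma dep_transfer (R B : comPzRingType) (X : lmodType R) (Y : lmodType B)
    (phi : X -> Y) t (U V : X -> Prop) (U' V' : Y -> Prop) :
  zmod_morphism phi ->
  (forall b, nu b -> exists2 r, nu r & forall x, phi (r *: x) = b *: phi x) ->
  (forall r, nu r -> exists2 b, nu b & forall x, phi (r *: x) = b *: phi x) ->
  submod U -> submod V -> submod U' -> submod V' ->
  (forall v, V v -> V' (phi v)) ->
  (forall v', V' v' -> exists2 v, V v & U' (v' - phi v)) ->
  (forall v, V v -> (U v <-> U' (phi v))) ->
  dep t U V <-> dep t U' V'.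
Proof.
move=> phiB lift push hU hV hU' hV' H1 H2.
elim: t U U' hU hU' H2 => // t IH U U' hU hU' H2 H3.
have {}IH r b : (forall x, phi (r *: x) = b *: phi x) ->
    dep t (addmul U r V) V <-> dep t (addmul U' b V') V'.
  move=> hr; apply: IH.
  - exact: submod_addmul.
  - exact: submod_addmul.
  - by move=> v' /H2[v Vv h]; exists v => //; exact: addmul_subl.
  move=> v Vv; split.
    move=> [w Vw h]; exists (phi w); first exact: H1.
    by rewrite -hr -phiB; apply/H3 => //; apply: submodB => //; exact: submodZ.
  move=> [w' Vw' h]; have [w Vw hw] := H2 _ Vw'; exists w => //.
  apply/H3; first by apply: submodB => //; exact: submodZ.
  rewrite phiB hr.
  have -> : phi v - b *: phi w = (phi v - b *: w') + b *: (w' - phi w).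
    by rewrite scalerBr addrA subrK.
  by apply: submodD => //; exact: submodZ.
split.
  move=> [r [rnu rr /= dr]]; have [b bnu hr] := push r rnu.
  exists b; split=> //; last exact/(IH _ _ hr).
  move=> v' Vv' h; have [v Vv hv] := H2 _ Vv'.
  apply: (submodKB hU' _ hv); apply/H3 => //; apply: rr => //.
  apply/H3; first exact: submodZ.
  rewrite hr; apply: (@submodKB _ _ _ hU' _ (- (b *: (v' - phi v)))).
    by apply: submodN => //; exact: submodZ.
  by rewrite scalerBr opprB opprB addrC subrK.
move=> [b [bnu rb db]]; have [r rnu hr] := lift b bnu.
exists r; split=> //; last exact/(IH _ _ hr).
by move=> v Vv /H3 h; apply/H3 => //; apply: rb; [exact: H1|rewrite -hr; apply: h; exact: submodZ].
Qed.

(** The depth lemma for 0 -> W/U -> V/U -> V/W -> 0. Choose c regular on both V/W and V/U;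
    regularity on V/W keeps the sequence exact modulo c, so that W/(U + cW) is (W + cV)/(U + cV),
    and induction applies. *)
Lemma depth_lemma (R : comPzRingType) (M : lmodType R) t (U W V : M -> Prop) :
  noeth R^o -> idl (@nu R) -> noeth M ->
  submod U -> submod W -> submod V -> sub U W -> sub W V ->
  dep t W V -> dep t.+1 U V -> dep t.+1 U W.
Proof.
move=> nR lR nM; elim: t U W => [|t IH] U W hU hW hV UW WV.
  by move=> _ [a [anu ra _]]; exists a; split=> // v /WV; exact: ra.
move=> dW dU.
have [|c cnu rc] := @common_regular R nR lR M nM [:: (W, V); (U, V)].
  move=> UV /= [<-|[<-|]] //; split=> //=.
    exact: dep_socle0 dW.
  exact: dep_socle0 dU.
have rcW : regular_on c W V := rc _ (or_introl erefl).
have rcU : regular_on c U V := rc _ (or_intror (or_introl erefl)).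
exists c; split=> //; first by move=> v /WV; exact: rcU.
have hW' := submod_addmul c hW hV; have hU' := submod_addmul c hU hV.
have h : dep t.+1 (addmul U c V) (addmul W c V).
  apply: IH => //.
  - by move=> x [v Vv /UW h]; exists v.
  - by apply: addmul_min => // v; exact: submodZ.
  - exact: dep_addmul.
  - exact: dep_addmul.
suff e : dep t.+1 (addmul U c W) W <-> dep t.+1 (addmul U c V) (addmul W c V) by exact/e.
apply: (@dep_transfer R R M M idfun) => //.
- by move=> b bnu; exists b.
- by move=> b bnu; exists b.
- exact: submod_addmul.
- by move=> v; exact: addmul_subl.
- move=> v' [z Vz hz]; exists (v' - c *: z) => //.
  rewrite /= opprB addrC subrK; exact: addmul_mem.
move=> v Wv; split=> -[z hz hU0]; exists z => //; first exact: WV.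
apply: rcW => //; apply: (@submodK _ _ _ hW _ (v - c *: z)); first exact: UW.
by rewrite addrC subrK.
Qed.

(** * Krull's principal ideal theorem and regular local rings *)

Section PrincipalIdeal.
Variables (R : comPzRingType) (nR : noeth R^o).
Implicit Types (p P q J I : R -> Prop) (x y a b c : R).

Let T : R^o -> Prop := fun=> True.

(* Krull's principal ideal theorem. The quotient by p0 + xR, localized at a
   minimal prime q, satisfies the descending chain condition; applied to the
   saturations at p1 of the powers of some y in p1 \ p0 this forces, by
   Nakayama's lemma, y^n and y^(n+1) to generate the same ideal. *)
Lemma principal_ideal_theorem p0 p1 q x :
  prm p0 -> prm p1 -> prm q -> ssub p0 p1 -> ssub p1 q -> q x ->
  exists q', [/\ prm q', sub p0 q', q' x & ssub q' q].
Proof.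
move=> pp0 pp1 pq [p01 /existsNP[y /not_implyP[p1y p0y]]] [p1q np1q] qx.
have [i0 _ pr0] := pp0; have [i1 u1 pr1] := pp1; have [iq uq prq] := pq.
apply: contrapT => nq'.
have qmin q' : prm q' -> sub p0 q' -> q' x -> sub q' q -> sub q q'.
  by move=> h1 h2 h3 h4; apply: contrapT => h5; apply: nq'; exists q'.
pose I := addmul (M := R^o) p0 x T.
have iI : idl I by apply: submod_addmul.
(* [dcc N]: every descending chain of ideals above I becomes stationary on N after localization at
   q. The aim is such an N not contained in q, since it localizes to the unit ideal. *)
pose dcc (N : R -> Prop) := forall J : nat -> R -> Prop,
  (forall n, idl (J n)) -> (forall n, sub I (J n)) -> (forall n, sub (J n.+1) (J n)) ->
  exists n0, forall n, (n0 <= n)%N -> forall u, J n0 u -> N u ->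
    exists2 s, ~ q s & J n (s * u).
have decr (J : nat -> R -> Prop) : (forall n, sub (J n.+1) (J n)) ->
    forall m n, (m <= n)%N -> sub (J n) (J m).
  move=> hJ m n /subnK <-; elim: (n - m)%N => // k IH u; rewrite addSn => /hJ.
  exact: IH.
have [||N [iN IN dN] Nmax] := @noeth_max R R^o (fun N => [/\ idl N, sub I N & dcc N]) nR.
- by move=> N [].
- exists I; split=> // J _ IJ _; exists 0%N => n _ u _ Iu; exists 1; first by case: pq.
  by rewrite mul1r; exact: IJ.
(* Otherwise an associated prime of R/N inside q contains p0 and x, so it is q by minimality. Then
   N' = N + vR has N'/N simple after localization, N' inherits the chain condition, and N was not
   maximal. *)
have [m Nm qm] : exists2 m, N m & ~ q m.
  apply: contrapT => nm.
  have Nq : sub N q by move=> a Na; apply: contrapT => qa; apply: nm; exists a.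
  have [|v [_ pv _ vq _]] := @assoc_above R R^o q N T 1 nR pq iN (@submodT _ _) Logic.I.
    by move=> a; rewrite /ann /GRing.scale /= mulr1; exact: Nq.
  have Nv a : N a -> ann (M := R^o) N v a by move=> Na; exact: (idlMr _ iN Na).
  have qv : sub q (ann (M := R^o) N v).
    apply: qmin => //.
      by move=> a p0a; apply/Nv/IN; exact: addmul_subl.
    by apply/Nv/IN; rewrite -[x]mulr1; exact: (@addmul_mem R R^o).
  have [_ nv1 _] := pv; apply: nv1; rewrite /ann scale1r.
  pose N' := addmul (M := R^o) N v T.
  have iN' : idl N' by exact: submod_addmul.
  have NN' : sub N N' by exact: addmul_subl.
  apply: (Nmax N') => //; last first.
    by rewrite -[v]mulr1; exact: (@addmul_mem R R^o).
  split=> //; first by move=> a /IN/NN'.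
  move=> J iJ IJ dJ; have [n1 hn1] := dN J iJ IJ dJ.
  have [[n2 hn2]|nA] := EM (exists n2, forall u, J n2 u -> N' u -> N u).
    exists (maxn n1 n2) => n le_n u Ju N'u.
    apply: hn1; first by apply: leq_trans le_n; exact: leq_maxl.
      by apply: decr Ju => //; exact: leq_maxl.
    by apply: hn2 => //; apply: decr Ju => //; exact: leq_maxr.
  (* In the remaining case every J n meets N' outside N. Such an element w generates N'/N locally,
     so c u - a w falls into N, where [hn1] applies. *)
  exists n1 => n le_n u Ju [a _ ha].
  have [w [Jw [c _ hc] Nw]] : exists w, [/\ J n w, N' w & ~ N w].
    apply: contrapT => nw; apply: nA; exists n => w Jw N'w.
    by apply: contrapT => Nw; apply: nw; exists w.
  have qc : ~ q c.
    move=> /qv; rewrite /ann => h; apply: Nw; apply: (submodKB iN _ hc).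
    by rewrite /GRing.scale /= mulrC.
  have [||s qs hs] := hn1 n le_n (c * u - a * w).
  - apply: (submodB (iJ n1)); first exact: (idlM _ (iJ n1) Ju).
    by apply: (idlM _ (iJ n1)); apply: decr Jw.
  - have -> : c * u - a * w = c * (u - v * a) - a * (w - v * c) by ring.
    by apply: (submodB iN); exact: (idlM _ iN).
  exists (s * c); first exact: prmM.
  have -> : s * c * u = s * (c * u - a * w) + (s * a) * w by ring.
  by apply: (submodD (iJ n)) => //; exact: (idlM _ (iJ n)).
pose K n a := exists2 s, ~ p1 s & exists c, p0 (s * a - y ^+ n * c).
have iK n : idl (K n).
  split; first by exists 1 => //; exists 0; rewrite !mulr0 subr0; exact: submod0 i0.
  move=> a b b' [s hs [c hc]] [s' hs' [c' hc']]; exists (s * s'); first exact: prmM.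
  exists (a * s' * c + s * c'); rewrite /GRing.scale /=.
  have -> : s * s' * (a * b + b') - y ^+ n * (a * s' * c + s * c') =
    (a * s') * (s * b - y ^+ n * c) + s * (s' * b' - y ^+ n * c') by ring.
  by apply: (submodD i0); exact: (idlM _ i0).
have KS n : sub (K n.+1) (K n).
  by move=> a [s hs [c hc]]; exists s => //; exists (y * c); rewrite mulrA -exprSr.
have p0K n : sub p0 (K n).
  by move=> a p0a; exists 1 => //; exists 0; rewrite mulr0 subr0 mul1r.
have satK n t a : ~ p1 t -> K n (t * a) -> K n a.
  move=> ht [s hs [c hc]]; exists (s * t); first exact: prmM.
  by exists c; rewrite -mulrA.
pose J n := addmul (M := R^o) (K n) x T.
have [|||n hn] := dN J.
- by move=> n; exact: (submod_addmul x (iK n) (@submodT _ _)).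
- by move=> n a [c _ hc]; exists c => //; exact: p0K.
- by move=> n a [c _ hc]; exists c => //; exact: KS.
have p1x : ~ p1 x.
  by move=> p1x; apply: np1q; apply: qmin.
(* Stationarity gives s m u = k' + x c with k' in K (n+1). Since x is outside p1 and K n is
   saturated there, c lies in K n; hence K n is K (n+1) + x K n locally at q, and Nakayama
   applies. *)
have Kn : sub (K n) (K n.+1).
  have [l [lK Kl]] := nR (K n).
  move=> a /Kl; apply: (@nakayama R R^o q (K n.+1) l pq (iK _)).
    by move=> t b qt; apply: satK => /p1q.
  move=> u ul; have Ku := lK u ul.
  have [|||s qs [c _ hc]] := hn n.+1 _ (m * u); first exact: leqnSn.
  - by exists 0; rewrite // scaler0 subr0; exact: (idlM _ (iK n)).
  - exact: (idlMr _ iN).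
  exists (s * m); first exact: prmM.
  exists (s * (m * u) - x * c) => //.
  have -> : (s * m) *: (u : R^o) - (s * (m * u) - x * c) = x *: (c : R^o).
    by rewrite /GRing.scale /=; ring.
  apply: span_comb => //; apply: Kl; apply: (satK n x) => //.
  have -> : x * c = s * (m * u) - (s * (m * u) - x * c) by ring.
  apply: (submodB (iK n)); last exact: KS.
  by do 2!apply: (idlM _ (iK n)).
have [s hs [c]] : K n.+1 (y ^+ n).
  by apply: Kn; exists 1 => //; exists 1; rewrite mul1r mulr1 subrr; exact: submod0 i0.
have -> : s * y ^+ n - y ^+ n.+1 * c = y ^+ n * (s - y * c) by rewrite exprS; ring.
move/pr0 => [/(prmX pp0) //|/p01 h].
by apply: hs; apply: (submodKB i1 _ h); exact: (idlMr _ i1).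
Qed.

(** Work down from the top. If x is in q but not in the prime q' below it, the principal ideal
    theorem for q'' < q' < q replaces q' by a prime containing x, so x moves one step down. *)
Lemma pchain_through r p q x : pchain r.+1 p q -> q x ->
  exists p1, [/\ ssub p p1, p1 x & pchain r p1 q].
Proof.
elim: r q x => [|r IH] q x.
  by case=> P' [[pP' <-] pq h] qx; exists q.
case=> q' [hq' pq q'q] qx.
have [q'x|q'x] := EM (q' x).
  have [p1 [pp1 p1x h1]] := IH _ _ hq' q'x.
  by exists p1; split=> //; exists q'.
case: hq' => q'' [hq'' pq' q''q'].
have [_ pq''] := pchain_prm hq''.
have [qs [pqs q''qs qsx qsq]] := principal_ideal_theorem pq'' pq' pq q''q' q'q qx.
have [|p1 [pp1 p1x h1]] := IH qs x _ qsx.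
  exists q''; split=> //; split=> // h.
  by apply: q'x; apply: q''q'.1; exact: h.
by exists p1; split=> //; exists qs.
Qed.

End PrincipalIdeal.

Section Height.
Variables (R : comPzRingType) (nR : noeth R^o) (lR : idl (@nu R)).
Implicit Types (p P Q J : R -> Prop) (s : seq R).

Let pnu : prm (@nu R) := nu_prm lR.

(* The maximal ideal is contained in the ideal generated by [J] and [s]. *)
Definition gen_max J s := forall K : R -> Prop,
  idl K -> sub J K -> (forall x, x \in s -> K x) -> sub (@nu R) K.

Lemma gen_max_cons J x s :
  gen_max J (x :: s) -> gen_max (fun a => J a \/ a = x) s.
Proof.
move=> h K iK JK sK; apply: h => // [a Ja|a]; first by apply: JK; left.
by rewrite inE => /orP[/eqP->|/sK //]; apply: JK; right.
Qed.

Lemma pchain_top t P Q : pchain t P Q -> exists2 t', (t <= t')%N & pchain t' P (@nu R).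
Proof.
move=> h; have [_ [iQ Q1 _]] := pchain_prm h; have Qnu := nu_max iQ Q1.
have [nuQ|nuQ] := EM (sub (@nu R) Q); last by exists t.+1 => //; exists Q.
exists t => //; suff <- : Q = @nu R by [].
by apply/funext => a; apply/propext; split; [exact: Qnu|exact: nuQ].
Qed.

(** Each generator costs one prime: make the chain contain x from its second prime on, drop the
    bottom prime, and add x to J. *)
Lemma height_theorem t P Q J s : (forall x, x \in s -> nu x) -> gen_max J s ->
  sub J P -> pchain t P Q -> (t <= size s)%N.
Proof.
move=> + + + /pchain_top[t' /leq_trans tt' h].
move=> sm gJ JP; apply: tt'; move: sm gJ JP h {t Q}.
elim: s t' P J => [|x s IH] t P J sm gJ JP.
  case: t => // t /= [P' [hP' _ [_ h]]]; case: h => a; apply: gJ => //.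
    by have [_ []] := pchain_prm hP'.
  by move=> b /JP; exact: (pchain_sub hP').
case: t => // t /(pchain_through nR)/(_ (sm x (mem_head _ _)))[p1 [[Pp1 _] p1x h1]].
apply: IH h1; first by move=> z zs; apply: sm; rewrite inE zs orbT.
  exact: gen_max_cons gJ.
by move=> a [/JP/Pp1 //|->].
Qed.

Fixpoint prime_seq J s : Prop :=
  prm J /\ if s is x :: s' then
    ~ J x /\ prime_seq (addmul (M := R^o) J x (fun=> True)) s' else True.

(** The chain is as long as the height theorem permits. Hence x is not in P, and J + xR is prime and
    equal to the second prime P1 of a chain through x. Then P is inside J + xR, so inside J + xP
    since x is outside P, and Nakayama gives P = J. *)
Lemma regular_prime_seq J s P : idl J -> (forall x, x \in s -> nu x) ->
  gen_max J s -> sub J (@nu R) -> sub J P -> pchain (size s) P (@nu R) ->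
  prime_seq J s.
Proof.
elim: s J P => [|x s IH] J P iJ sm gJ Jnu JP.
  move=> _; split=> //; suff -> : J = @nu R by [].
  by apply/funext => a; apply/propext; split=> [/Jnu //|]; apply: gJ.
move=> h; have smx : nu x by apply: sm; rewrite mem_head.
have {}sm z : z \in s -> nu z by move=> zs; apply: sm; rewrite inE zs orbT.
have [pP _] := pchain_prm h; have [iP _ prP] := pP.
pose J1 := addmul (M := R^o) J x (fun=> True).
have iJ1 : idl J1 by exact: submod_addmul.
have J1x : J1 x by rewrite -[x]mulr1; exact: (@addmul_mem R R^o).
have JJ1 : sub J J1 by exact: (@addmul_subl R R^o).
have gJ1 : gen_max J1 s.
  move=> K iK J1K sK; apply: gJ => // [a /JJ1/J1K //|z].
  by rewrite inE => /orP[/eqP->|/sK //]; exact: J1K.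
have J1min K : idl K -> sub J K -> K x -> sub J1 K.
  by move=> iK JK Kx; apply: addmul_min => // v _; exact: idlMr.
have Px : ~ P x.
  move=> Px; have := height_theorem sm gJ1 (J1min _ iP JP Px) h.
  by rewrite ltnn.
have [P1 [PP1 P1x h1]] := pchain_through nR h smx.
have [[iP1 _ _] _] := pchain_prm h1.
have J1P1 := J1min _ iP1 (fun a Ja => PP1.1 a (JP a Ja)) P1x.
have hJ1 : prime_seq J1 s.
  apply: IH h1 => //.
  exact: J1min.
have pJ1 : prm J1 by case: (s) hJ1 => [|? ?] [].
have P1J1 : sub P1 J1.
  apply: contrapT => P1J1.
  have := height_theorem sm gJ1 (fun a h => h) (@pchain_cons R _ J1 P1 _ pJ1 (conj J1P1 P1J1) h1).
  by rewrite ltnn.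
have PJ : sub P J.
  have [l [lP Pl]] := nR P.
  move=> a /Pl; apply: (@nakayama R R^o (@nu R) J l pnu iJ).
    exact: (@nu_sat R R^o _ iJ).
  move=> u ul; exists 1; first by apply; exists 1; rewrite mulr1.
  have Pu := lP u ul; have [c _ hc] := P1J1 _ (PP1.1 u Pu).
  exists (u - x *: (c : R^o)) => //; rewrite scale1r opprB addrC subrK.
  apply: span_comb => //; apply: Pl.
  suff /prP[] : P (x * c) by [].
  have -> : x * c = u - (u - x * c) by ring.
  by apply: (submodB iP) => //; exact: JP.
have eJ : J = P by apply/funext => a; apply/propext; split=> [/JP|/PJ].
by split; rewrite ?eJ //; split=> //; rewrite -eJ.
Qed.

End Height.

(** * Krull dimension through recursive chains of primes *)

Section KrullDim.
Variable R : comPzRingType.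

Lemma pchain_prime_chain t (P Q : R -> Prop) : pchain t P Q ->
  exists p : 'I_t.+1 -> {pred R}, prime_chain p.
Proof.
move=> h; have [g [g0 gt gp gs]] : exists g : nat -> R -> Prop,
    [/\ g 0%N = P, g t = Q, forall i, (i <= t)%N -> prm (g i) &
        forall i, (i < t)%N -> ssub (g i) (g i.+1)].
  elim: t Q h => [|t IH] Q; first by case=> pQ ->; exists (fun=> Q); split=> // -[].
  case=> P' [/IH[g [g0 gt gp gs]] pQ hQ].
  exists (fun i => if (i <= t)%N then g i else Q); split=> //.
  - by rewrite ltnn.
  - by move=> i _; case: ifP => [/gp|].
  - move=> i; rewrite ltnS => le_it; rewrite le_it; case: ltnP => [/gs //|ti].
    by have -> : i = t by [apply/eqP; rewrite eqn_leq le_it]; rewrite gt.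
exists (fun i a => `[< g i a >]); split.
  move=> i; have [iI u pr] := gp i (leq_ord i); split.
  - split; first by apply/asboolP; exact: submod0 iI.
    by move=> a x y /asboolP hx /asboolP hy; apply/asboolP; exact: iI.2.
  - by apply/asboolPn.
  - by move=> a b /asboolP/pr[ha|hb]; [left|right]; apply/asboolP.
have gm i d : (i + d.+1 <= t)%N -> ssub (g i) (g (i + d.+1)%N).
  elim: d => [|d IH]; first by rewrite addn1; exact: gs.
  rewrite addnS => le_t; have [h1 h2] := IH (ltnW le_t).
  have [h3 h4] := gs _ le_t.
  by split=> [a /h1/h3 //|h5]; apply: h2 => a /h3/h5.
move=> i j ij; have : ssub (g i) (g j).
  have := leq_ord j; rewrite -(subnKC ij) addSnnS; exact: gm.
case=> h1 /existsNP[a /not_implyP[h2 h3]]; split.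
  by move=> b /asboolP hb; apply/asboolP; exact: h1.
by exists a; [apply/asboolP|apply/asboolPn].
Qed.

Lemma prime_chain_pchain t (p : 'I_t.+1 -> {pred R}) : prime_chain p ->
  exists P Q : R -> Prop, pchain t P Q.
Proof.
case=> hp hs; exists (fun a => a \in p ord0).
have pr i : prm (fun a => a \in p i).
  by have [hI /negP u hpr] := hp i; split.
suff H : forall i, (i <= t)%N -> pchain i (fun a => a \in p ord0) (fun a => a \in p (inord i)).
  by exists (fun a => a \in p (inord t)); exact: H.
elim=> [|i IH] le_t.
  split; first exact: pr.
  by have -> : inord 0 = ord0 :> 'I_t.+1 by apply/val_inj; rewrite /= inordK.
exists (fun a => a \in p (inord i)); split=> //; first exact: IH (ltnW le_t).
have [|h1 [a h2 /negP h3]] := hs (inord i) (inord i.+1).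
  by rewrite !inordK // ltnS ltnW.
by split=> [b /h1 //|h]; exact/h3/h.
Qed.

Lemma krull_dimP e : krull_dim R e <->
  (exists P Q : R -> Prop, pchain e P Q) /\
  (forall e' (P Q : R -> Prop), pchain e' P Q -> (e' <= e)%N).
Proof.
split=> -[].
  move=> [p /prime_chain_pchain hp] h; split=> // e' P Q /pchain_prime_chain[q]; exact: h.
move=> [P [Q /pchain_prime_chain hp]] h; split=> // e' p /prime_chain_pchain[P' [Q']].
exact: h.
Qed.

Lemma krull_dim_uniq e e' : krull_dim R e -> krull_dim R e' -> e = e'.
Proof.
by move=> [[p hp] h] [[p' hp'] h']; apply/eqP; rewrite eqn_leq (h' _ _ hp) (h _ _ hp').
Qed.

End KrullDim.

(** * The ring R^# *)

Section RestrictionOfScalars.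
Variables (A B : comPzRingType) (g : {rmorphism A -> B}) (M : lmodType B).

(** The phantom argument [g] keeps the A-module structure apart from the B-module structure on the
    same carrier. *)
Definition res of {rmorphism A -> B} : Type := M.
HB.instance Definition _ := GRing.Zmodule.on (res g).

Let scale (a : A) (x : res g) : res g := g a *: (x : M).
Let scaleA a b x : scale a (scale b x) = scale (a * b) x.
Proof. by rewrite /scale scalerA rmorphM. Qed.
Let scale1 : left_id 1 scale.
Proof. by move=> x; rewrite /scale rmorph1 scale1r. Qed.
Let scaleDr : right_distributive scale +%R.
Proof. by move=> a x y; rewrite /scale scalerDr. Qed.
Let scaleDl x : {morph scale^~ x : a b / a + b}.
Proof. by move=> a b; rewrite /scale rmorphD scalerDl. Qed.

HB.instance Definition _ := GRing.Zmodule_isLmodule.Build A (res g)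
  scaleA scale1 scaleDr scaleDl.

Lemma resZ a (x : M) : (a *: (x : res g)) = g a *: x. Proof. by []. Qed.

End RestrictionOfScalars.

Arguments res {A B} M g.

Section Rsharp.
Variables (S : comNzRingType) (f : S) (n : nat).

Definition psharp (p : {poly S}) : Rsharp f n := quot_ring_proj [:: f%:P + 'X^n] p.
HB.instance Definition _ := GRing.RMorphism.copy psharp (quot_ring_proj [:: f%:P + 'X^n]).
Definition cst (s : S) : Rsharp f n := psharp s%:P.
HB.instance Definition _ := GRing.RMorphism.copy cst (psharp \o polyC).

Local Notation R := (Rsharp f n).
Local Notation y := (ysharp f n).
Local Notation h := (f%:P + 'X^n : {poly S}).

Lemma psharpX : psharp 'X = y. Proof. by []. Qed.

Lemma psharp_eq p q : psharp p = psharp q <-> exists c, p = q + c * h.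
Proof.
rewrite [X in X <-> _]quot_ring_projP; split.
  move/seq_mul_span => [c _ /eqP e]; exists c; apply/eqP.
  by rewrite addrC -subr_eq -subr_eq0.
move=> [c ->]; apply/seq_mul_span; exists c => //.
by rewrite /= [q + _]addrC addrK; exact: subrr.
Qed.

Lemma psharp_surj r : exists p, psharp p = r.
Proof. exact: quot_ring_proj_surj. Qed.

Lemma ysharpXn : y ^+ n = - cst f.
Proof.
rewrite -psharpX -rmorphXn /cst -rmorphN; apply/psharp_eq; exists 1.
by rewrite mul1r addrA addNr add0r.
Qed.

Hypothesis n_gt0 : (0 < n)%N.

Lemma h_monic : h \is monic.
Proof. by rewrite monicE addrC lead_coefDl ?lead_coefXn // size_polyXn ltnS (leq_trans (size_polyC_leq1 _)). Qed.

Lemma size_h : size h = n.+1.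
Proof. by rewrite addrC size_polyDl size_polyXn // ltnS (leq_trans (size_polyC_leq1 _)). Qed.

Definition lift_sharp (r : R) : {poly S} := Pdiv.Ring.rmodp (projT1 (cid (psharp_surj r))) h.

Lemma lift_sharpE p : lift_sharp (psharp p) = Pdiv.Ring.rmodp p h.
Proof.
rewrite /lift_sharp; case: cid => q /= /psharp_eq[c ->].
rewrite Pdiv.RingMonic.rmodpD ?h_monic // Pdiv.RingMonic.rmodp_mull ?h_monic //.
by rewrite addr0.
Qed.

Lemma lift_sharpK r : psharp (lift_sharp r) = r.
Proof.
have [p <-] := psharp_surj r; rewrite lift_sharpE; apply/psharp_eq.
exists (- Pdiv.Ring.rdivp p h).
by rewrite {2}(Pdiv.RingMonic.rdivp_eq h_monic p) mulNr addrAC subrr add0r.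
Qed.

Lemma size_lift r : (size (lift_sharp r) <= n)%N.
Proof. by rewrite -ltnS -size_h; apply: Pdiv.Ring.ltn_rmodpN0; exact: monic_neq0 h_monic. Qed.

Lemma lift_small (p : {poly S}) : (size p <= n)%N -> lift_sharp (psharp p) = p.
Proof. by move=> hp; rewrite lift_sharpE Pdiv.Ring.rmodp_small // size_h ltnS. Qed.

Lemma lift_linear s r r' :
  lift_sharp (cst s * r + r') = s *: lift_sharp r + lift_sharp r'.
Proof.
have -> : cst s * r + r' = psharp (s *: lift_sharp r + lift_sharp r').
  by rewrite rmorphD -mul_polyC rmorphM /= !lift_sharpK.
rewrite lift_small //.
apply: (leq_trans (size_polyD _ _)); rewrite geq_max size_lift andbT.
exact: leq_trans (size_scale_leq _ _) (size_lift r).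
Qed.

(* The functional extracting the coefficient of y^(n-1) makes R^# a symmetric
   S-algebra. *)
Definition tcoef (r : R) : S := (lift_sharp r)`_n.-1.

Lemma tcoef_linear s r r' : tcoef (cst s * r + r') = s * tcoef r + tcoef r'.
Proof. by rewrite /tcoef lift_linear coefD coefZ. Qed.

Lemma tcoef0 : tcoef 0 = 0.
Proof. by rewrite /tcoef -(rmorph0 psharp) lift_small ?size_poly0 // coef0. Qed.

Lemma tcoef_exp m : (m < n)%N -> tcoef (y ^+ m) = (m == n.-1)%:R.
Proof.
move=> hm; rewrite -psharpX -rmorphXn /tcoef lift_small ?size_polyXn //.
by rewrite coefXn eq_sym.
Qed.

(** The y^i and y^(n-1-i) are dual bases for this form: if i + j >= n, replacing y^n by -f leaves an
    exponent below n-1, because i + j <= 2n-2. *)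
Lemma tcoef_exp_add i j : (i < n)%N -> (j < n)%N ->
  tcoef (y ^+ (i + j)) = (i + j == n.-1)%N%:R.
Proof.
move=> hi hj; case: (ltnP (i + j) n) => [|le_n]; first exact: tcoef_exp.
rewrite -(subnKC le_n); set m := (i + j - n)%N.
have hm : (m < n.-1)%N by rewrite /m; lia.
rewrite exprD ysharpXn -rmorphN -[_ * _]addr0 tcoef_linear tcoef_exp; last by lia.
rewrite (ltn_eqF hm) mulr0 add0r; have -> : (n + m == n.-1)%N = false by apply/negbTE; lia.
exact: tcoef0.
Qed.

Lemma sharp_decomp r : r = \sum_(i < n) cst (lift_sharp r)`_i * y ^+ i.
Proof.
rewrite -{1}[r]lift_sharpK -{1}(coefK (lift_sharp r)) (poly_def).
rewrite rmorph_sum /= (big_ord_widen n (fun i => psharp ((lift_sharp r)`_i *: 'X^i))) ?size_lift //.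
rewrite big_mkcond /=; apply: eq_bigr => i _.
rewrite -mul_polyC rmorphM rmorphXn /= psharpX; case: ltnP => // hi.
by rewrite nth_default // /cst polyC0 rmorph0 mul0r.
Qed.

End Rsharp.

(** * Primes in finite ring extensions *)

Section FiniteExtension.
Variables (A B : comPzRingType) (g : {rmorphism A -> B}).

Lemma prm_contract (P : B -> Prop) : prm P -> prm (P \o g).
Proof.
case=> iP P1 pr; split=> /=; last by move=> a b; rewrite rmorphM => /pr.
  split; first by rewrite /= rmorph0; exact: submod0 iP.
  move=> a x y hx hy; change (P (g (a * x + y))).
  by rewrite rmorphD rmorphM; exact: iP.2.
by rewrite rmorph1.
Qed.

Lemma res_span (M : lmodType B) (l : seq M) x : span (M := res M g) l x -> span l x.
Proof.
apply: span_min; first split; first exact: submod0 (span_submod l).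
  by move=> a u v hu hv; apply: (span_submod l).2.
by move=> z; exact: (@span_mem _ M l z).
Qed.

Lemma noeth_res (M : lmodType B) : noeth (res M g) -> noeth M.
Proof.
move=> nM G; have [l [lG Gl]] := nM G.
by exists l; split=> // x /Gl; exact: res_span.
Qed.

Hypothesis nB : noeth (res B^o g).

(* The constant term of a monic relation for b modulo P lies in Q, hence in P,
   so that b can be cancelled from the relation. *)
Lemma incomparability (P Q : B -> Prop) : prm P -> prm Q -> ssub P Q ->
  ~ sub (Q \o g) (P \o g).
Proof.
move=> [iP P1 prP] [iQ Q1 prQ] [PQ /existsNP[b /not_implyP[Qb Pb]]] QP.
(* The value at b of the monic polynomial with lower coefficients [c], in Horner form: cancelling b
   from a relation removes the head of [c], and the empty list gives 1. *)
pose mval := fix mval (c : seq A) : B := if c is a :: c' then g a + b * mval c' else 1.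
have [c hc] : exists c, mval c = 0.
  have [l [lG Gl]] := nB (fun x => exists i, x = b ^+ i).
  have [m hm] : exists m, forall x, x \in l -> exists2 i, (i < m)%N & x = b ^+ i.
    elim: l lG {Gl} => [|x l IH] lG; first by exists 0%N.
    have [m hm] := IH (fun z hz => lG z (mem_behead (s := x :: l) hz)).
    have [i hi] := lG x (mem_head _ _).
    exists (maxn m i.+1) => z; rewrite inE => /orP[/eqP->|/hm[j hj ->]].
      by exists i => //; rewrite leq_max leqnn orbT.
    by exists j => //; rewrite leq_max hj.
  have : exists2 c : nat -> A, True & b ^+ m = \sum_(i < m) g (c i) * b ^+ i.
    pose H (x : res B^o g) := exists2 c : nat -> A, True & x = \sum_(i < m) g (c i) * b ^+ i.
    apply: (@span_min A (res B^o g) l H); last by apply: Gl; exists m.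
      split; first by exists (fun=> 0) => //; rewrite big1 // => i _; rewrite rmorph0 mul0r.
      move=> a _ _ [c _ ->] [d _ ->]; exists (fun i => a * c i + d i) => //.
      rewrite resZ scaler_sumr -big_split /=; apply: eq_bigr => i _.
      by rewrite rmorphD rmorphM mulrDl -mulrA.
    move=> x /hm[i hi ->]; exists (fun j => (j == i)%:R) => //.
    rewrite (bigD1 (Ordinal hi)) //= eqxx rmorph1 mul1r big1 ?addr0 // => j ji.
    by rewrite (negbTE (ji : nat_of_ord j != i)) rmorph0 mul0r.
  move=> [c _ e]; exists [seq - c i | i <- iota 0 m].
  have mvalE k j : mval [seq - c i | i <- iota j k] =
      b ^+ k - \sum_(i < k) g (c (j + i)%N) * b ^+ i.
    elim: k j => [|k IH] j; first by rewrite big_ord0 subr0.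
    rewrite /= IH big_ord_recl /= addn0 rmorphN mulr1 mulrBr -exprS opprD addrCA.
    congr (_ + (_ - _)); rewrite mulr_sumr; apply: eq_bigr => i _.
    by rewrite addSnnS exprS mulrCA.
  rewrite mvalE e; apply/eqP; rewrite subr_eq0; apply/eqP.
  by apply: eq_bigr => i _; rewrite add0n.
suff: ~ P (mval c) by apply; rewrite hc; exact: submod0 iP.
elim: c {hc} => //= a c IH h.
have Pa : P (g a).
  apply: QP => /=; apply: (submodK iQ _ (PQ _ h)); exact: (idlMr _ iQ).
have /prP[//|//] : P (b * mval c).
by apply: (submodK iP Pa); rewrite addrC.
Qed.

Lemma pchain_contract t (P Q : B -> Prop) : pchain t P Q -> pchain t (P \o g) (Q \o g).
Proof.
elim: t Q => [|t IH] Q; first by case=> pQ ->; split=> //; exact: prm_contract.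
case=> P' [hP' pQ hQ]; exists (P' \o g); split; [exact: IH|exact: prm_contract|].
have [_ pP'] := pchain_prm hP'.
by split; [move=> a; exact: hQ.1|exact: incomparability].
Qed.

End FiniteExtension.

Section RsharpLocal.
Variables (S : comNzRingType) (f : S) (n : nat).
Hypotheses (n_gt0 : (0 < n)%N) (nS : noeth S^o) (lS : idl (@nu S)) (f_nu : nu f).
Local Notation R := (Rsharp f n).
Local Notation y := (ysharp f n).
Local Notation h := (f%:P + 'X^n : {poly S}).
Local Notation iota_ := (cst f n).

Definition ypows : seq R := [seq y ^+ i | i <- iota 0 n].

Lemma span_ypows (r : R) : span (M := res R^o iota_) ypows r.
Proof.
rewrite (sharp_decomp n_gt0 r).
elim/big_ind: _ => [|u v hu hv|i _].
- exact: submod0 (span_submod _).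
- exact: (submodD (span_submod _) hu hv).
apply: (submodZ (span_submod (M := res R^o iota_) ypows)).
by apply: span_mem; apply/mapP; exists (i : nat); rewrite // mem_iota /=.
Qed.

Lemma noeth_resR : noeth (res R^o iota_).
Proof. exact: (@noeth_fg S (res R^o iota_) ypows nS span_ypows). Qed.

Lemma noeth_R : noeth R^o.
Proof. exact: noeth_res noeth_resR. Qed.

Lemma psharp_horner0 (p q : {poly S}) : psharp f n p = psharp f n q ->
  exists c, p.[0] = q.[0] + c * f.
Proof.
move=> /psharp_eq[c ->]; exists (c.[0]).
by rewrite !(hornerD, hornerM, hornerC, hornerXn) expr0n (gtn_eqF n_gt0) addr0.
Qed.

(** Write p = p(0) + q y. Modulo p the unit p(0)^n equals (-q y)^n, a multiple of y^n = -f. So R^#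
    is the sum of p R^# and f R^#, and Nakayama over S concludes. *)
Lemma psharp_unit (p : {poly S}) : ~ nu p.[0] -> ~ nu (psharp f n p).
Proof.
move=> /contrapT[v hv]; apply.
pose W (r : res R^o iota_) := exists r', r = psharp f n p * r'.
have hW : submod W.
  split; first by exists 0; rewrite mulr0.
  move=> a _ _ [r1 ->] [r2 ->]; exists (iota_ a * r1 + r2).
  by rewrite resZ /GRing.scale /= mulrDr mulrCA.
have [r e] : W 1; last by exists r.
have pS := nu_prm lS.
apply: (@nakayama S (res R^o iota_) (@nu S) W ypows pS hW (nu_sat hW)); last exact: span_ypows.
have /factor_theorem[q eq] : root (p - (p.[0])%:P) 0.
  by rewrite /root !hornerE subrr.
have ep : psharp f n p = iota_ p.[0] + psharp f n q * y.
  by rewrite -{1}[p](subrK (p.[0])%:P) eq subr0 rmorphD rmorphM addrC.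
have [g eg] : exists g, iota_ (p.[0]) ^+ n = psharp f n p * g + (- psharp f n q * y) ^+ n.
  exists (\sum_(i < n) iota_ p.[0] ^+ (n.-1 - i) * (- psharp f n q * y) ^+ i).
  by apply/eqP; rewrite -subr_eq subrXX ep mulNr opprK.
rewrite exprMn ysharpXn in eg.
move=> x _; exists 1; first by apply; exists 1; rewrite mulr1.
have v1 : iota_ v ^+ n * iota_ p.[0] ^+ n = 1.
  by rewrite -exprMn -rmorphM mulrC hv rmorph1 expr1n.
exists (psharp f n p * (g * iota_ v ^+ n * x)); first by eexists.
suff -> : (1 : S) *: (x : res R^o iota_) - psharp f n p * (g * iota_ v ^+ n * x) =
   f *: (- (- psharp f n q) ^+ n * iota_ v ^+ n * x : res R^o iota_).
  by apply: span_comb => //; exact: span_ypows.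
rewrite scale1r resZ /GRing.scale /= -{1}[x]mul1r -v1 eg; ring.
Qed.

Lemma nu_psharp (p : {poly S}) : nu (psharp f n p) <-> nu p.[0].
Proof.
split; first by move=> h; apply: contrapT => /psharp_unit.
move=> hp [r]; have [q <-] := psharp_surj r.
rewrite -rmorphM -(rmorph1 (psharp f n)) => /psharp_horner0[c].
rewrite hornerM hornerC => e; have [_ nu1 _] := nu_prm lS; apply: nu1.
have -> : 1 = p.[0] * q.[0] - c * f by rewrite e addrK.
by apply: (submodB lS); [exact: (idlMr _ lS)|exact: (idlM _ lS)].
Qed.

Lemma local_R : idl (@nu R).
Proof.
split; first by rewrite -(rmorph0 (psharp f n)); apply/nu_psharp; rewrite horner0; exact: submod0 lS.
move=> a b c; have [p <-] := psharp_surj a; have [q <-] := psharp_surj b.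
have [r <-] := psharp_surj c => /nu_psharp hq /nu_psharp hr.
rewrite /GRing.scale /= -rmorphM -rmorphD; apply/nu_psharp.
by rewrite hornerD hornerM; exact: lS.2.
Qed.

Lemma nu_cst s : nu (iota_ s) <-> nu s.
Proof. by rewrite /cst nu_psharp hornerC. Qed.

Lemma nu_y : nu y.
Proof. by rewrite -psharpX; apply/nu_psharp; rewrite hornerX; exact: submod0 lS. Qed.

End RsharpLocal.

(** * The ring A_k *)

Section TruncatedRing.
Variables (S : comNzRingType) (f : S) (n k : nat).
Hypotheses (n_gt0 : (0 < n)%N) (k_gt0 : (0 < k)%N) (le_kn : (k <= n)%N).
Local Notation R := (Rsharp f n).
Local Notation y := (ysharp f n).
Local Notation Ak := (A_ f k).

Definition ptrunc (p : {poly S}) : Ak := quot_ring_proj [:: f%:P; 'X^k] p.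
HB.instance Definition _ := GRing.RMorphism.copy ptrunc (quot_ring_proj [:: f%:P; 'X^k]).

Lemma ptrunc_eq (p q : {poly S}) :
  ptrunc p = ptrunc q <-> exists a b, p = q + (a * f%:P + b * 'X^k).
Proof.
rewrite [X in X <-> _]quot_ring_projP; split.
  move/seq_mul_span => [a _ [b _ /eqP e]]; exists a, b; apply/eqP.
  by rewrite addrC -subr_eq -subr_eq0 opprD addrA.
move=> [a [b ->]]; apply/seq_mul_span; exists a => //; exists b => //.
change (q + (a * f%:P + b * 'X^k) - q - a * f%:P - b * 'X^k = 0).
by ring.
Qed.

Lemma ptrunc_surj b : exists p, ptrunc p = b.
Proof. exact: quot_ring_proj_surj. Qed.

Definition trunc (r : R) : Ak := ptrunc (lift_sharp r).

(** As k <= n, the relation f + y^n lies in the ideal generated by f and y^k, so the chosen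
    representative does not matter. *)
Lemma truncE (p : {poly S}) : trunc (psharp f n p) = ptrunc p.
Proof.
rewrite /trunc; have /esym/psharp_eq[c {2}->] := lift_sharpK n_gt0 (psharp f n p).
apply/ptrunc_eq; exists (- c), (- c * 'X^(n - k)).
by rewrite -mulrA -exprD subnK // -mulrDr mulNr addrK.
Qed.

Lemma trunc_surj b : exists r, trunc r = b.
Proof. by have [p <-] := ptrunc_surj b; exists (psharp f n p); exact: truncE. Qed.

Lemma truncB : {morph trunc : r r' / r - r'}.
Proof.
move=> r r'; have [p <-] := psharp_surj r; have [q <-] := psharp_surj r'.
by rewrite -rmorphB !truncE rmorphB.
Qed.

Lemma trunc0 : trunc 0 = 0.
Proof. by rewrite -(subrr 0) truncB subrr. Qed.

Lemma truncD : {morph trunc : r r' / r + r'}.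
Proof. by move=> r r'; rewrite -{1}[r']opprK truncB -[- r']sub0r truncB trunc0 sub0r opprK. Qed.

Lemma truncM : {morph trunc : r r' / r * r'}.
Proof.
move=> r r'; have [p <-] := psharp_surj r; have [q <-] := psharp_surj r'.
by rewrite -rmorphM !truncE rmorphM.
Qed.

Lemma trunc1 : trunc 1 = 1.
Proof. by rewrite -(rmorph1 (psharp f n)) truncE rmorph1. Qed.

(** In R^# the element f = -y^n is already a multiple of y^k. *)
Lemma trunc_eq0 r : trunc r = 0 <-> exists r', r = y ^+ k * r'.
Proof.
have [p <-] := psharp_surj r; rewrite truncE -(rmorph0 ptrunc); split.
  move/ptrunc_eq => [a [b ->]]; exists (psharp f n b - y ^+ (n - k) * psharp f n a).
  rewrite add0r rmorphD !rmorphM rmorphXn /= psharpX mulrBr mulrA -exprD subnKC //.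
  by rewrite ysharpXn mulNr opprK [RHS]addrC; congr (_ + _); exact: mulrC.
move=> [r']; have [q <-] := psharp_surj r'.
rewrite -psharpX -rmorphXn -rmorphM => /psharp_eq[c ->].
apply/ptrunc_eq; exists c, (q + c * 'X^(n - k)).
by rewrite add0r mulrDr mulrDl -mulrA -exprD subnK // [q * _]mulrC addrCA.
Qed.

Lemma trunc_eq r r' : trunc r = trunc r' -> exists c, r - r' = y ^+ k * c.
Proof. by move/eqP; rewrite -subr_eq0 -truncB => /eqP/trunc_eq0. Qed.

Hypotheses (lS : idl (@nu S)) (f_nu : nu f).

Let lR : idl (@nu R) := local_R n_gt0 lS f_nu.

Lemma nu_yk : nu (y ^+ k).
Proof.
rewrite -(prednK k_gt0) exprS; apply: (idlMr _ lR).
exact: nu_y.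
Qed.

Lemma nu_trunc r : nu (trunc r) <-> nu r.
Proof.
split=> [h [r' e]|hr [b]]; first by apply: h; exists (trunc r'); rewrite -truncM e trunc1.
have [r' <-] := trunc_surj b.
rewrite -truncM -trunc1 => /eqP; rewrite -subr_eq0 -truncB => /eqP/trunc_eq0[c e].
have [_ nu1 _] := nu_prm lR; apply: nu1.
have -> : 1 = r * r' - y ^+ k * c by rewrite -e opprB addrC subrK.
by apply: (submodB lR); apply: (idlMr _ lR) => //; exact: nu_yk.
Qed.

Lemma local_trunc : idl (@nu Ak).
Proof.
split; first by rewrite -trunc0; apply/nu_trunc; exact: submod0 lR.
move=> a b c; have [r <-] := trunc_surj a.
have [r1 <-] := trunc_surj b; have [r2 <-] := trunc_surj c.
move=> /nu_trunc h1 /nu_trunc h2.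
change (nu (trunc r * trunc r1 + trunc r2)).
by rewrite -truncM -truncD; apply/nu_trunc; exact: lR.2.
Qed.

Lemma prm_trunc (P : Ak -> Prop) : prm P -> prm (P \o trunc).
Proof.
case=> iP P1 pr; split=> /=; last by move=> a b; rewrite truncM => /pr.
  split; first by rewrite /= trunc0; exact: submod0 iP.
  move=> a x z hx hz; change (P (trunc (a * x + z))).
  by rewrite truncD truncM; exact: iP.2.
by rewrite trunc1.
Qed.

Lemma pchain_pull t (P Q : Ak -> Prop) : pchain t P Q -> pchain t (P \o trunc) (Q \o trunc).
Proof.
elim: t Q => [|t IH] Q; first by case=> pQ ->; split=> //; exact: prm_trunc.
case=> P' [hP' pQ [h1 h2]]; exists (P' \o trunc); split; [exact: IH|exact: prm_trunc|].
split=> [r|h]; first exact: h1.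
by apply: h2 => b; have [r <-] := trunc_surj b; exact: h.
Qed.

Definition push (P : R -> Prop) (b : Ak) := exists2 r, P r & trunc r = b.

Lemma pushE (P : R -> Prop) r : idl P -> P (y ^+ k) -> push P (trunc r) <-> P r.
Proof.
move=> iP Py; split; last by exists r.
move=> [r' Pr' /eqP]; rewrite eq_sym -subr_eq0 -truncB => /eqP/trunc_eq0[c e].
by apply: (submodK iP (submodN iP Pr')); rewrite e; exact: (idlMr _ iP).
Qed.

Lemma prm_push (P : R -> Prop) : prm P -> P (y ^+ k) -> prm (push P).
Proof.
move=> [iP P1 pr] Py; split.
- split; first by exists 0; [exact: submod0 iP|exact: trunc0].
  move=> a _ _ [x Px <-] [z Pz <-]; have [r <-] := trunc_surj a.
  by exists (r * x + z); [exact: iP.2|rewrite truncD truncM].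
- by rewrite -trunc1 pushE.
move=> a b; have [r <-] := trunc_surj a; have [r' <-] := trunc_surj b.
by rewrite -truncM !pushE //; exact: pr.
Qed.

Lemma pchain_push t (P Q : R -> Prop) : P (y ^+ k) -> pchain t P Q ->
  pchain t (push P) (push Q).
Proof.
move=> Py; elim: t Q => [|t IH] Q; first by case=> pQ e; subst Q; split=> //; exact: prm_push.
case=> P' [hP' pQ [h1 h2]].
have [_ pP'] := pchain_prm hP'; have P'y := pchain_sub hP' Py; have Qy := h1 _ P'y.
exists (push P'); split; [exact: IH|exact: prm_push|split].
  by move=> _ [r hr <-]; exists r => //; exact: h1.
move=> h; apply: h2 => r hr.
have [[iP' _ _] [iQ _ _]] := (pP', pQ).
by apply/(pushE _ iP') => //; apply: h; exists r.
Qed.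

End TruncatedRing.

Lemma regular_localP (S : comNzRingType) e : regular_local_ring S e ->
  [/\ noeth S^o, idl (@nu S), forall t (P Q : S -> Prop), pchain t P Q -> (t <= e)%N &
    exists xs : seq S, [/\ size xs = e, forall x, x \in xs -> nu x,
      gen_max (fun x => x = 0) xs & prime_seq (fun x => x = 0) xs]].
Proof.
case=> /noeth_noetherian nS /local_idl lS /krull_dimP[[P [Q hPQ]] dS] [xs sz hxs].
have hnu a : nu a <-> span (M := S^o) xs a.
  split; first by move/nuP; rewrite hxs => /seq_mul_span.
  by move/seq_mul_span; rewrite -hxs => /nuP.
have xnu x : x \in xs -> nu x by move=> xx; apply/hnu; exact: span_mem.
have gx : gen_max (fun x : S => x = 0) xs.
  by move=> K iK _ xK a /hnu; exact: span_min.
split=> //; exists xs; split=> //.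
have [t' le_t h] := pchain_top lS hPQ.
have et : t' = size xs by apply/eqP; rewrite sz eqn_leq le_t (dS _ _ _ h).
rewrite et in h; have [[iP _ _] _] := pchain_prm h.
apply: (regular_prime_seq nS lS (@submod_eq0 S S^o) xnu gx _ _ h) => x ->.
  exact: submod0 lS.
exact: submod0 iP.
Qed.

(** * Projective modules and regular sequences *)

Section Generators.
Variables (A : comPzRingType) (M : lmodType A).

Lemma fin_genP : fin_gen M <-> exists l, forall x : M, span l x.
Proof.
split=> -[l hl]; exists l => x; first by have [c ->] := hl x; exact: sum_comb.
by have [c _ e] := comb_sum (hl x); exists c.
Qed.

(** The dual basis criterion for projectivity: [l] generates, but the coordinates [c] need not be
    its only ones. *)
Definition dual_basis (l : seq M) (c : 'I_(size l) -> M -> A) :=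
  (forall i a u v, c i (a *: u + v) = a * c i u + c i v) /\
  forall v, v = \sum_i c i v *: l`_i.

Lemma projective_dual_basis : projective M -> fin_gen M ->
  exists l c, @dual_basis l c.
Proof.
move=> pM [l hl].
pose q (r : 'rV[A]_(size l)) : M := \sum_i r 0 i *: l`_i.
have ql : linear q.
  move=> a u v; rewrite /q scaler_sumr -big_split /=; apply: eq_bigr => i _.
  by rewrite !mxE scalerDl scalerA.
pose qL : {linear 'rV[A]_(size l) -> M} :=
  HB.pack q (GRing.isLinear.Build A _ _ _ q ql).
have [|s hs] := pM _ _ qL (idfun : {linear M -> M}).
  move=> v; have [c e] := hl v; exists (\row_i c i); rewrite e.
  by apply: eq_bigr => i _; rewrite mxE.
exists l, (fun i v => s v 0 i); split=> [i a u v|v].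
  by rewrite linearP !mxE.
by rewrite -[LHS]hs.
Qed.

Lemma dual_basis_projective l c : @dual_basis l c -> projective M.
Proof.
move=> [clin cE] X Y g h gs.
have [b hb] := choice (fun i => gs (h (l`_i))).
pose s (v : M) : X := \sum_(i < size l) c i v *: b i.
have sl : linear s.
  move=> a u v; rewrite /s scaler_sumr -big_split /=; apply: eq_bigr => i _.
  by rewrite clin scalerDl scalerA.
exists (HB.pack_for {linear M -> X} s (GRing.isLinear.Build A _ _ _ s sl)) => v /=.
rewrite [v in RHS]cE /s !linear_sum; apply: eq_bigr => i _.
by rewrite !linearZ /= hb.
Qed.

Lemma dual_basis0 l c : @dual_basis l c -> forall i, c i 0 = 0.
Proof.
move=> [clin _] i; have := clin i 1 0 0; rewrite scale1r addr0 mul1r => e.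
by rewrite -[LHS](addrK (c i 0)) -e subrr.
Qed.

Lemma dual_basisZ l c : @dual_basis l c -> forall i a v, c i (a *: v) = a * c i v.
Proof.
by move=> h i a v; rewrite -[a *: v]addr0 h.1 (dual_basis0 h) addr0.
Qed.

Lemma dual_basisD l c : @dual_basis l c -> forall i u v, c i (u + v) = c i u + c i v.
Proof. by move=> h i u v; rewrite -[u]scale1r h.1 mul1r scale1r. Qed.

(** A relation with a unit coefficient expresses one generator through the others, so the list can
    be shortened until no such relation is left. *)
Lemma minimal_generators (l0 : seq M) : (forall v, span l0 v) ->
  exists l : seq M, (forall v, span l v) /\
  forall c : 'I_(size l) -> A, \sum_i c i *: l`_i = 0 -> forall i, nu (c i).
Proof.
have [m] := ubnP (size l0); elim: m l0 => // m IH l0 hm hl0.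
have [h|] := EM (forall c : 'I_(size l0) -> A, \sum_i c i *: l0`_i = 0 -> forall i, nu (c i)).
  by exists l0.
move=> /existsNP[c /not_implyP[e /existsNP[i /contrapT[b hb]]]].
pose l' := take i l0 ++ drop i.+1 l0.
have sz : (size l' < size l0)%N.
  by rewrite size_cat size_drop size_take ltn_ord -addSn subnKC.
have ml' (j : 'I_(size l0)) : j != i -> l0`_j \in l'.
  rewrite mem_cat => ji; apply/orP.
  have : (j < i)%N || (i < j)%N by rewrite -neq_ltn.
  case/orP => h; [left|right].
    by rewrite -(nth_take _ h) mem_nth // size_take ltn_ord.
  have -> : l0`_j = (drop i.+1 l0)`_(j - i.+1) by rewrite nth_drop subnKC.
  by rewrite mem_nth // size_drop; apply: ltn_sub2r (ltn_ord j); apply: leq_ltn_trans h _.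
apply: (IH l'); first by rewrite (leq_trans sz).
move=> v; apply: span_min (hl0 v) => [|x /(nthP 0)[j hj <-]]; first exact: span_submod.
have [ji|ji] := eqVneq (Ordinal hj) i; last by apply: span_mem; exact: (ml' _ ji).
have -> : l0`_j = l0`_i by rewrite -ji.
have -> : l0`_i = - (b *: \sum_(j | j != i) c j *: l0`_j).
  move: e; rewrite (bigD1 i) //= => /eqP; rewrite addrC addr_eq0 => /eqP ->.
  by rewrite scalerN opprK scalerA mulrC hb scale1r.
apply: submodN; [exact: span_submod|apply: submodZ; first exact: span_submod].
elim/big_ind: _ => [|u w|k ki]; first exact: submod0 (span_submod _).
  exact: (submodD (span_submod _)).
by apply: submodZ; [exact: span_submod|apply: span_mem; exact: ml'].
Qed.

End Generators.

Section RegularSequences.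
Variables (A : comPzRingType) (M : lmodType A).
Implicit Types (U : M -> Prop) (s : seq A).
Let T : M -> Prop := fun=> True.

Definition muls U s := foldl (fun U a => addmul U a T) U s.

Lemma mulsP U s x : muls U s x <->
  exists v : 'I_(size s) -> M, U (x - \sum_(i < size s) s`_i *: v i).
Proof.
elim: s U x => [|a s IH] U x.
  by split=> [h|[v]]; [exists (fun=> 0)|]; rewrite big_ord0 subr0.
rewrite /= IH; split.
  move=> [v [w _ h]]; exists (fun i => oapp v w (unlift ord0 i)).
  rewrite big_ord_recl unlift_none /= opprD addrCA addrC; move: h.
  by under [X in _ -> U (_ - X - _)]eq_bigr => i _ do rewrite liftK /=.
move=> [v]; rewrite big_ord_recl /= opprD addrCA addrC => h.
by exists (fun i => v (lift ord0 i)), (v ord0).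
Qed.

Lemma muls_seq_mul s x : muls (fun x => x = 0) s x <-> x \in seq_mul M s.
Proof.
rewrite mulsP; split=> [[v /eqP]|/seq_mulP[v ->]].
  by rewrite subr_eq0 => /eqP ->; apply/seq_mulP; exists v.
by exists v; rewrite subrr.
Qed.

Lemma dep_seq t U : dep t U T <-> exists s, [/\ size s = t, forall a, a \in s -> nu a &
  forall i, (i < t)%N -> regular_on s`_i (muls U (take i s)) T].
Proof.
elim: t U => [|t IH] U; first by split=> // _; exists [::].
split.
  move=> [a [anu ra /IH[s [sz snu hs]]]]; exists (a :: s); split=> /=.
  - by rewrite sz.
  - by move=> b; rewrite inE => /orP[/eqP->|/snu].
  - by case.
case=> -[|a s] [] //= [sz] snu hs; exists a; split.
- by apply: snu; rewrite mem_head.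
- exact: (hs 0%N).
- apply/IH; exists s; split=> // [b bs|i ti]; first by apply: snu; rewrite inE bs orbT.
  exact: (hs i.+1).
Qed.

Hypothesis lA : idl (@nu A).

Lemma regular_sequence_dep s : regular_sequence M s -> dep (size s) (fun x => x = 0) T.
Proof.
case=> snu hs _; apply/dep_seq; exists s; split=> //.
  by move=> a /snu/nuP.
by move=> i ti v _ /muls_seq_mul/(hs i ti)/muls_seq_mul.
Qed.

(** Nakayama supplies the condition that M differs from sM, which [dep] does not ask for. *)
Lemma dep_regular_sequence t : fin_gen M -> ~ (forall x : M, x = 0) ->
  dep t (fun x => x = 0) T -> exists2 s, size s = t & regular_sequence M s.
Proof.
move=> /fin_genP[l hl] M0 /dep_seq[s [sz snu hs]]; exists s => //; split.
- by move=> a /snu ha; apply/nuP.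
- by rewrite sz => i ti x /muls_seq_mul h; apply/muls_seq_mul; exact: hs.
apply: contrapT => h; apply: M0 => x.
apply: (@nakayama A M (@nu A) _ l (nu_prm lA) (@submod_eq0 A M)
  (nu_sat (@submod_eq0 A M))); last exact: hl.
move=> {}x _; exists 1; first by apply; exists 1; rewrite mulr1.
exists 0 => //; rewrite scale1r subr0.
have /seq_mulP[v ->] : x \in seq_mul M s.
  by apply: contrapT => /negP hx; apply: h; exists x.
have hc : submod (comb (@nu A) l) by apply: comb_submod; [exact: lA.1|exact: lA.2].
elim/big_ind: _ => [|u w hu hw|i _]; [exact: submod0|exact: submodD|].
by apply: span_comb => //; apply: snu; exact: mem_nth.
Qed.

End RegularSequences.

(** * Depth over R and projectivity over S *)

Section DepthAndFreeness.
Variables (S : comNzRingType) (R : comPzRingType) (g : {rmorphism S -> R}).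
Hypotheses (nS : noeth S^o) (lS : idl (@nu S)).
Hypotheses (nR : noeth R^o) (lR : idl (@nu R)) (nRg : noeth (res R^o g)).
Hypothesis nug : forall s, nu (g s) <-> nu s.
Variables (M : lmodType R).
Let T : M -> Prop := fun=> True.
Implicit Types (U : M -> Prop) (J : S -> Prop) (s : seq S).

Section OneModule.
Variables (l : seq M) (c : 'I_(size l) -> M -> S).
Hypothesis hc : @dual_basis S (res M g) l c.

Let cD i u v : c i (u + v) = c i u + c i v. Proof. exact: (dual_basisD hc). Qed.
Let cZ i a v : c i (g a *: v) = a * c i v. Proof. exact: (dual_basisZ hc). Qed.
Let c0 i : c i 0 = 0. Proof. exact: (dual_basis0 hc). Qed.
Let cN i u : c i (- u) = - c i u.
Proof. by apply/eqP; rewrite -addr_eq0 -cD addNr c0. Qed.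
Let cE v : v = \sum_i g (c i v) *: l`_i. Proof. exact: hc.2. Qed.

(** For an ideal J this is JM, read off the dual basis; an x outside a prime J is then visibly
    regular modulo JM. *)
Let coords J v := forall i, J (c i v).

Lemma projective_dep s J : idl J -> (forall x, x \in s -> nu x) -> prime_seq J s ->
  dep (size s) (coords J) T.
Proof.
elim: s J => // x s IH J iJ snu /= [pJ [Jx hJ]].
have [_ _ prJ] := pJ.
exists (g x); split.
- by apply/nug; apply: snu; rewrite mem_head.
- by move=> v _ h i; have := h i; rewrite cZ => /prJ[].
have -> : addmul (coords J) (g x) T = coords (addmul (M := S^o) J x (fun=> True)).
  apply/funext => v; apply/propext; split.
    by move=> [w _ h] i; exists (c i w) => //; have := h i; rewrite cD cN cZ.
  move=> /(_ _)/cid2 h; pose a i := projT1 (h i).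
  have ha i : J (c i v - x * a i) by rewrite /a; case: (h i).
  exists (\sum_i g (a i) *: l`_i) => // i.
  rewrite {1}[v]cE scaler_sumr -sumrB.
  elim/big_ind: _ => [|u w hu hw|j _]; first by rewrite c0; exact: submod0 iJ.
    by rewrite cD; exact: (submodD iJ).
  rewrite scalerA -rmorphM -scalerBl -rmorphB cZ; exact: (idlMr _ iJ).
apply: IH hJ => [|z zs]; first exact: submod_addmul.
by apply: snu; rewrite inE zs orbT.
Qed.

Lemma coords0 v : coords (fun a => a = 0) v <-> v = 0.
Proof.
split=> [h|->]; last by move=> i; exact: c0.
by rewrite [v]cE big1 // => i _; rewrite h rmorph0 scale0r.
Qed.

Lemma projective_regular (a : S) (v : M) : prm (fun s : S => s = 0) -> a != 0 ->
  g a *: v = 0 -> v = 0.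
Proof.
move=> [_ _ pr0] a0 e; apply/coords0 => i.
have /pr0[e0|//] : a * c i v = 0 by rewrite -cZ e c0.
by rewrite e0 eqxx in a0.
Qed.

End OneModule.

Lemma projective_depth s : fin_gen (res M g) -> projective (res M g) ->
  (forall x, x \in s -> nu x) -> prime_seq (fun a => a = 0) s ->
  dep (size s) (fun v : M => v = 0) T.
Proof.
move=> fM pM snu hs; have [l [c hc]] := projective_dual_basis pM fM.
have -> : (fun v : M => v = 0) = (fun v => forall i, c i v = 0).
  by apply/funext => v; apply/propext; rewrite -(coords0 hc).
exact: (projective_dep hc (@submod_eq0 S S^o)).
Qed.

(** Unlike in [dep], the sequence is prescribed. *)
Fixpoint wreg U s : Prop :=
  if s is x :: s' then regular_on (g x) U T /\ wreg (addmul U (g x) T) s' else True.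

Hypothesis nM : noeth M.

(* An associated prime of M/U containing g x would start a chain whose
   contraction to S is longer than the height theorem allows. *)
Lemma depth_wreg U J s : submod U -> idl J -> (forall a v, J a -> U (g a *: v)) ->
  (forall x, x \in s -> nu x) -> gen_max J s -> dep (size s) U T -> wreg U s.
Proof.
elim: s U J => // x s IH U J hU iJ JU snu gJ dU.
have hT : submod T by [].
have {}snu' z : z \in s -> nu z by move=> zs; apply: snu; rewrite inE zs orbT.
have rx : regular_on (g x) U T.
  move=> v _ xv; apply: contrapT => Uv.
  have [w [_ pw vw Uw _]] := max_ann nR lR hU hT Logic.I Uv.
  have [Q /(pchain_contract nRg) hQ] := dep_chain nR lR nM hU hT Logic.I Uw pw dU.
  have h : sub (fun a => J a \/ a = x) (ann U w \o g).
    by move=> a [Ja|->]; [exact: JU|exact: vw].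
  by have := height_theorem nS lS snu' (gen_max_cons gJ) h hQ; rewrite ltnn.
split=> //; apply: (IH _ (addmul (M := S^o) J x (fun=> True))) => //.
- exact: submod_addmul.
- exact: submod_addmul.
- move=> a v [b _ Jb]; exists (g b *: v) => //.
  rewrite scalerA -rmorphM -scalerBl -rmorphB; exact: JU.
- move=> K iK JK sK; apply: gJ => // [a Ja|z].
    by apply: JK; exact: (@addmul_subl S S^o J x (fun=> True)).
  rewrite inE => /orP[/eqP->|/sK //]; apply: JK.
  by rewrite -{2}[x]mulr1; exact: (@addmul_mem S S^o J x (fun=> True) 1 iJ Logic.I).
- apply: dep_addmul => //; apply/nug/snu; exact: mem_head.
Qed.

(* Relations among minimal generators have coefficients in the maximal ideal;
   each regular element g x cuts that ideal down from J + xS to J, until J = 0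
   and the generators form a basis. *)
Lemma wreg_relations U J (l : seq M) s : submod U -> idl J ->
  (forall v, U v -> comb (M := res M g) (@nu S) l v) ->
  (forall v, span (M := res M g) l v) ->
  (forall c : 'I_(size l) -> S, \sum_i g (c i) *: l`_i = 0 -> forall i, nu (c i)) ->
  (forall a v, J a -> U (g a *: v)) -> (forall x, x \in s -> nu x) -> sub J (@nu S) ->
  gen_max J s -> wreg U s ->
  forall c : 'I_(size l) -> S, U (\sum_i g (c i) *: l`_i) -> forall i, J (c i).
Proof.
move=> + + + hl hmin; elim: s U J => [|x s IH] U J hU iJ Unu JU snu Jnu gJ /=.
  (* Here J contains the maximal ideal m. As U lies in mM, a relation modulo U differs from an exact
     one by non-unit coefficients. *)
  move=> _ c Uc i; apply: gJ => //.
  have [a anu ea] := comb_sum (Unu _ Uc).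
  have := hmin (fun i => c i - a i); rewrite -[X in X = 0 -> _]/(\sum_i _) => h.
  apply: (submodKB lS (anu i)); apply: h.
  under eq_bigr => j _ do rewrite rmorphB scalerBl.
  by rewrite sumrB; apply/eqP; rewrite subr_eq0; apply/eqP.
move=> [rx hs].
have xnu : nu x by apply: snu; rewrite mem_head.
pose J1 := addmul (M := S^o) J x (fun=> True).
have iJ1 : idl J1 by exact: submod_addmul.
have {}IH : forall c : 'I_(size l) -> S, addmul U (g x) T (\sum_i g (c i) *: l`_i) ->
    forall i, J1 (c i).
  apply: IH => //.
  - exact: submod_addmul.
  - move=> v [w _ /Unu h].
    have hcl : submod (comb (M := res M g) (@nu S) l).
      by apply: comb_submod; [exact: lS.1|exact: lS.2].
    apply: (submodKB hcl _ h); rewrite -(@resZ _ _ g).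
    exact: span_comb (hl w).
  - move=> a v [b _ Jb]; exists (g b *: v) => //.
    rewrite scalerA -rmorphM -scalerBl -rmorphB; exact: JU.
  - by move=> z zs; apply: snu; rewrite inE zs orbT.
  - apply: (@addmul_min S S^o J x (fun=> True) (@nu S) lS Jnu) => v _; exact: (idlMr _ lS xnu).
  move=> K iK JK sK; apply: gJ => // [a Ja|z].
    by apply: JK; exact: (@addmul_subl S S^o J x (fun=> True)).
  rewrite inE => /orP[/eqP->|/sK //]; apply: JK.
  by rewrite -[x]mulr1; exact: (@addmul_mem S S^o J x (fun=> True) 1 iJ Logic.I).
(* The i-th coefficients of relations modulo U. Induction writes c as x c' modulo J, and regularity
   of x makes c' a relation again; so [rel i] lies in J + x [rel i]. *)
pose rel i a := exists2 c : 'I_(size l) -> S, U (\sum_j g (c j) *: l`_j) & c i = a.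
suff relJ i : sub (rel i) J by move=> c Uc i; apply: relJ; exists c.
have [ls [lsr rls]] := nS (rel i).
move=> a /rls; apply: (@nakayama S S^o (@nu S) J ls (nu_prm lS) iJ (nu_sat iJ)).
move=> _ /lsr[c Uc <-]; exists 1; first by apply; exists 1; rewrite mulr1.
have h j : exists c', J (c j - x * c').
  by have [|c' _ hc'] := IH c _ j; [exact: addmul_subl|exists c'].
have [c' hc'] := choice h.
exists (c i - x * c' i); first exact: hc'.
rewrite scale1r opprB addrC subrK.
apply: (@span_comb S S^o) => //; apply: rls; exists c' => //.
apply: rx => //.
have -> : g x *: (\sum_j g (c' j) *: l`_j) =
    \sum_j g (c j) *: l`_j - \sum_j g (c j - x * c' j) *: l`_j.
  rewrite scaler_sumr -sumrB; apply: eq_bigr => j _.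
  by rewrite -scalerBl -rmorphB opprB addrC subrK scalerA rmorphM.
apply: submodB => //.
by elim/big_ind: _ => [|u w|j _]; [exact: submod0|exact: submodD|exact: JU].
Qed.

Lemma depth_projective s : fin_gen (res M g) -> (forall x, x \in s -> nu x) ->
  gen_max (fun a => a = 0) s -> dep (size s) (fun v : M => v = 0) T ->
  projective (res M g).
Proof.
move=> /fin_genP[l0 hl0] snu gs dM.
have [l [hl lmin]] := minimal_generators hl0.
have hw := depth_wreg (@submod_eq0 R M) (@submod_eq0 S S^o) _ snu gs dM.
have {}hw : wreg (fun v => v = 0) s.
  by apply: hw => a v ->; rewrite rmorph0 scale0r.
have free := @wreg_relations _ _ l s (@submod_eq0 R M) (@submod_eq0 S S^o) _ hl lmin _ snu _ gs hw.
have {}free (c : 'I_(size l) -> S) : \sum_i c i *: l`_i = 0 -> forall i, c i = 0.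
  apply: free.
  - move=> v ->; apply: (@submod0 _ _ (comb (M := res M g) (@nu S) l)).
    by apply: comb_submod; [exact: lS.1|exact: lS.2].
  - by move=> a v ->; rewrite rmorph0 scale0r.
  - by move=> a ->; exact: submod0 lS.
have hs v : exists c : 'I_(size l) -> S, v = \sum_i c i *: (l`_i : res M g).
  by have [c _ e] := comb_sum (hl v); exists c.
have [c hc] := choice hs.
apply: (@dual_basis_projective _ _ l (fun i v => c v i)); split=> [i a u v|v]; last exact: hc.
apply/eqP; rewrite -subr_eq0; apply/eqP.
apply: (free (fun i => c (a *: u + v) i - (a * c u i + c v i))).
under eq_bigr => j _ do rewrite scalerBl scalerDl -scalerA.
by rewrite sumrB big_split /= -scaler_sumr -!hc subrr.
Qed.

End DepthAndFreeness.

(** * Submodules as types and closure properties of modules *)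

Definition mklin (A : comPzRingType) (X Y : lmodType A) (g : X -> Y) (gl : linear g) :
  {linear X -> Y} := HB.pack_for {linear X -> Y} g (GRing.isLinear.Build A X Y _ g gl).

Section SubmoduleType.
Variables (A : comPzRingType) (M : lmodType A) (U : M -> Prop) (hU : submod U).

(** The proof of closure is an argument, so that the structures on this predicate can depend on
    it. *)
Definition sub_pred of submod U : {pred M} := fun x => `[< U x >].

Lemma sub_pred_closed : submod_closed (sub_pred hU).
Proof.
split; first by apply/asboolP; exact: submod0.
by move=> a x y /asboolP hx /asboolP hy; apply/asboolP; exact: hU.2.
Qed.
HB.instance Definition _ := GRing.isSubmodClosed.Build A M (sub_pred hU)
  (GRing.submod_closed_semi sub_pred_closed).
HB.instance Definition _ := GRing.isOppClosed.Build M (sub_pred hU)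
  (GRing.zmod_closedN (GRing.submod_closedB sub_pred_closed)).

Record subm := Subm { subm_val : M; subm_prop : subm_val \in sub_pred hU }.
HB.instance Definition _ := [isSub for subm_val].
HB.instance Definition _ := [Choice of subm by <:].
HB.instance Definition _ := [SubChoice_isSubZmodule of subm by <:].
HB.instance Definition _ := [SubZmodule_isSubLmodule of subm by <:].
Definition mksub x (Ux : U x) : subm := Subm (introT (asboolP (U x)) Ux).
Lemma submP (x : subm) : U (val x).
Proof. exact: (asboolP _ (subm_prop x)). Qed.
End SubmoduleType.

Section ModuleClosure.
Variable A : comPzRingType.
Implicit Types X Y Z : lmodType A.

Lemma fin_gen_surj X Y (q : {linear X -> Y}) : surjective q -> fin_gen X -> fin_gen Y.
Proof.
move=> qs /fin_genP[l hl]; apply/fin_genP; exists (map q l) => v.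
have [x <-] := qs v; apply: (@span_min _ _ l (fun x => span (map q l) (q x))) (hl x).
  split; first by rewrite linear0; exact: submod0 (span_submod _).
  by move=> a u w hu hw; rewrite linearP; exact: (span_submod _).2.
by move=> u ul; apply: span_mem; exact: map_f.
Qed.

Lemma projective_retract X Y (i : {linear Y -> X}) (q : {linear X -> Y}) :
  cancel i q -> projective X -> projective Y.
Proof.
move=> iK pX U V g h gs.
have [l hl] := pX U V g (h \o q) gs.
by exists (l \o i) => y; rewrite hl /= iK.
Qed.

Lemma projective_section X Y (q : {linear X -> Y}) : projective Y -> surjective q ->
  exists s : {linear Y -> X}, cancel s q.
Proof. by move=> pY qs; have [s hs] := pY _ _ q idfun qs; exists s. Qed.

Lemma projective_zero X : (forall x : X, x = 0) -> projective X.
Proof.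
move=> h; apply: (@dual_basis_projective _ _ [::] (fun _ _ => 0)); split.
  by move=> i a u v; rewrite mulr0 addr0.
by move=> v; rewrite big_ord0.
Qed.

Lemma inl_linear X Y : linear (fun x : X => (x, 0 : Y)).
Proof. by move=> a u v; congr pair; rewrite /= scaler0 addr0. Qed.
Lemma inr_linear X Y : linear (fun y : Y => (0 : X, y)).
Proof. by move=> a u v; congr pair; rewrite /= scaler0 addr0. Qed.
Definition inl_lin X Y := mklin (@inl_linear X Y).
Definition inr_lin X Y := mklin (@inr_linear X Y).
Definition fst_lin X Y : {linear (X * Y)%type -> X} := mklin (fun a u v => erefl : (a *: u + v).1 = a *: u.1 + v.1).
Definition snd_lin X Y : {linear (X * Y)%type -> Y} := mklin (fun a u v => erefl : (a *: u + v).2 = a *: u.2 + v.2).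

Lemma projective_prod X Y : projective X -> projective Y -> projective (X * Y)%type.
Proof.
move=> pX pY U V g h gs.
have [lX hX] := pX U V g (h \o inl_lin X Y) gs.
have [lY hY] := pY U V g (h \o inr_lin X Y) gs.
have ll : linear (fun p : X * Y => lX p.1 + lY p.2).
  by move=> a u v; rewrite !linearP scalerDr addrACA.
exists (mklin ll) => -[x z] /=.
by rewrite linearD hX hY /= -linearD; congr (h (_, _)); rewrite ?addr0 ?add0r.
Qed.

Lemma fin_gen_prod X Y : fin_gen X -> fin_gen Y -> fin_gen (X * Y)%type.
Proof.
move=> /fin_genP[l hl] /fin_genP[l' hl']; apply/fin_genP.
exists (map (inl_lin X Y) l ++ map (inr_lin X Y) l') => -[x z].
have hs := span_submod (map (inl_lin X Y) l ++ map (inr_lin X Y) l').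
have -> : (x, z) = inl_lin X Y x + inr_lin X Y z by congr pair; rewrite /= ?addr0 ?add0r.
apply: (submodD hs).
  apply: (@span_min _ _ l (fun x => span _ (inl_lin X Y x))) (hl x).
    by split=> [|a u v hu hv]; [rewrite linear0; exact: submod0|rewrite linearP; exact: hs.2].
  by move=> u ul; apply: span_mem; rewrite mem_cat (map_f (inl_lin X Y)).
apply: (@span_min _ _ l' (fun x => span _ (inr_lin X Y x))) (hl' z).
  by split=> [|a u v hu hv]; [rewrite linear0; exact: submod0|rewrite linearP; exact: hs.2].
by move=> u ul; apply: span_mem; rewrite mem_cat (map_f (inr_lin X Y)) // orbT.
Qed.

Lemma inv_linear X Y (g : {linear X -> Y}) h : cancel g h -> cancel h g -> linear h.
Proof. by move=> gK hK a u v; apply: (can_inj gK); rewrite linearP !hK. Qed.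

Lemma factor_mono X Y Z (i : {linear X -> Y}) (h : {linear Z -> Y}) : injective i ->
  (forall z, exists x, i x = h z) -> exists l : {linear Z -> X}, forall z, i (l z) = h z.
Proof.
move=> inj /choice[l hl]; have ll : linear l.
  by move=> a u v; apply: inj; rewrite linearP !hl linearP.
by exists (mklin ll).
Qed.

Lemma noeth_fin_gen_sub X (hN : noeth X) (U : X -> Prop) (hU : submod U) :
  fin_gen (subm hU).
Proof.
have [l [lU Ul]] := hN U; apply/fin_genP.
have [l' el] : exists l' : seq (subm hU), map val l' = l.
  elim: l lU {Ul} => [|x l IH] lU; first by exists [::].
  have [l' e] := IH (fun z hz => lU z (mem_behead (s := x :: l) hz)).
  by exists (mksub hU (lU x (mem_head _ _)) :: l'); rewrite /= e.
exists l' => v; have : span l (val v) by apply: Ul; exact: submP.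
rewrite -el; elim: l' v {l lU Ul el} => [|x l IH] v /=; first by move=> e; apply: val_inj; exact: e.
case=> c _ h; exists c => //; apply: IH.
exact: h.
Qed.

End ModuleClosure.

Section RestrictedProjectivity.
Variables (A B : comPzRingType) (g : {rmorphism A -> B}).
Implicit Types X Y Z : lmodType B.

Lemma res_linear X Y (h : {linear X -> Y}) : linear (h : res X g -> res Y g).
Proof. by move=> a u v; exact: linearP. Qed.
Definition res_lin X Y (h : {linear X -> Y}) : {linear res X g -> res Y g} :=
  mklin (res_linear h).

Definition fg_rel_projective X := fin_gen X /\ projective (res X g).

Lemma fg_rel_projective_retract X Y (i : {linear Y -> X}) (q : {linear X -> Y}) :
  cancel i q -> fg_rel_projective X -> fg_rel_projective Y.
Proof.
move=> iK [fX pX]; split; first by apply: (fin_gen_surj (q := q)) fX => y; exists (i y).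
exact: (@projective_retract _ _ _ (res_lin i) (res_lin q)).
Qed.

(** Projectivity over S passes to direct summands at once, which is not visible for depth. *)
Lemma add_closure_rel_projective (C : lmodType B -> Prop) :
  (forall X, C X -> fg_rel_projective X) ->
  forall X, add_closure C X -> fg_rel_projective X.
Proof.
move=> hC X; elim=> {X} [X /hC //|X Y [h [h' hK h'K]] _|X X0|X Y _ [fX pX] _ [fY pY]|X Y _].
- exact: (@fg_rel_projective_retract _ _ (mklin (inv_linear hK h'K)) h).
- split; last exact: projective_zero.
  by apply/fin_genP; exists [::] => x; exact: X0.
- split; first exact: fin_gen_prod.
  have l1 : linear (fun p : res (X * Y)%type g => (p : res X g * res Y g)) by [].
  have l2 : linear (fun p : (res X g * res Y g)%type => (p : res (X * Y)%type g)) by [].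
  by apply: (@projective_retract _ _ _ (mklin l1) (mklin l2)) (projective_prod pX pY).
exact: (@fg_rel_projective_retract _ _ (inl_lin X Y) (fst_lin X Y)).
Qed.

End RestrictedProjectivity.

(** * Modules killed by y^k as A_k-modules *)

Section Descent.
Variables (S : comNzRingType) (f : S) (n k : nat).
Hypotheses (n_gt0 : (0 < n)%N) (le_kn : (k <= n)%N).
Local Notation R := (Rsharp f n).
Local Notation y := (ysharp f n).
Variable M : lmodType R.
Hypothesis kM : forall x : M, y ^+ k *: x = 0.

Definition descend of (0 < n)%N & (k <= n)%N & (forall x : M, y ^+ k *: x = 0) : Type := M.
Local Notation dM := (descend n_gt0 le_kn kM).
HB.instance Definition _ := GRing.Zmodule.on dM.

Let scale (b : A_ f k) (x : dM) : dM :=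
  projT1 (cid (trunc_surj n_gt0 le_kn b)) *: (x : M).
Let scaleE r x : scale (trunc k r) x = r *: (x : M).
Proof.
rewrite /scale; case: cid => r' e.
have [c ec] := trunc_eq n_gt0 le_kn e.
change (r' *: (x : M) = r *: (x : M)).
have -> : r' = r + y ^+ k * c by rewrite -ec addrC subrK.
by rewrite scalerDl mulrC -scalerA kM scaler0 addr0.
Qed.
Let surj (b : A_ f k) : exists r : R, trunc k r = b := trunc_surj n_gt0 le_kn b.
Let scaleA a b x : scale a (scale b x) = scale (a * b) x.
Proof. by have [r <-] := surj a; have [r' <-] := surj b; rewrite -(truncM n_gt0 le_kn r r') !scaleE scalerA. Qed.
Let scale1 : left_id 1 scale.
Proof. by move=> x; rewrite -(trunc1 f n_gt0 le_kn) scaleE scale1r. Qed.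
Let scaleDr : right_distributive scale +%R.
Proof. by move=> a x z; rewrite /scale scalerDr. Qed.
Let scaleDl x : {morph scale^~ x : a b / a + b}.
Proof.
by move=> a b; have [r <-] := surj a; have [r' <-] := surj b; rewrite -(truncD n_gt0 le_kn r r') !scaleE scalerDl.
Qed.

HB.instance Definition _ := GRing.Zmodule_isLmodule.Build (A_ f k) dM
  scaleA scale1 scaleDr scaleDl.

Lemma descendZ r (x : M) : trunc k r *: (x : dM) = r *: x.
Proof. exact: scaleE. Qed.

Lemma restriction_descend : restriction (dM : lmodType (A_ f k)) M.
Proof.
exists (idfun : {additive M -> M}); split; first by exists idfun.
move=> p x; have e : quot_ring_proj [:: f%:P; 'X^k] p = trunc k (psharp f n p).
  by rewrite truncE.
by rewrite e; exact: (esym (descendZ _ x)).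
Qed.

End Descent.

(** * Maximal Cohen-Macaulay modules over R^# and A_k *)

Section MCMModules.
Variables (S : comNzRingType) (f : S) (n d k : nat).
Hypotheses (hS : regular_local_ring S d.+1) (f_neq0 : f != 0) (f_nu : nu f).
Hypotheses (n_gt0 : (0 < n)%N) (k_gt0 : (0 < k)%N) (le_kn : (k <= n)%N).
Local Notation R := (Rsharp f n).
Local Notation y := (ysharp f n).
Local Notation g := (cst f n).

Let nS : noeth S^o. Proof. by case: (regular_localP hS). Qed.
Let lS : idl (@nu S). Proof. by case: (regular_localP hS). Qed.
Let dimS t (P Q : S -> Prop) : pchain t P Q -> (t <= d.+1)%N.
Proof. by case: (regular_localP hS) => _ _ + _; apply. Qed.
Let nR : noeth R^o := noeth_R n_gt0 nS.
Let lR : idl (@nu R) := local_R n_gt0 lS f_nu.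
Let nRg : noeth (res R^o g) := noeth_resR n_gt0 nS.
Let nug s : nu (g s) <-> nu s := nu_cst n_gt0 lS f_nu s.
Let nuyk : nu (y ^+ k) := nu_yk n_gt0 k_gt0 lS f_nu.

Lemma regular_local_domain : prm (fun s : S => s = 0).
Proof. by have [_ _ _ [[|x xs] [_ _ _ []]]] := regular_localP hS. Qed.

Lemma ysharpXnk : y ^+ n = y ^+ (n - k) * y ^+ k.
Proof. by rewrite -exprD subnK. Qed.

Lemma fin_gen_res (M : lmodType R) : fin_gen M <-> fin_gen (res M g).
Proof.
split=> /fin_genP[l hl]; apply/fin_genP; last first.
  by exists l => x; apply: (@res_span _ _ g); exact: hl.
pose L := [seq r *: x | r <- ypows f n, x <- l]; exists L => v.
have hL := span_submod (L : seq (res M g)).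
have hx x : x \in l -> forall r : R, span (M := res M g) L (r *: x).
  move=> xl r; apply: (@span_min S (res R^o g) (ypows f n)
    (fun r => span (M := res M g) L ((r : R) *: x))) (span_ypows n_gt0 r).
    split; first by rewrite scale0r; exact: submod0 hL.
    move=> a u w hu hw; change (span (M := res M g) L ((g a * (u : R) + (w : R)) *: x)).
    by rewrite scalerDl -scalerA; exact: hL.2.
  by move=> u ur; apply: span_mem; apply/allpairsP; exists (u, x).
have [c _ ->] := comb_sum (hl v).
elim/big_ind: _ => [|u w|i _]; first exact: submod0 hL.
  exact: (submodD hL).
by apply: hx; exact: mem_nth.
Qed.

Lemma fg_noeth (M : lmodType R) : fin_gen M -> noeth M.
Proof. by move=> /fin_genP[l]; exact: noeth_fg. Qed.

Lemma projective_res (F : lmodType R) : fin_gen F -> projective F -> projective (res F g).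
Proof.
move=> fF pF X Y q h qs.
have [l [c [clin cE]]] := projective_dual_basis pF fF.
have [b hb] := choice (fun ij : 'I_(size l) * 'I_n => qs (h (y ^+ ij.2 *: l`_ij.1))).
pose s (v : res F g) : X := \sum_i \sum_(j < n) (lift_sharp (c i v))`_j *: b (i, j).
have sl : linear s.
  move=> a u v; rewrite /s scaler_sumr -big_split; apply: eq_bigr => i _ /=.
  rewrite scaler_sumr -big_split; apply: eq_bigr => j _ /=.
  by rewrite resZ clin (lift_linear n_gt0) coefD coefZ scalerDl scalerA.
exists (mklin sl) => v; rewrite /= /s [v in RHS]cE !linear_sum; apply: eq_bigr => i _.
rewrite [c i v in RHS](sharp_decomp n_gt0) scaler_suml !linear_sum; apply: eq_bigr => j _.
by rewrite linearZ hb /= -linearZ resZ scalerA.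
Qed.

Lemma fg_rel_projective_free : fg_rel_projective g (R^o : lmodType R).
Proof.
have fR : fin_gen (R^o : lmodType R).
  by apply/fin_genP; exists [:: 1] => x; exists x; rewrite // /GRing.scale /= mulr1 subrr.
split=> //; apply: projective_res => //.
apply: (@dual_basis_projective R R^o [:: 1] (fun _ x => x)); split=> // v.
by rewrite big_ord_recl big_ord0 addr0 /GRing.scale /= mulr1.
Qed.

Lemma fg_rel_projective_dep (N : lmodType R) : fg_rel_projective g N ->
  dep d.+1 (fun v : N => v = 0) (fun=> True).
Proof.
case=> /fin_gen_res fN pN.
have [_ _ _ [xs [<- xnu _ px]]] := regular_localP hS.
exact: projective_depth.
Qed.

Lemma dep_rel_projective (N : lmodType R) : fin_gen N ->
  dep d.+1 (fun v : N => v = 0) (fun=> True) -> fg_rel_projective g N.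
Proof.
move=> fN; have [_ _ _ [xs [<- xnu gx _]]] := regular_localP hS => dN.
split=> //; have /fin_gen_res fN' := fN.
exact: (depth_projective nS lS nR lR nRg nug (fg_noeth fN) fN' xnu gx dN).
Qed.

Lemma rel_projective_regular (N : lmodType R) (v : N) : fg_rel_projective g N ->
  y ^+ k *: v = 0 -> v = 0.
Proof.
move=> [/fin_gen_res fN pN] e; have [l [c hc]] := projective_dual_basis pN fN.
apply: (projective_regular hc regular_local_domain f_neq0).
by rewrite /= -[g f]opprK -ysharpXn scaleNr ysharpXnk -scalerA e scaler0 oppr0.
Qed.

Lemma pchain_bound t (P Q : R -> Prop) : pchain t P Q -> (t <= d.+1)%N.
Proof. by move=> /(pchain_contract nRg); exact: dimS. Qed.

(** P contains f = -y^n up to sign, so the contracted chain can be preceded by the zero ideal of the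
    domain S. *)
Lemma pchain_bound_yk t (P Q : R -> Prop) : P (y ^+ k) -> pchain t P Q -> (t <= d)%N.
Proof.
move=> Pyk h; have [pP _] := pchain_prm h; have [iP _ _] := pP.
have Pf : P (g f).
  rewrite -[g f]opprK -ysharpXn; apply: (submodN iP).
  by rewrite ysharpXnk; exact: (idlM _ iP).
rewrite -ltnS; apply: (dimS (P := fun s => s = 0) (Q := Q \o g)).
apply: (pchain_cons regular_local_domain _ (pchain_contract nRg h)).
split; first by move=> _ ->; rewrite /= rmorph0; exact: submod0 iP.
by move=> h0; move: f_neq0; rewrite (h0 f Pf) eqxx.
Qed.

Lemma pchain_of_dep (N : lmodType R) t (U : N -> Prop) (v : N) : fin_gen N -> submod U -> ~ U v ->
  dep t U (fun=> True) -> exists P Q : R -> Prop, pchain t P Q /\ sub (ann U v) P.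
Proof.
move=> fN hU Uv dU.
have [w [_ pw vw Uw _]] := @max_ann R nR lR N U (fun=> True) v hU (@submodT _ _) Logic.I Uv.
have [Q hQ] := dep_chain nR lR (fg_noeth fN) hU (@submodT _ _) Logic.I Uw pw dU.
by exists (ann U w), Q.
Qed.

Let R1 : (1 : R) <> 0.
Proof. by move=> e; apply: (submod0 lR); exists 0; rewrite e mulr0. Qed.

(** Contraction to S bounds chains from above. The chain of the right length comes from the depth
    d+1 of R^#, which is projective over S. *)
Lemma krull_dim_R : krull_dim R d.+1.
Proof.
apply/krull_dimP; split; last exact: pchain_bound.
have [P [Q [h _]]] := pchain_of_dep fg_rel_projective_free.1 (@submod_eq0 _ _) R1
  (fg_rel_projective_dep fg_rel_projective_free).
by exists P, Q.
Qed.

Lemma MCM_rel_projective (N : lmodType R) : MCM N <-> fg_rel_projective g N.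
Proof.
split.
  case=> fN [N0|[e /(krull_dim_uniq krull_dim_R) <- [[s sz hs] _]]].
    by split=> //; exact: projective_zero.
  by apply: dep_rel_projective => //; rewrite -sz; exact: regular_sequence_dep.
move=> hN; have [fN _] := hN; split=> //.
have [N0|N0] := EM (forall x : N, x = 0); [by left|right].
exists d.+1; first exact: krull_dim_R.
have [s sz hs] := dep_regular_sequence lR fN N0 (fg_rel_projective_dep hN).
split; first by exists s.
move=> s' hs'.
have /existsNP[v Nv] := N0.
have [P [Q [h _]]] := pchain_of_dep fN (@submod_eq0 _ _) Nv (regular_sequence_dep hs').
exact: pchain_bound h.
Qed.

Lemma seq_mul1 (N : lmodType R) (a : R) (x : N) :
  (x \in seq_mul N [:: a]) <-> addmul (fun v => v = 0) a (fun=> True) x.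
Proof. by rewrite -muls_seq_mul. Qed.

Lemma dep_quotient (N : lmodType R) : fg_rel_projective g N ->
  dep d (addmul (fun v : N => v = 0) (y ^+ k) (fun=> True)) (fun=> True).
Proof.
move=> hN; apply: (dep_addmul nR lR (fg_noeth hN.1)) => //.
- exact: submod_eq0.
- exact: fg_rel_projective_dep.
- by move=> v _; exact: rel_projective_regular.
Qed.

Lemma krull_dim_Ak : krull_dim (A_ f k) d.
Proof.
apply/krull_dimP; split; last first.
  move=> t P Q hPQ; have [[iP _ _] _] := pchain_prm hPQ.
  apply: pchain_bound_yk (pchain_pull n_gt0 le_kn hPQ) => /=.
  have -> : trunc k (y ^+ k) = 0.
    by apply/(trunc_eq0 n_gt0 le_kn); exists 1; rewrite mulr1.
  exact: submod0 iP.
have hU : submod (addmul (fun v : (R^o : lmodType R) => v = 0) (y ^+ k) (fun=> True)).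
  by apply: submod_addmul; [exact: submod_eq0|].
have n1 : ~ addmul (fun v : (R^o : lmodType R) => v = 0) (y ^+ k) (fun=> True) (1 : R).
  move=> [v _ /eqP]; rewrite subr_eq0 => /eqP e; apply: nuyk; exists v.
  by rewrite [RHS]e.
have [P [Q [h Pyk]]] := pchain_of_dep fg_rel_projective_free.1 hU n1
  (dep_quotient fg_rel_projective_free).
exists (push P), (push Q); apply: pchain_push => //.
apply: Pyk; exists 1 => //; exact: subrr.
Qed.

Section QuotientMCM.
Variable N : lmodType R.
Let Q : lmodType R := quot_mod N [:: y ^+ k].

Lemma quot_mod_kill (x : Q) : y ^+ k *: x = 0.
Proof.
have [u <-] := quot_mod_proj_surj x.
rewrite -quot_mod_projZ -(raddf0 (quot_mod_proj (M := N) [:: y ^+ k])).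
apply/quot_mod_projP/seq_mul1; exists u => //; rewrite subr0; exact: subrr.
Qed.

Let M : lmodType (A_ f k) := descend n_gt0 le_kn quot_mod_kill.

Lemma dep_quot_mod t :
  dep t (addmul (fun v : N => v = 0) (y ^+ k) (fun=> True)) (fun=> True) <->
  dep t (fun v : M => v = 0) (fun=> True).
Proof.
apply: (@dep_transfer R (A_ f k) N M (quot_mod_proj [:: y ^+ k])).
- move=> u v; exact: (raddfB (quot_mod_proj (M := N) [:: y ^+ k])).
- move=> b; have [r <-] := trunc_surj n_gt0 le_kn b => /(nu_trunc n_gt0 k_gt0 le_kn lS f_nu) hr.
  by exists r => // x; rewrite quot_mod_projZ; exact: (esym (descendZ _ _ _ _ _)).
- move=> r hr; exists (trunc k r); first exact/(nu_trunc n_gt0 k_gt0 le_kn lS f_nu).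
  by move=> x; rewrite quot_mod_projZ; exact: (esym (descendZ _ _ _ _ _)).
- by apply: submod_addmul; [exact: submod_eq0|].
- by [].
- exact: submod_eq0.
- by [].
- by [].
- move=> v _; have [u <-] := quot_mod_proj_surj (v : Q); exists u => //; exact: subrr.
move=> v _; split=> [h|].
  rewrite -[0 in RHS](raddf0 (quot_mod_proj (M := N) [:: y ^+ k])).
  by apply/quot_mod_projP/seq_mul1; rewrite subr0.
rewrite -[0 in RHS](raddf0 (quot_mod_proj (M := N) [:: y ^+ k])).
by move=> /quot_mod_projP/seq_mul1; rewrite subr0.
Qed.

Lemma MCM_quot_mod : fg_rel_projective g N -> MCM M.
Proof.
move=> hN; have [fN _] := hN.
have fM : fin_gen M.
  have /fin_genP[l hl] := fN; apply/fin_genP; exists (map (quot_mod_proj [:: y ^+ k]) l) => x.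
  have [u <-] := quot_mod_proj_surj (x : Q).
  have hs := span_submod (map (quot_mod_proj [:: y ^+ k]) l : seq M).
  apply: (@span_min _ _ l (fun u => span (M := M) (map (quot_mod_proj [:: y ^+ k]) l)
    (quot_mod_proj [:: y ^+ k] u))) (hl u).
    split; first by rewrite raddf0; exact: submod0 hs.
    move=> a v w hv hw.
    have -> : quot_mod_proj [:: y ^+ k] (a *: v + w) =
        trunc k a *: (quot_mod_proj [:: y ^+ k] v : M) + (quot_mod_proj [:: y ^+ k] w : M).
      by rewrite descendZ; exact: linearP.
    exact: hs.2.
  by move=> v vl; apply: span_mem; exact: map_f.
split=> //.
have [M0|M0] := EM (forall x : M, x = 0); [by left|right].
exists d; first exact: krull_dim_Ak.
have lAk : idl (@nu (A_ f k)) := local_trunc n_gt0 k_gt0 le_kn lS f_nu.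
have dM : dep d (fun v : M => v = 0) (fun=> True).
  by apply/dep_quot_mod; exact: dep_quotient.
split; first by have [s sz hs] := dep_regular_sequence lAk fM M0 dM; exists s.
move=> s /regular_sequence_dep/dep_quot_mod dN.
have /existsNP[v Mv] := M0; have [u eu] := quot_mod_proj_surj (v : Q).
have hU : submod (addmul (fun v : N => v = 0) (y ^+ k) (fun=> True)).
  by apply: submod_addmul; [exact: submod_eq0|].
have Uu : ~ addmul (fun v : N => v = 0) (y ^+ k) (fun=> True) u.
  move=> h; apply: Mv; rewrite -eu -[0 in RHS](raddf0 (quot_mod_proj (M := N) [:: y ^+ k])).
  by apply/quot_mod_projP/seq_mul1; rewrite subr0.
have [P [P' [h uP]]] := pchain_of_dep fN hU Uu dN.
apply: pchain_bound_yk h; apply: uP; exists u => //; exact: subrr.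
Qed.

Lemma Sigma_quot_mod (W : lmodType R) : fg_rel_projective g N -> syzygy Q W ->
  @Sigma_ S f n k W.
Proof.
move=> hN hW; apply: add_base; exists M, Q; split=> //; first exact: MCM_quot_mod.
exact: restriction_descend.
Qed.

End QuotientMCM.

(** [dep] records weak regularity, so the zero quotient has every depth. *)
Lemma dep_full (X : lmodType R) t (U : X -> Prop) : (forall x, U x) ->
  dep t U (fun=> True).
Proof.
elim: t U => // t IH U hU; exists (y ^+ k); split=> //.
by apply: IH => x; exists 0; rewrite // scaler0 subr0.
Qed.

(** The depth lemma inside P: P has depth d+1 and P/W, which is M, has depth d, so W has depth
    d+1. *)
Lemma syzygy_MCM (M : lmodType (A_ f k)) (M' X : lmodType R) :
  MCM M -> restriction M M' -> syzygy M' X -> fg_rel_projective g X.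
Proof.
move=> [fM hM] [phi [[psi phiK psiK] phiZ]] [P [i [q [fP pP [inj ker surj]]]]].
pose W p := q p = 0.
have hW : submod W.
  split; first exact: linear0.
  by move=> a u v hu hv; rewrite /W linearP hu hv scaler0 addr0.
have nP := fg_noeth fP.
have dW : dep d W (fun=> True).
  case: hM => [M0|[e /(krull_dim_uniq krull_dim_Ak) <- [[s sz hs] _]]].
    by apply: dep_full => p; apply: (can_inj phiK); exact: etrans (M0 _) (esym (M0 _)).
  have := regular_sequence_dep hs; rewrite sz.
  suff e0 : dep d W (fun=> True) <-> dep d (fun v : M => v = 0) (fun=> True) by move/e0.
  have phiE r (x : M') : phi (r *: x) = trunc k r *: phi x.
    have [p <-] := psharp_surj r.
    have -> : trunc k (psharp f n p) = quot_ring_proj [:: f%:P; 'X^k] p.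
      by rewrite truncE.
    exact: phiZ.
  apply: (@dep_transfer R (A_ f k) P M (phi \o q)).
  - by move=> u v /=; rewrite !raddfB.
  - move=> b; have [r <-] := trunc_surj n_gt0 le_kn b => /(nu_trunc n_gt0 k_gt0 le_kn lS f_nu) hr.
    by exists r => // x /=; rewrite linearZ phiE.
  - move=> r hr; exists (trunc k r); first exact/(nu_trunc n_gt0 k_gt0 le_kn lS f_nu).
    by move=> x /=; rewrite linearZ phiE.
  - by [].
  - by [].
  - exact: submod_eq0.
  - by [].
  - by [].
  - by move=> v _; have [p ep] := surj (psi v); exists p => //=; rewrite ep psiK subrr.
  move=> p _; rewrite /W /=; split=> [->|qv]; first exact: raddf0.
  by apply: (can_inj phiK); rewrite qv raddf0.
have fP' : fg_rel_projective g P by split=> //; exact: projective_res.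
have fX : fin_gen X.
  have [|l hl] := @factor_mono _ _ _ _ i (val : {linear subm hW -> P}) inj.
    by move=> z; apply/ker; exact: submP z.
  apply: (fin_gen_surj (q := l)) (noeth_fin_gen_sub nP hW) => x.
  have Wx : W (i x) by apply/ker; exists x.
  by exists (mksub hW Wx); apply: inj; rewrite hl.
apply: dep_rel_projective => //.
have dX : dep d.+1 (fun v : P => v = 0) W.
  apply: (depth_lemma nR lR nP _ hW _ _ _ dW) => //; first exact: submod_eq0.
    by move=> v ->; exact: linear0.
  exact: fg_rel_projective_dep.
suff e0 : dep d.+1 (fun v : X => v = 0) (fun=> True) <-> dep d.+1 (fun v : P => v = 0) W by apply/e0.
apply: (@dep_transfer R R X P i) => //.
- exact: raddfB.
- by move=> b hb; exists b => // x; exact: linearZ.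
- by move=> b hb; exists b => // x; exact: linearZ.
- exact: submod_eq0.
- exact: submod_eq0.
- by move=> v _; apply/ker; exists v.
- by move=> v /ker[x <-]; exists x => //; exact: subrr.
move=> v _; split=> [->|e]; first exact: linear0.
by apply: inj; rewrite e linear0.
Qed.

Lemma Sigma_rel_projective (X : lmodType R) : @Sigma_ S f n k X -> fg_rel_projective g X.
Proof.
apply: add_closure_rel_projective => Z [M [M' [hM hr hz]]]; exact: syzygy_MCM hM hr hz.
Qed.

End MCMModules.

(** * Coinduced modules *)

Section Coinduction.
Variables (S : comNzRingType) (f : S) (n : nat) (n_gt0 : (0 < n)%N).
Local Notation R := (Rsharp f n).
Local Notation y := (ysharp f n).
Local Notation g := (cst f n).

Section Construction.
Variable V : lmodType S.

(* The coinduced module Hom_S(R^#, V): a homomorphism is given by its values on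
   the basis 1, y, ..., y^(n-1), and [ev r phi] is its value at [r]. *)
Definition coind of (0 < n)%N : Type := {ffun 'I_n -> V}.
Local Notation C := (coind n_gt0).
HB.instance Definition _ := GRing.Zmodule.on C.

Definition ev (r : R) (phi : C) : V := \sum_(i < n) (lift_sharp r)`_i *: (phi : {ffun 'I_n -> V}) i.

Lemma ev_linear s r r' phi : ev (g s * r + r') phi = s *: ev r phi + ev r' phi.
Proof.
rewrite /ev scaler_sumr -big_split; apply: eq_bigr => i _ /=.
by rewrite (lift_linear n_gt0) coefD coefZ scalerDl scalerA.
Qed.

Lemma evDr r : {morph ev r : phi psi / phi + psi}.
Proof.
move=> phi psi; rewrite /ev -big_split; apply: eq_bigr => i _ /=.
by rewrite ffunE scalerDr.
Qed.

Lemma ev_exp (j : 'I_n) phi : ev (y ^+ j) phi = (phi : {ffun 'I_n -> V}) j.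
Proof.
rewrite /ev -psharpX -rmorphXn (lift_small f n_gt0) ?size_polyXn // (bigD1 j) //=.
rewrite coefXn eqxx scale1r big1 ?addr0 // => i ij.
by rewrite coefXn (negbTE (ij : nat_of_ord i != j)) scale0r.
Qed.

Lemma coindP (phi psi : C) : (forall j, (j < n)%N -> ev (y ^+ j) phi = ev (y ^+ j) psi) -> phi = psi.
Proof. by move=> h; apply/ffunP => j; rewrite -!ev_exp; apply: h. Qed.

Definition mkcoind (a : R -> V) : C := [ffun j : 'I_n => a (y ^+ j)].

Lemma lin_decomp (a : R -> V) : (forall s r r', a (g s * r + r') = s *: a r + a r') ->
  forall r, a r = \sum_(i < n) (lift_sharp r)`_i *: a (y ^+ i).
Proof.
move=> al r; have a0 : a 0 = 0.
  have := al 1 0 0; rewrite scale1r mulr0 addr0 => e.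
  by rewrite -[LHS](addrK (a 0)) -e subrr.
rewrite {1}(sharp_decomp n_gt0 r).
elim/big_rec2: _ => [//|i u v _ <-]; exact: al.
Qed.

Lemma ev_mkcoind (a : R -> V) : (forall s r r', a (g s * r + r') = s *: a r + a r') ->
  forall r, ev r (mkcoind a) = a r.
Proof.
move=> al r; rewrite (lin_decomp al) /ev; apply: eq_bigr => i _; by rewrite ffunE.
Qed.

Let scale (r : R) (phi : C) : C := mkcoind (fun r' => ev (r * r') phi).

Let ev_scale r r' phi : ev r' (scale r phi) = ev (r * r') phi.
Proof.
apply: (ev_mkcoind (a := fun r' => ev (r * r') phi)) => s u v.
by rewrite mulrDr mulrCA ev_linear.
Qed.

Let scaleA a b phi : scale a (scale b phi) = scale (a * b) phi.
Proof. by apply: coindP => j _; rewrite !ev_scale mulrCA mulrA. Qed.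
Let scale1 : left_id 1 scale.
Proof. by move=> phi; apply: coindP => j _; rewrite ev_scale mul1r. Qed.
Let scaleDr : right_distributive scale +%R.
Proof. by move=> a phi psi; apply: coindP => j _; rewrite ev_scale !evDr !ev_scale. Qed.
Let ev_add r r' phi : ev (r + r') phi = ev r phi + ev r' phi.
Proof. by rewrite -[r]mul1r -(rmorph1 g) ev_linear scale1r rmorph1 mul1r. Qed.
Let scaleDl phi : {morph scale^~ phi : a b / a + b}.
Proof. by move=> a b; apply: coindP => j _; rewrite ev_scale evDr !ev_scale mulrDl ev_add. Qed.

HB.instance Definition _ := GRing.Zmodule_isLmodule.Build R C
  scaleA scale1 scaleDr scaleDl.

Lemma evZ r r' (phi : C) : ev r' (r *: phi) = ev (r * r') phi.
Proof. exact: ev_scale. Qed.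

Lemma evMc s r (phi : C) : ev (g s * r) phi = s *: ev r phi.
Proof.
have e0 : ev 0 phi = 0.
  by have := ev_linear 1 0 0 phi; rewrite scale1r mulr0 addr0 => e; rewrite -[LHS](addrK (ev 0 phi)) -e subrr.
by rewrite -[_ * _]addr0 ev_linear e0 addr0.
Qed.

Lemma ev0r r : ev r 0 = 0.
Proof. by rewrite /ev big1 // => i _; rewrite ffunE scaler0. Qed.

Lemma ev_sum r (I : finType) (F : I -> C) : ev r (\sum_i F i) = \sum_i ev r (F i).
Proof. by apply: big_morph; [exact: evDr|exact: ev0r]. Qed.

Lemma ev_yn (phi : C) : ev (y ^+ n) phi = - (f *: ev 1 phi).
Proof. by rewrite ysharpXn -[- _]mulr1 -rmorphN evMc scaleNr. Qed.

(** The form [tcoef] identifies Hom_S(R^#, V) with the tensor product of R^# and V over S; this is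
    the image of 1 tensor v. *)
Definition delta (v : V) : C := mkcoind (fun r => tcoef r *: v).

Lemma ev_delta r v : ev r (delta v) = tcoef r *: v.
Proof.
apply: (ev_mkcoind (a := fun r => tcoef r *: v)) => s u w.
by rewrite (tcoef_linear n_gt0) scalerDl scalerA.
Qed.

Lemma delta_linear s u v : delta (s *: u + v) = g s *: delta u + delta v.
Proof.
apply: coindP => j _; rewrite evDr evZ evMc !ev_delta scalerDr !scalerA.
by rewrite mulrC.
Qed.

(** The exponents are reversed because y^i and y^(n-1-i) are dual bases for [tcoef]. *)
Lemma coind_decomp (phi : C) : phi = \sum_(i < n) y ^+ i *: delta (ev (y ^+ (n.-1 - i)) phi).
Proof.
apply: coindP => j hj; rewrite ev_sum.
have hj' : (n.-1 - j < n)%N by rewrite (leq_ltn_trans (leq_subr _ _)) // prednK.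
rewrite (bigD1 (Ordinal hj')) //= big1 ?addr0 => [|i ij].
  rewrite evZ -exprD ev_delta (tcoef_exp_add f n_gt0 hj' hj) //.
  have hj2 : (j <= n.-1)%N by rewrite -ltnS prednK.
  by rewrite subnK // eqxx scale1r subKn.
rewrite evZ -exprD ev_delta (tcoef_exp_add f n_gt0 (ltn_ord i) hj) //.
case: eqP => [e|]; last by rewrite scale0r.
case/eqP: ij; apply: val_inj => /=; by rewrite -e addnK.
Qed.

End Construction.

Lemma sharp_linear_ind (X Z : lmodType R) (h : X -> Z) : {morph h : u v / u + v} ->
  (forall s u, h (g s *: u) = g s *: h u) -> (forall u, h (y *: u) = y *: h u) -> linear h.
Proof.
move=> hD hs hy a u v; rewrite hD; congr (_ + _).
have h0 : h 0 = 0 by have := hs 0 0; rewrite rmorph0 !scale0r.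
have hyi i w : h (y ^+ i *: w) = y ^+ i *: h w.
  by elim: i w => [|i IH] w; rewrite ?expr0 ?scale1r // exprSr -!scalerA IH hy.
rewrite (sharp_decomp n_gt0 a) !scaler_suml (big_morph h hD h0); apply: eq_bigr => i _.
by rewrite -!scalerA hs hyi.
Qed.

(** Both sides are the sum of a^i F(m-i) over i <= m. When F(m) = a^m F(0), cancelling these terms
    shows that sums of this shape commute with multiplication by a. *)
Lemma shift_sum (B : comPzRingType) (X : lmodType B) (a : B) (F : nat -> X) m :
  F m + a *: (\sum_(i < m) a ^+ i *: F (m.-1 - i)%N) =
  \sum_(i < m) a ^+ i *: F (m - i)%N + a ^+ m *: F 0%N.
Proof.
transitivity (\sum_(i < m.+1) a ^+ i *: F (m - i)%N); last by rewrite big_ord_recr /= subnn.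
rewrite big_ord_recl expr0 scale1r subn0 scaler_sumr; congr (_ + _).
by apply: eq_bigr => i _; rewrite scalerA -exprS /= /bump /= add1n subnS -subn1 subnAC subn1.
Qed.

Section Extension.
Variables (V : lmodType S) (X : lmodType R) (l0 : {linear V -> res X g}).
Local Notation C := (coind V n_gt0).

(* Hom_S(R^#, V) is also induced, with unit [delta]; this is the R^#-linear
   extension of [l0] along it. *)
Definition ext_coind (phi : C) : X :=
  \sum_(i < n) y ^+ i *: (l0 (ev (y ^+ (n.-1 - i)) phi) : X).

Lemma ext_coind_linear : linear ext_coind.
Proof.
apply: sharp_linear_ind => [u v|s u|u]; rewrite /ext_coind.
- rewrite -big_split; apply: eq_bigr => i _ /=.
  by rewrite evDr linearD scalerDr.
- rewrite scaler_sumr; apply: eq_bigr => i _.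
  by rewrite evZ evMc linearZ /= resZ !scalerA mulrC.
pose F j : X := l0 (ev (y ^+ j) u).
have e := shift_sum y F n.
have eF : F n = y ^+ n *: F 0%N.
  by rewrite /F ev_yn linearN linearZ /= resZ ysharpXn scaleNr.
move: e; rewrite -eF addrC => /addIr ->; apply: eq_bigr => i _.
rewrite evZ -exprS /F; congr (_ *: (l0 (ev (y ^+ _) u) : X)).
by have := ltn_ord i; lia.
Qed.

Lemma ext_coind_delta v : ext_coind (delta v) = l0 v.
Proof.
rewrite /ext_coind (bigD1 (Ordinal n_gt0)) //= expr0 scale1r subn0 big1.
  by rewrite addr0 ev_delta (tcoef_exp f n_gt0) ?eqxx ?scale1r // prednK.
move=> i /eqP i0; rewrite ev_delta (tcoef_exp f n_gt0); last by have := ltn_ord i; lia.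
have -> : (n.-1 - i == n.-1)%N = false.
  have ip : nat_of_ord i <> 0%N by move=> e; apply: i0; exact: val_inj.
  by apply/eqP; have := ltn_ord i; lia.
by rewrite scale0r linear0 scaler0.
Qed.

End Extension.

Lemma projective_coind (V : lmodType S) : projective V ->
  projective (coind V n_gt0 : lmodType R).
Proof.
move=> pV X Y h k hs.
have kl : linear (fun v => k (delta v) : res Y g).
  by move=> s u v; rewrite delta_linear linearP.
have [l0 hl0] := pV _ _ (res_lin g h) (mklin kl) hs.
exists (mklin (ext_coind_linear l0)) => phi; rewrite /= /ext_coind.
rewrite [phi in RHS]coind_decomp !linear_sum; apply: eq_bigr => i _.
rewrite !linearZ; congr (_ *: _); exact: hl0.
Qed.

Lemma fin_gen_coind (V : lmodType S) : fin_gen V -> fin_gen (coind V n_gt0 : lmodType R).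
Proof.
move=> /fin_genP[l hl]; apply/fin_genP; exists (map (@delta V) l) => phi.
have hs := span_submod (map (@delta V) l : seq (coind V n_gt0 : lmodType R)).
rewrite [phi]coind_decomp.
elim/big_ind: _ => [|u v|i _]; [exact: submod0 hs|exact: (submodD hs)|apply: (submodZ hs)].
apply: (@span_min _ _ l (fun v => span _ (delta v : (coind V n_gt0 : lmodType R)))) (hl _).
  have d0 : delta (0 : V) = 0.
    by apply: coindP => j _; rewrite ev_delta scaler0 ev0r.
  split; first by rewrite d0; exact: submod0 hs.
  by move=> a u v hu hv; rewrite delta_linear; exact: hs.2.
by move=> u ul; apply: span_mem; exact: map_f.
Qed.

Section Resolution.
Variable N : lmodType R.
Local Notation C := (coind (res N g) n_gt0).

Definition unit_coind (v : N) : C := mkcoind (fun r => (r *: v : res N g)).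

Lemma ev_unit r v : ev r (unit_coind v) = r *: v.
Proof.
apply: (ev_mkcoind (a := fun r => (r *: v : res N g))) => s u w.
by rewrite scalerDl -scalerA.
Qed.

Lemma unit_coind_linear : linear unit_coind.
Proof.
move=> a u v; apply: coindP => j _; rewrite evDr evZ !ev_unit scalerDr scalerA.
by rewrite [_ * a]mulrC.
Qed.

(** In terms of the tensor product this is the action map, r tensor v to r v. *)
Definition counit_coind (phi : C) : N := ext_coind (idfun : {linear res N g -> res N g}) phi.

Lemma counit_coind_linear : linear counit_coind.
Proof. exact: ext_coind_linear. Qed.

Lemma counit_delta v : counit_coind (delta (v : res N g)) = v.
Proof. exact: ext_coind_delta. Qed.

(* The R^#-linear endomorphism [phi |-> y phi(-) - phi(y -)], whose kernel
   consists of the R^#-linear maps; 0 -> N -> C -> C -> N -> 0 is exact. *)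
Definition twist (phi : C) : C :=
  mkcoind (fun r => (y *: (ev r phi : N) - ev (y * r) phi : res N g)).

Lemma ev_twist r phi : ev r (twist phi) = y *: (ev r phi : N) - ev (y * r) phi.
Proof.
apply: (ev_mkcoind (a := fun r => (y *: (ev r phi : N) - ev (y * r) phi : res N g))).
move=> s u w; rewrite mulrDr mulrCA !ev_linear scalerBr resZ !resZ scalerDr.
by rewrite opprD addrACA !scalerA mulrC.
Qed.

Lemma twist_linear : linear twist.
Proof.
move=> a u v; apply: coindP => j _.
have h (a1 a2 b1 b2 : N) : y *: (a1 + a2) - (b1 + b2) = (y *: a1 - b1) + (y *: a2 - b2).
  by rewrite scalerDr opprD addrACA.
rewrite [RHS]evDr [X in _ = X + _]evZ ev_twist (ev_twist (a * _)) (ev_twist _ v).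
rewrite !evDr !evZ (mulrCA y a); exact: h.
Qed.

Lemma twist_unit v : twist (unit_coind v) = 0.
Proof. by apply: coindP => j _; rewrite ev_twist !ev_unit scalerA subrr ev0r. Qed.

Lemma twist_eq0 phi : twist phi = 0 -> exists v, unit_coind v = phi.
Proof.
move=> e; exists (ev 1 phi); apply: coindP => j _; rewrite ev_unit.
elim: j => [|j IH]; first by rewrite expr0 scale1r.
rewrite exprS -scalerA IH; apply/eqP; rewrite -subr_eq0 -ev_twist e; apply/eqP.
exact: ev0r.
Qed.

Lemma counit_twist phi : counit_coind (twist phi) = 0.
Proof.
pose F j : N := ev (y ^+ j) phi.
have := shift_sum y F n.
have -> : F n = y ^+ n *: F 0%N by rewrite /F ev_yn resZ ysharpXn scaleNr.
rewrite addrC => /addIr e.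
rewrite /counit_coind /ext_coind /=.
under eq_bigr => i _ do rewrite ev_twist scalerBr.
rewrite sumrB; apply/eqP; rewrite subr_eq0; apply/eqP.
transitivity (y *: (\sum_(i < n) y ^+ i *: F (n.-1 - i)%N)).
  rewrite scaler_sumr; apply: eq_bigr => i _; by rewrite !scalerA mulrC.
rewrite e; apply: eq_bigr => i _; rewrite -exprS /F; congr (_ *: (ev (y ^+ _) phi : N)).
by have := ltn_ord i; lia.
Qed.

(** The equation [twist psi = phi] is a recursion for the values psi(y^j), solved here from psi(1) =
    0. It is consistent when the value at y^n is -f psi(1) = 0, and that value is minus the counit
    of phi. *)
Lemma counit_eq0 phi : counit_coind phi = 0 -> exists psi, twist psi = phi.
Proof.
pose F j : N := ev (y ^+ j) phi.
pose v := fix v j : N := if j is j'.+1 then y *: v j' - F j' else 0.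
have vE m : v m = - \sum_(i < m) y ^+ i *: F (m.-1 - i)%N.
  elim: m => [|m IH]; first by rewrite big_ord0 oppr0.
  rewrite /= IH big_ord_recl expr0 scale1r subn0 scalerN opprD addrC; congr (_ - _).
  rewrite scaler_sumr; apply: eq_bigr => i _; rewrite scalerA -exprS /= /bump /= add1n.
  by congr (_ *: F _); lia.
move=> e0; have vn : v n = 0 by rewrite vE -[\sum_(i < n) _]/(counit_coind phi) e0 oppr0.
exists ([ffun j : 'I_n => v j] : {ffun 'I_n -> res N g}).
set psi : C := [ffun _ => _].
have evv j : (j <= n)%N -> ev (y ^+ j) psi = v j.
  rewrite leq_eqVlt => /orP[/eqP ->|hj].
    rewrite vn ev_yn; have := ev_exp (Ordinal n_gt0) psi; rewrite ffunE /= expr0 => ->.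
    by rewrite scaler0 oppr0.
  by have := ev_exp (Ordinal hj) psi; rewrite ffunE.
apply: coindP => j hj; rewrite ev_twist -exprS !evv //; last exact: ltnW.
by rewrite /= opprB [LHS]addrC subrK.
Qed.

End Resolution.

(* Projective R^#-modules are injective relative to S-split extensions: F is a
   summand of Hom_S(R^#, F). *)
Lemma extend_split (N P F : lmodType R) (i : {linear N -> P}) (rho : {linear res P g -> res N g})
    (h : {linear N -> F}) : (forall v, rho (i v) = v) -> projective F ->
  exists h' : {linear P -> F}, forall v, h' (i v) = h v.
Proof.
move=> rhoK pF.
pose eps : {linear _ -> F} := mklin (@counit_coind_linear F).
have [|s hs] := projective_section pF (q := eps).
  by move=> v; exists (delta (v : res F g)); exact: counit_delta.
(* An R^#-linear map into Hom_S(R^#, F) is the same as an S-linear map into F. Here the latter is p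
   |-> ev 1 (s (h (rho p))), and [a p] is the resulting function on R^#. *)
pose a (p : P) (r : R) : res F g := ev 1 (s (h (rho (r *: p)))).
have al p t r r' : a p (g t * r + r') = t *: a p r + a p r'.
  rewrite /a scalerDl -scalerA [rho _](linearP rho t) linearP linearP evDr evZ.
  by rewrite evMc.
pose k (p : P) := mkcoind (a p).
have evk p r : ev r (k p) = a p r by rewrite (ev_mkcoind (al p)).
have kl : linear k.
  move=> b u v; apply: coindP => j _; rewrite evDr evZ !evk /a scalerDr scalerA.
  by rewrite [y ^+ j * b]mulrC !linearD evDr.
exists (eps \o mklin kl) => v; rewrite -[RHS]hs /=; congr (counit_coind _).
apply: coindP => j _; rewrite evk /a -linearZ rhoK !linearZ evZ mulr1.
by [].
Qed.

End Coinduction.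

(** * Approximations *)

Section MinimalSyzygies.
Variable A : comPzRingType.
Implicit Types M N P Z : lmodType A.

Definition in_max M (x : M) := exists2 s : seq A, {subset s <= nonunit} & x \in seq_mul M s.

Lemma in_maxD M (x z : M) : in_max x -> in_max z -> in_max (x + z).
Proof.
move=> [s1 h1 /muls_seq_mul m1] [s2 h2 /muls_seq_mul/mulsP[v /eqP]].
rewrite subr_eq0 => /eqP ez; exists (s1 ++ s2).
  by move=> a; rewrite mem_cat => /orP[/h1|/h2].
apply/muls_seq_mul; rewrite /muls foldl_cat; apply/mulsP; exists v.
by rewrite {1}ez addrK.
Qed.

Lemma in_max0 M : in_max (0 : M).
Proof. by exists [::] => //; apply/muls_seq_mul. Qed.

Lemma in_maxZ M a (x : M) : nu a -> in_max (a *: x).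
Proof.
move=> ha; exists [:: a]; first by move=> b; rewrite inE => /eqP ->; apply/nuP.
by apply/muls_seq_mul; exists x => //; exact: subrr.
Qed.

Lemma in_max_sum M (I : finType) (a : I -> A) (v : I -> M) :
  (forall i, nu (a i)) -> in_max (\sum_i a i *: v i).
Proof.
move=> ha; elim/big_ind: _ => [|u w|i _]; [exact: in_max0|exact: in_maxD|exact: in_maxZ].
Qed.

Lemma minimal_syzygy_syzygy N Z : minimal_syzygy N Z -> syzygy N Z.
Proof. by move=> [P [i [q [h1 h2 h3 _]]]]; exists P, i, q. Qed.

Lemma short_exact_val M N (q : {linear M -> N}) (hq : submod (fun x => q x = 0)) :
  surjective q -> short_exact (val : {linear subm hq -> M}) q.
Proof.
move=> qs; split=> //; first exact: val_inj.
by move=> x; split=> [h|[z <-]]; [exists (mksub hq h)|exact: (submP z)].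
Qed.

Lemma ker_submod M N (q : {linear M -> N}) : submod (fun x => q x = 0).
Proof.
split; first exact: linear0.
by move=> a u v hu hv; rewrite linearP hu hv scaler0 addr0.
Qed.

Lemma minimal_syzygy_exists N : fin_gen N -> exists Z, minimal_syzygy N Z.
Proof.
move=> /fin_genP[l0 /minimal_generators[l [hl lmin]]].
pose m := size l.
pose q (r : 'rV[A]_m) : N := \sum_i r 0 i *: l`_i.
have ql : linear q.
  move=> a u v; rewrite /q scaler_sumr -big_split /=; apply: eq_bigr => i _.
  by rewrite !mxE scalerDl scalerA.
have rE (r : 'rV[A]_m) : r = \sum_i r 0 i *: delta_mx 0 i by exact: row_sum_delta.
have qs : surjective (mklin ql).
  move=> v; have [c _ ->] := comb_sum (hl v); exists (\row_i c i).
  by apply: eq_bigr => i _; rewrite mxE.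
exists (subm (ker_submod (mklin ql))), 'rV[A]_m, val, (mklin ql); split.
- exists [seq delta_mx 0 i | i <- enum 'I_m] => x.
  rewrite size_map size_enum_ord; exists (fun i => x 0 i).
  rewrite {1}[x]rE; apply: eq_bigr => i _.
  by rewrite (nth_map i) ?size_enum_ord // nth_ord_enum.
- move=> X Y h k hs.
  have [b hb] := choice (fun i => hs (k (delta_mx 0 i))).
  have ll : linear (fun r : 'rV[A]_m => \sum_i r 0 i *: b i).
    move=> a u v; rewrite scaler_sumr -big_split /=; apply: eq_bigr => i _.
    by rewrite !mxE scalerDl scalerA.
  exists (mklin ll) => r; rewrite /= [r in RHS]rE !linear_sum; apply: eq_bigr => i _.
  by rewrite !linearZ /= hb.
- exact: short_exact_val.
- move=> z; suff : in_max (\sum_i val z 0 i *: delta_mx 0 i : 'rV[A]_m) by rewrite -rE.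
  apply: in_max_sum => i.
  by apply: (lmin (fun i => val z 0 i)); exact: (submP z).
Qed.

Lemma syzygy_fin_gen N P Z (i : {linear Z -> P}) (q : {linear P -> N}) :
  noeth P -> short_exact i q -> fin_gen Z.
Proof.
move=> nP [inj ker _].
have [|l hl] := @factor_mono _ _ _ _ i (val : {linear subm (ker_submod q) -> P}) inj.
  by move=> z; apply/ker; exact: submP z.
apply: (fin_gen_surj (q := l)) (noeth_fin_gen_sub nP (ker_submod q)) => x.
have Wx : q (i x) = 0 by apply/ker; exists x.
by exists (mksub (ker_submod q) Wx); apply: inj; rewrite hl.
Qed.

(* An element of a projective module outside mP has a unit coordinate, which
   splits a free summand off any module containing it. *)
Lemma no_free_summand_in_max N P (i : {linear N -> P}) : fin_gen P -> projective P ->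
  ~ has_free_summand N -> forall v, in_max (i v).
Proof.
move=> fP pP nf v; have [l [c hc]] := projective_dual_basis pP fP.
have [h|/existsNP[j /contrapT[b hb]]] := EM (forall j, nu (c j (i v))).
  by rewrite [i v]hc.2; exact: in_max_sum.
case: nf; pose u (w : N) : A^o := c j (i w).
have ul : linear u by move=> a x z; rewrite /u linearP hc.1.
pose U := ker_submod (mklin ul); pose n1 := b *: v.
have un1 : u n1 = 1 by rewrite /u /n1 linearZ /= (dual_basisZ hc) mulrC.
have Uw w : mklin ul (w - u w *: n1) = 0.
  by rewrite linearB linearZ /= un1 /GRing.scale /= mulr1 subrr.
pose G (w : N) : (A^o * subm U)%type := (u w, mksub U (Uw w)).
have Gl : linear G.
  move=> a x z; congr pair; first exact: ul.
  apply: val_inj.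
  change (a *: x + z - u (a *: x + z) *: n1 = a *: (x - u x *: n1) + (z - u z *: n1)).
  rewrite ul scalerDl opprD addrACA scalerBr; congr (_ - _ + _).
  exact: (esym (scalerA a (u x) n1)).
exists (subm U), (mklin Gl), (fun p => p.1 *: n1 + val p.2) => [w|[r x]] /=.
  by rewrite addrC subrK.
have ux : u (r *: n1 + val x) = r.
  rewrite ul un1; have -> : u (val x) = 0 by exact: (submP x).
  by rewrite /GRing.scale /= mulr1 addr0.
congr pair => //; apply: val_inj => /=.
by rewrite [X in _ - X *: _]ux addrC addKr.
Qed.

End MinimalSyzygies.

Section Approximation.
Variables (R : comPzRingType) (a : R) (N P Z : lmodType R).
Variables (i : {linear Z -> P}) (q : {linear P -> N}).
Hypotheses (fP : fin_gen P) (pP : projective P) (iq : short_exact i q).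
Hypothesis a_reg : forall v : N, a *: v = 0 -> v = 0.

(* The preimage in P of aN. It is the pullback of P -> N along the
   multiplication by a on N. *)
Let W p := exists v, q p = a *: v.
Let hW : submod W.
Proof.
split; first by exists 0; rewrite linear0 scaler0.
move=> b x z [u eu] [v ev]; exists (b *: u + v).
by rewrite linearP eu ev scalerDr !scalerA mulrC.
Qed.
Let wP : {linear subm hW -> P} := val.

Lemma pullback_exists : exists (X : lmodType R) (j : {linear Z -> X})
    (p : {linear X -> N}) (w : {linear X -> P}),
  [/\ short_exact j p, forall z, w (j z) = i z, forall x, a *: p x = q (w x) &
      [/\ injective w, forall t v, q t = a *: v -> exists x, w x = t,
        syzygy (quot_mod N [:: a]) X &
        nu a -> (forall z, in_max (i z)) -> minimal_syzygy (quot_mod N [:: a]) X]].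
Proof.
have [inj ker qs] := iq.
have al : linear (fun v : N => a *: v).
  by move=> b u v; rewrite scalerDr !scalerA mulrC.
have ainj : injective (mklin al).
  by move=> u v /eqP; rewrite /= -subr_eq0 -scalerBr => /eqP/a_reg/eqP; rewrite subr_eq0 => /eqP.
have [|p hp] := @factor_mono _ _ _ _ (mklin al) (q \o wP) ainj.
  by move=> x; have [v ev] := submP x; exists v.
have winj : injective wP by exact: val_inj.
have [|j hj] := @factor_mono _ _ _ _ wP i winj.
  move=> z; have Wz : W (i z).
    by exists 0; rewrite scaler0; apply/ker; exists z.
  by exists (mksub hW Wz).
have wE t v : q t = a *: v -> exists x, wP x = t.
  by move=> e; have Wt : W t by [exists v]; exists (mksub hW Wt).
have ex : short_exact wP (quot_mod_proj [:: a] \o q).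
  split=> //.
    move=> t; rewrite -(raddf0 (quot_mod_proj (M := N) [:: a])); split.
      move=> /quot_mod_projP/muls_seq_mul[v _ /eqP]; rewrite subr0 subr_eq0 => /eqP.
      exact: wE.
    move=> [x <-]; apply/quot_mod_projP/muls_seq_mul; have [v ev] := submP x.
    by exists v => //; rewrite subr0 ev subrr.
  move=> v; have [u <-] := quot_mod_proj_surj v; have [t <-] := qs u.
  by exists t.
exists (subm hW), j, p, wP; split=> //.
  split.
  - by move=> z z' e; apply: inj; rewrite -!hj e.
  - move=> x; split=> [e|[z <-]].
      have /ker[z ez] : q (wP x) = 0 by rewrite -[LHS]hp e /= scaler0.
      by exists z; apply: winj; rewrite hj.
    have e : q (wP (j z)) = 0 by rewrite hj; apply/ker; exists z.
    by apply: a_reg; exact: etrans (hp (j z)) e.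
  - move=> v; have [t et] := qs (a *: v); have [x ex'] := wE _ _ et.
    by exists x; apply: ainj; rewrite hp; exact: etrans (congr1 q ex') et.
split=> //; first by exists P, wP, (quot_mod_proj [:: a] \o q).
move=> anu imax; exists P, wP, (quot_mod_proj [:: a] \o q); split=> // x.
(* W is the sum of iZ and aP, and both lie in mP. *)
have [v ev] := submP x; have [t et] := qs v.
have /ker[z ez] : q (wP x - a *: t) = 0 by rewrite linearB linearZ /= et ev subrr.
rewrite -/(in_max _) -[wP x](subrK (a *: t)) -ez.
by apply: in_maxD => //; exact: in_maxZ.
Qed.

End Approximation.

Section AddClosure.
Variables (R : comPzRingType) (C : lmodType R -> Prop).

Lemma add_closure_lift (N X : lmodType R) (q : {linear X -> N}) :
  (forall X', C X' -> forall h : {linear X' -> N},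
     exists g : {linear X' -> X}, forall x, h x = q (g x)) ->
  forall X', add_closure C X' -> forall h : {linear X' -> N},
     exists g : {linear X' -> X}, forall x, h x = q (g x).
Proof.
move=> hC X'; elim=> {X'} [X' /hC //|Y Y' [u [u' uK u'K]] _ IH|Y Y0|Y Y' _ IH _ IH'|Y Y' _ IH] h.
- have [g hg] := IH (h \o u); exists (g \o mklin (inv_linear uK u'K)) => x /=.
  by rewrite -hg /= u'K.
- by exists \0 => x; rewrite (Y0 x) !linear0.
- have [g hg] := IH (h \o inl_lin Y Y'); have [g' hg'] := IH' (h \o inr_lin Y Y').
  have ll : linear (fun p : Y * Y' => g p.1 + g' p.2).
    by move=> a u v; rewrite !linearP scalerDr addrACA.
  exists (mklin ll) => -[x x'] /=; rewrite linearD -hg -hg' /= -linearD.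
  by congr (h (_, _)); rewrite ?addr0 ?add0r.
have [g hg] := IH (h \o fst_lin Y Y'); exists (g \o inl_lin Y Y') => x.
by rewrite -hg.
Qed.

Lemma add_closure_extend (N X : lmodType R) (j : {linear N -> X}) :
  (forall X', C X' -> forall h : {linear N -> X'},
     exists g : {linear X -> X'}, forall x, h x = g (j x)) ->
  forall X', add_closure C X' -> forall h : {linear N -> X'},
     exists g : {linear X -> X'}, forall x, h x = g (j x).
Proof.
move=> hC X'; elim=> {X'} [X' /hC //|Y Y' [u [u' uK u'K]] _ IH|Y Y0|Y Y' _ IH _ IH'|Y Y' _ IH] h.
- have [g hg] := IH (mklin (inv_linear uK u'K) \o h); exists (u \o g) => x /=.
  by rewrite -hg /= u'K.
- by exists \0 => x; exact: etrans (Y0 _) (esym (Y0 _)).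
- have [g hg] := IH (fst_lin Y Y' \o h); have [g' hg'] := IH' (snd_lin Y Y' \o h).
  have ll : linear (fun p : X => (g p, g' p)).
    by move=> a u v; rewrite !linearP.
  by exists (mklin ll) => x /=; rewrite -hg -hg' /=; case: (h x).
have [g hg] := IH (inl_lin Y Y' \o h); exists (fst_lin Y Y' \o g) => x /=.
by rewrite -hg.
Qed.

End AddClosure.

Section Approximations.
Variables (S : comNzRingType) (f : S) (n d k : nat).
Hypotheses (hS : regular_local_ring S d.+1) (f_neq0 : f != 0).
Hypotheses (n_gt0 : (0 < n)%N) (le_kn : (k <= n)%N).
Local Notation R := (Rsharp f n).
Local Notation y := (ysharp f n).
Local Notation g := (cst f n).
Local Notation Sigma := (@Sigma_ S f n k).

Lemma restriction_kill (M : lmodType (A_ f k)) (M' : lmodType R) : restriction M M' ->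
  forall x : M', y ^+ k *: x = 0.
Proof.
move=> [phi [[psi phiK _] phiZ]] x; apply: (can_inj phiK).
have -> : y ^+ k = quot_ring_proj [:: f%:P + 'X^n] 'X^k :> R.
  by rewrite -psharpX -rmorphXn.
rewrite phiZ raddf0.
have -> : quot_ring_proj [:: f%:P; 'X^k] 'X^k = 0 :> A_ f k.
  change (ptrunc f k 'X^k = 0); rewrite -(rmorph0 (ptrunc f k)).
  by apply/ptrunc_eq; exists 0, 1; rewrite mul0r mul1r !add0r.
exact: scale0r.
Qed.

Lemma syzygy_scale (A : comPzRingType) (a : A) (M P X : lmodType A)
    (i : {linear X -> P}) (q : {linear P -> M}) :
  short_exact i q -> (forall x : M, a *: x = 0) ->
  exists e : {linear P -> X}, forall p, i (e p) = a *: p.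
Proof.
move=> [inj ker _] aM.
have al : linear (fun p : P => a *: p).
  by move=> b u v; rewrite scalerDr !scalerA mulrC.
have [|e he] := @factor_mono _ _ _ _ i (mklin al) inj.
  by move=> p; apply/ker; rewrite /= linearZ; exact: aM.
by exists e.
Qed.

(** Subtracting an S-linear section of q projects P onto Z; this retraction is the input of
    [extend_split]. *)
Lemma rel_projective_split (N P Z : lmodType R) (i : {linear Z -> P}) (q : {linear P -> N}) :
  short_exact i q -> projective (res N g) ->
  exists rho : {linear res P g -> res Z g}, forall z, rho (i z) = z.
Proof.
move=> [inj ker qs] pN.
have [s hs] := projective_section pN (q := res_lin g q) qs.
have rl : linear (fun t : res P g => t - s (q t) : res P g).
  move=> a u v; rewrite (linearP (res_lin g q)) linearP /= scalerBr opprD addrACA.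
  by [].
have [|rho hrho] := @factor_mono _ _ _ _ (res_lin g i) (mklin rl) inj.
  by move=> t; apply/ker; rewrite /= linearB; apply/eqP; rewrite subr_eq0; apply/eqP/esym/hs.
exists rho => z; apply: inj; have := hrho (i z); rewrite /= => ->.
have -> : q (i z) = 0 by apply/ker; exists z.
by rewrite (linear0 s) subr0.
Qed.

Section Pullback.
Variables (N P Z X : lmodType R) (i : {linear Z -> P}) (q : {linear P -> N}).
Variables (j : {linear Z -> X}) (p : {linear X -> N}) (w : {linear X -> P}).
Hypotheses (iq : short_exact i q) (jp : short_exact j p).
Hypotheses (wj : forall z, w (j z) = i z) (pw : forall x, y ^+ k *: p x = q (w x)).
Hypotheses (winj : injective w)
  (wE : forall t v, q t = y ^+ k *: v -> exists x, w x = t).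
Hypothesis (hN : fg_rel_projective g N).

Let yk_inj (u v : N) : y ^+ k *: u = y ^+ k *: v -> u = v.
Proof.
move=> /eqP; rewrite -subr_eq0 -scalerBr => /eqP e; apply/eqP; rewrite -subr_eq0; apply/eqP.
exact: (rel_projective_regular hS f_neq0 n_gt0 le_kn hN).
Qed.

(* If X' is the kernel of P' -> M' with y^k M' = 0, then y^k P' lies in X', so
   y^k h extends to P' and hence lifts to P; its restriction to X' is the
   required map into the pullback. *)
Lemma pullback_lift X' : Sigma X' -> forall h : {linear X' -> N},
  exists u : {linear X' -> X}, forall x, h x = p (u x).
Proof.
apply: add_closure_lift => {}X' [M [M' [_ hr [P' [i' [q' [_ pP' iq']]]]]]] h.
have [e he] := syzygy_scale iq' (restriction_kill hr).
have [_ _ qs] := iq; have [inj' _ _] := iq'.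
have [L hL] := pP' _ _ q (h \o e) qs.
have ei x : e (i' x) = y ^+ k *: x by apply: inj'; rewrite he linearZ.
have qL x : q (L (i' x)) = y ^+ k *: h x by rewrite hL /= ei linearZ.
have [|u hu] := @factor_mono _ _ _ _ w (L \o i') winj.
  by move=> x; exact: wE (qL x).
by exists u => x; apply: yk_inj; rewrite pw hu /= qL.
Qed.

(* The pullback is iZ + y^k P; a map h : Z -> X' extends to h' : P -> P', and
   h' sends y^k P to y^k P', inside X'. *)
Lemma pullback_extend X' : Sigma X' -> forall h : {linear Z -> X'},
  exists u : {linear X -> X'}, forall z, h z = u (j z).
Proof.
apply: add_closure_extend => {}X' [M [M' [_ hr [P' [i' [q' [_ pP' iq']]]]]]] h.
have [inj ker qs] := iq; have [inj' _ _] := iq'.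
have [e he] := syzygy_scale iq' (restriction_kill hr).
have [rho rhoK] := rel_projective_split iq hN.2.
have [h' hh'] := extend_split n_gt0 (i' \o h) rhoK pP'.
have [|u hu] := @factor_mono _ _ _ _ i' (h' \o w) inj'.
  move=> x; have [t et] := qs (p x).
  have /ker[z ez] : q (w x - y ^+ k *: t) = 0 by rewrite linearB linearZ -pw et subrr.
  exists (h z + e (h' t)); rewrite linearD he /=.
  by rewrite -[w x](subrK (y ^+ k *: t)) -ez linearD hh' linearZ.
by exists u => z; apply: inj'; rewrite hu /= wj hh'.
Qed.

End Pullback.

(* The second half 0 -> N -> P' -> Z -> 0 of the 2-periodic resolution, for
   an arbitrary syzygy Z of N: P' = {(phi, t) | twist phi + mu t = 0} in
   Hom_S(R^#, N) x P, where mu lifts P -> N along the counit. *)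
Lemma cosyzygy_exists (N P Z : lmodType R) (i : {linear Z -> P}) (q : {linear P -> N}) :
  fin_gen P -> projective P -> short_exact i q -> fg_rel_projective g N ->
  exists (P' : lmodType R) (i' : {linear N -> P'}) (q' : {linear P' -> Z}),
    [/\ fin_gen P', projective P' & short_exact i' q'].
Proof.
move=> fP pP [inj ker qs] [fN pN].
pose C : lmodType R := coind (res N g) n_gt0.
pose eps : {linear C -> N} := mklin (@counit_coind_linear _ f n n_gt0 N).
pose D : {linear C -> C} := mklin (@twist_linear _ f n n_gt0 N).
pose eta : {linear N -> C} := mklin (@unit_coind_linear _ f n n_gt0 N).
have epss : surjective eps.
  by move=> v; exists (delta f n_gt0 (v : res N g)); exact: counit_delta.
have [mu hmu] := pP _ _ eps q epss.
have Tl : linear (fun x : C * P => D x.1 + mu x.2).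
  by move=> a u v; rewrite !linearP scalerDr addrACA.
pose T := mklin Tl; pose hT := ker_submod T.
have TE x : T x = D x.1 + mu x.2 by [].
have epsD phi : eps (D phi) = 0 by exact: counit_twist.
have Deta v : D (eta v) = 0 by exact: twist_unit.
have epsK phi : eps phi = 0 -> exists psi, D psi = phi by exact: counit_eq0.
have Ts : surjective T.
  move=> c; have [t et] := qs (eps c).
  have [|psi epsi] := epsK (c - mu t); first by rewrite linearB hmu et subrr.
  by exists (psi, t); rewrite TE epsi subrK.
(* A projective target splits [T], so its kernel is a summand of the projective product of C and
   P. *)
have pC : projective C by exact: projective_coind.
have fC : fin_gen C by apply: fin_gen_coind; apply/(fin_gen_res n_gt0).
have [s hs] := projective_section pC Ts.
have rT x : T (x - s (T x)) = 0 by rewrite linearB hs subrr.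
have rl : linear (fun x => mksub hT (rT x)).
  move=> a u v; apply: val_inj.
  change (a *: u + v - s (T (a *: u + v)) = a *: (u - s (T u)) + (v - s (T v))).
  by rewrite (linearP T) (linearP s) scalerBr opprD addrACA.
have rK : cancel (val : {linear subm hT -> (C * P)%type}) (mklin rl).
  move=> x; apply: val_inj.
  change (val x - s (T (val x)) = val x).
  by rewrite (submP x : T (val x) = 0) linear0 subr0.
have eta0 v : T (eta v, 0) = 0 by rewrite TE Deta linear0 addr0.
have il : linear (fun v => mksub hT (eta0 v)).
  by move=> a u v; apply: val_inj; congr pair; [exact: linearP|rewrite /= scaler0 addr0].
(* For (phi, t) in the kernel, q t = eps (mu t) = -eps (D phi) = 0, so t comes from Z. The kernel of
   this projection is given by t = 0 and D phi = 0, which singles out N. *)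
have [|q' hq'] := @factor_mono _ _ _ _ i (snd_lin C P \o (val : {linear subm hT -> (C * P)%type})) inj.
  move=> x; apply/ker; rewrite /= -hmu.
  have /eqP := submP x; rewrite TE addrC addr_eq0 => /eqP ->.
  by rewrite linearN epsD oppr0.
exists (subm hT), (mklin il), q'; split.
- apply: (fin_gen_surj (q := mklin rl)) (fin_gen_prod fC fP) => x.
  by exists (val x); exact: rK.
- exact: projective_retract rK (projective_prod pC pP).
split.
- move=> u v /(congr1 val)/(congr1 fst) e.
  rewrite -[u]scale1r -[v]scale1r -(ev_unit n_gt0 1 u) -(ev_unit n_gt0 1 v).
  exact: (congr1 (fun c : coind (res N g) n_gt0 => ev 1 c : N) e).
- move=> x; split=> [e|[v <-]].
    have x2 : (val x).2 = 0 by have := hq' x; rewrite e linear0.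
    have := submP x; rewrite TE x2 linear0 addr0 => /twist_eq0[v ev0].
    exists v; apply: val_inj; rewrite /= [RHS]surjective_pairing -ev0 x2.
    by [].
  by apply: inj; rewrite hq' linear0.
move=> z; have [|psi epsi] := epsK (- mu (i z)).
  by rewrite linearN hmu; apply/eqP; rewrite oppr_eq0; apply/eqP/ker; exists z.
have hz : T (psi, i z) = 0 by rewrite TE epsi addNr.
by exists (mksub hT hz); apply: inj; rewrite hq'.
Qed.

Lemma syzygy_rel_projective (N P Z : lmodType R) (i : {linear Z -> P}) (q : {linear P -> N}) :
  fin_gen P -> projective P -> short_exact i q -> fg_rel_projective g N ->
  fg_rel_projective g Z.
Proof.
move=> fP pP iq [fN pN]; have [inj ker qs] := iq.
split; first by apply: syzygy_fin_gen iq; exact: (fg_noeth hS n_gt0 fP).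
have [rho rhoK] := rel_projective_split iq pN.
exact: (@projective_retract _ _ _ (res_lin g i) rho) (projective_res n_gt0 fP pP).
Qed.

End Approximations.

Theorem theoremA (d n : nat) (S : comNzRingType) (f : S)
    (hS : regular_local_ring S d.+1) (f_neq0 : f != 0)
    (f_nonunit : f \in nonunit) (hn : (2 <= n)%N)
    (k : nat) (hk : (1 <= k <= n)%N) :
  functorially_finite_in (@MCM (Rsharp f n)) (@Sigma_ S f n k) /\
  forall N : lmodType (Rsharp f n), MCM N ->
    [/\ exists Z : lmodType (Rsharp f n), minimal_syzygy N Z,
        forall Z : lmodType (Rsharp f n), syzygy N Z ->
          exists (W : lmodType (Rsharp f n))
                 (i : {linear Z -> W}) (q : {linear W -> N}),
            [/\ syzygy (quot_mod N [:: ysharp f n ^+ k]) W,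
                minimal_syzygy N Z ->
                  minimal_syzygy (quot_mod N [:: ysharp f n ^+ k]) W,
                short_exact i q &
                right_approximation (@Sigma_ S f n k) q] &
        forall Z : lmodType (Rsharp f n), syzygy N Z ->
          exists (W : lmodType (Rsharp f n))
                 (j : {linear N -> W}) (p : {linear W -> Z}),
            [/\ syzygy (quot_mod Z [:: ysharp f n ^+ k]) W,
                ~ has_free_summand N ->
                  minimal_syzygy (quot_mod Z [:: ysharp f n ^+ k]) W,
                short_exact j p &
                left_approximation (@Sigma_ S f n k) j]].
Proof.
have n_gt0 : (0 < n)%N by exact: leq_trans hn.
have [k_gt0 le_kn] := andP hk.
have f_nu : nu f by apply/nuP.
have lS : idl (@nu S) by case: (regular_localP hS).
have nuyk := nu_yk n_gt0 k_gt0 lS f_nu.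
have MCMP := MCM_rel_projective hS f_nu n_gt0.
have hSig := Sigma_quot_mod hS f_neq0 f_nu n_gt0 k_gt0 le_kn.
have reg N hN v := @rel_projective_regular S f n d k hS f_neq0 n_gt0 le_kn N v hN.
have right N : MCM N -> forall Z, syzygy N Z -> exists (W : lmodType (Rsharp f n))
                 (i : {linear Z -> W}) (q : {linear W -> N}),
            [/\ syzygy (quot_mod N [:: ysharp f n ^+ k]) W,
                minimal_syzygy N Z ->
                  minimal_syzygy (quot_mod N [:: ysharp f n ^+ k]) W,
                short_exact i q &
                right_approximation (@Sigma_ S f n k) q].
  move=> /MCMP hN Z sZ.
  (* The same W must serve both syzygy claims, so a presentation with Z inside mP is chosen whenever
     Z has one. *)
  have [P [i [q [fP pP iq hmin]]]] : exists (P : lmodType (Rsharp f n))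
      (i : {linear Z -> P}) (q : {linear P -> N}),
      [/\ fin_gen P, projective P, short_exact i q &
          minimal_syzygy N Z -> forall z, in_max (i z)].
    have [mZ|mZ] := EM (minimal_syzygy N Z).
      by have [P [i [q [h1 h2 h3 h4]]]] := mZ; exists P, i, q.
    by have [P [i [q [h1 h2 h3]]]] := sZ; exists P, i, q.
  have [W [j [p [w [jp wj pw [winj wE sW mW]]]]]] := pullback_exists fP pP iq (reg N hN).
  exists W, j, p; split=> //; first by move=> /hmin; exact: mW.
  split; first exact: hSig hN sW.
  exact: (pullback_lift hS f_neq0 n_gt0 le_kn iq pw winj wE hN).
have left N : MCM N -> forall Z, syzygy N Z -> exists (W : lmodType (Rsharp f n))
                 (j : {linear N -> W}) (p : {linear W -> Z}),
            [/\ syzygy (quot_mod Z [:: ysharp f n ^+ k]) W,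
                ~ has_free_summand N ->
                  minimal_syzygy (quot_mod Z [:: ysharp f n ^+ k]) W,
                short_exact j p &
                left_approximation (@Sigma_ S f n k) j].
  move=> /MCMP hN Z [P0 [i0 [q0 [fP0 pP0 iq0]]]].
  have hZ := syzygy_rel_projective hS n_gt0 fP0 pP0 iq0 hN.
  (* The roles change: N is now a syzygy of Z, and the pullback is taken along y^k on Z. *)
  have [P [i [q [fP pP iq]]]] := cosyzygy_exists n_gt0 fP0 pP0 iq0 hN.
  have [W [j [p [w [jp wj pw [winj wE sW mW]]]]]] := pullback_exists fP pP iq (reg Z hZ).
  exists W, j, p; split=> //.
    by move=> nf; apply: mW => // z; exact: no_free_summand_in_max.
  split; first exact: hSig hZ sW.
  exact: (pullback_extend n_gt0 iq wj pw hZ).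
have min N : MCM N -> exists Z : lmodType (Rsharp f n), minimal_syzygy N Z.
  by move=> [fN _]; exact: minimal_syzygy_exists.
split; last by move=> N hN; split; [exact: min|exact: right|exact: left].
split.
  by move=> X /(Sigma_rel_projective hS f_neq0 f_nu n_gt0 k_gt0 le_kn) /MCMP.
move=> N hN; have [Z /minimal_syzygy_syzygy sZ] := min N hN.
have [W [i [q [_ _ _ hq]]]] := right N hN Z sZ.
have [W' [j [p [_ _ _ hj]]]] := left N hN Z sZ.
by split; [exists W, q|exists W', j].
Qed.
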